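(* Let $F\colon\mathcal C\to\mathcal D$ be a perfect tensor functor between finite tensor categories and $\mathcal M$ a unimodular $\mathcal D$-module category with unimodular structure $\tilde u\colon\mathrm{id}_{\mathcal M}\Rightarrow D_{\mathcal D^*_{\mathcal M}}$. The $\mathcal C$-module category ${}_F\mathcal M$ is unimodular if and only if $F$ is Frobenius with respect to $\mathcal M$. In that case, ${}_F\mathcal M$ is endowed with a unimodular structure given by the composite $$\mathrm{id}_{\mathcal M}=F^*(\mathrm{id}_{\mathcal M})\xrightarrow{F^*(\tilde u)}F^*\bigl(D_{\mathcal D^*_{\mathcal M}}\bigr)\cong D_{\mathcal C^*_{{}_F\mathcal M}}.$$ In particular, if $F$ is $\otimes$-Frobenius, then the $\mathcal C$-module category ${}_F\mathcal M$ is unimodular.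
   Context: Work over an algebraically closed field $\Bbbk$. A finite multitensor category is a finite $\Bbbk$-linear abelian rigid monoidal category with bilinear tensor product; it is a finite tensor category if also $\mathrm{End}(\mathbb 1)\cong\Bbbk$. A tensor functor is an exact $\Bbbk$-linear strong monoidal functor. $F^{\mathrm{la}},F^{\mathrm{ra}}$ are adjoints, $F^{\mathrm{rra}}=(F^{\mathrm{ra}})^{\mathrm{ra}}$. $F$ is perfect if $F^{\mathrm{ra}}$ is exact. Let ${}_F\mathcal D_F$ be $\mathcal D$ as a $\mathcal C$-bimodule category via $F(c)\otimes d\otimes F(c')$; $F\colon\mathcal C\to{}_F\mathcal D_F$ and its iterated adjoints are $\mathcal C$-bimodule functors. $F$ is $\otimes$-Frobenius if $F^{\mathrm{la}}\cong F^{\mathrm{ra}}$ as $\mathcal C$-bimodule functors. A $\mathcal D$-module category (finite $\Bbbk$-linear category with $\mathcal D$-action exact in each variable) is exact if $p\triangleright m$ is projective for all projective $p\in\mathcal D$ and all $m$. ${}_F\mathcal M$ is $\mathcal M$ with $\mathcal C$-action $c\triangleright^Fm=F(c)\triangleright m$ (exact if $\mathcal M$ is exact and $F$ perfect). For a $\mathcal D$-module functor $H$, $F^*(H)$ is $H$ viewed as a $\mathcal C$-module functor between $F$-twisted categories. For exact $\mathcal M$, $\mathcal D^*_{\mathcal M}=\mathrm{Fun}_{\mathcal D}(\mathcal M,\mathcal M)$ is a finite multitensor category under composition. The distinguished invertible object of a finite multitensor category $\mathcal A$ is $D_{\mathcal A}=\int_{y\in\mathcal A}\mathrm{Hom}(y,\mathbb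 1)\otimes_\Bbbk y$. A unimodular structure on an exact $\mathcal D$-module category $\mathcal M$ is an isomorphism of module functors $\mathrm{id}_{\mathcal M}\cong D_{\mathcal D^*_{\mathcal M}}$; $\mathcal M$ is unimodular if it has one. The relative modular object $\chi_F:=F^{\mathrm{rra}}(\mathbb 1)\in\mathcal D$ carries the half-braiding $\sigma_c\colon\chi_F\otimes F(c)\cong F^{\mathrm{rra}}(c)\cong F(c)\otimes\chi_F$ from the bimodule structure of $F^{\mathrm{rra}}$, making $\chi_F\triangleright-\colon{}_F\mathcal M\to{}_F\mathcal M$ a $\mathcal C$-module functor via $\sigma_c\triangleright\mathrm{id}$. $F$ is Frobenius with respect to $\mathcal M$ if $\chi_F\triangleright-\cong\mathrm{id}_{{}_F\mathcal M}$ as $\mathcal C$-module functors. In the displayed composite, the last isomorphism is obtained from the isomorphism of $\mathcal C$-module functors $\chi_F\triangleright F^*(D^{-1}_{\mathcal D^*_{\mathcal M}})\cong D^{-1}_{\mathcal C^*_{{}_F\mathcal M}}$ (valid for any perfect $F$ and exact $\mathcal M$) and a chosen trivialization of $\chi_F\triangleright-$. *)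

(* Defs.v *)
From HB Require Import structures.
From mathcomp Require Import all_boot all_algebra boolp.

Set Implicit Arguments.
Unset Strict Implicit.
Unset Printing Implicit Defensive.

Import GRing.Theory.
Local Open Scope ring_scope.

Declare Scope tcat_scope.
Delimit Scope tcat_scope with TC.
Reserved Notation "g ∘ f" (at level 40, left associativity).
Reserved Notation "x ⊗ y" (at level 30, right associativity).
Reserved Notation "f ⊠ g" (at level 30, right associativity).
Reserved Notation "c ▷ m" (at level 30, right associativity).
Reserved Notation "f ▶ g" (at level 30, right associativity).

Record linCat (k : fieldType) := LinCat {
  ob :> Type;
  hom : ob -> ob -> lmodType k;
  idm : forall x, hom x x;
  comp : forall x y z, hom y z -> hom x y -> hom x z;
  comp_idl : forall x y (f : hom x y), comp (idm y) f = f;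
  comp_idr : forall x y (f : hom x y), comp f (idm x) = f;
  comp_assoc : forall x y z w (h : hom z w) (g : hom y z) (f : hom x y),
    comp h (comp g f) = comp (comp h g) f;
  comp_linl : forall x y z (f : hom x y), linear (fun g : hom y z => comp g f);
  comp_linr : forall x y z (g : hom y z), linear (fun f : hom x y => comp g f)
}.
Arguments hom {k l} x y.
Arguments idm {k l} x.
Arguments comp {k l x y z} g f.
Notation "g ∘ f" := (comp g f) : tcat_scope.
Local Open Scope tcat_scope.

Definition is_inverse k (A : linCat k) (x y : A) (f : hom x y) (g : hom y x) :=
  g ∘ f = idm x /\ f ∘ g = idm y.

Definition is_iso k (A : linCat k) (x y : A) (f : hom x y) :=
  exists g, is_inverse f g.

(** The inverse of an isomorphism, with the junk value [0] for a morphism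
    that is not invertible. *)
Definition inv k (A : linCat k) (x y : A) (f : hom x y) : hom y x :=
  if pselect (is_iso f) is left h then projT1 (cid h) else 0.

Definition isomorphic k (A : linCat k) (x y : A) := exists f : hom x y, is_iso f.

Record functor k (A B : linCat k) := Functor {
  fob :> A -> B;
  fmap : forall x y, hom x y -> hom (fob x) (fob y);
  fmap_id : forall x, fmap (idm x) = idm (fob x);
  fmap_comp : forall x y z (g : hom y z) (f : hom x y),
    fmap (g ∘ f) = fmap g ∘ fmap f;
  fmap_linear : forall x y, linear (@fmap x y)
}.
Arguments fmap {k A B} F {x y} _ : rename.

Definition is_natural k (A B : linCat k) (F G : functor A B)
    (a : forall x, hom (F x) (G x)) :=
  forall x y (f : hom x y), fmap G f ∘ a x = a y ∘ fmap F f.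

Record adjunction k (A B : linCat k) (L : functor A B) (R : functor B A) :=
  Adjunction {
  adj_unit : forall x : A, hom x (R (L x));
  adj_counit : forall y : B, hom (L (R y)) y;
  adj_unit_nat : forall x x' (f : hom x x'),
    fmap R (fmap L f) ∘ adj_unit x = adj_unit x' ∘ f;
  adj_counit_nat : forall y y' (g : hom y y'),
    g ∘ adj_counit y = adj_counit y' ∘ fmap L (fmap R g);
  adj_triL : forall x, adj_counit (L x) ∘ fmap L (adj_unit x) = idm (L x);
  adj_triR : forall y, fmap R (adj_counit y) ∘ adj_unit (R y) = idm (R y)
}.

Section Abelian.
Variables (k : fieldType) (A : linCat k).

Definition is_zero_ob (z : A) := idm z = 0.

Definition is_biproduct (x y s : A) :=
  exists (i : hom x s) (j : hom y s) (p : hom s x) (q : hom s y),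
    [/\ p ∘ i = idm x, q ∘ j = idm y & i ∘ p + j ∘ q = idm s].

Definition is_kernel (z x y : A) (i : hom z x) (f : hom x y) :=
  f ∘ i = 0 /\
  forall w (g : hom w x), f ∘ g = 0 -> exists! h : hom w z, i ∘ h = g.

Definition is_cokernel (x y z : A) (p : hom y z) (f : hom x y) :=
  p ∘ f = 0 /\
  forall w (g : hom y w), g ∘ f = 0 -> exists! h : hom z w, h ∘ p = g.

Definition is_mono (x y : A) (f : hom x y) :=
  forall w (g h : hom w x), f ∘ g = f ∘ h -> g = h.

Definition is_epi (x y : A) (f : hom x y) :=
  forall w (g h : hom y w), g ∘ f = h ∘ f -> g = h.

Definition is_abelian :=
  [/\ exists z, is_zero_ob z,
      forall x y, exists s, is_biproduct x y s,
      forall x y (f : hom x y), (exists z (i : hom z x), is_kernel i f) /\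
                                (exists z (p : hom y z), is_cokernel p f),
      forall x y (f : hom x y), is_mono f -> exists z (g : hom y z), is_kernel f g &
      forall x y (f : hom x y), is_epi f -> exists z (g : hom z x), is_cokernel f g].

Definition is_simple (s : A) :=
  ~ is_zero_ob s /\
  forall x (f : hom x s), is_mono f -> is_zero_ob x \/ is_iso f.

Inductive finite_length : A -> Prop :=
| FL_zero x : is_zero_ob x -> finite_length x
| FL_ext y x s (i : hom y x) (p : hom x s) :
    finite_length y -> is_simple s -> is_kernel i p -> is_cokernel p i ->
    finite_length x.

Definition is_projective (p : A) :=
  forall x y (e : hom x y) (f : hom p y), is_epi e -> exists g, e ∘ g = f.

Definition fin_dim (V : lmodType k) :=
  exists n (b : 'I_n -> V), forall v, exists a : 'I_n -> k, v = \sum_i a i *: b i.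

Definition is_finite :=
  [/\ is_abelian,
      forall x y : A, fin_dim (hom x y),
      forall x, finite_length x,
      forall x, exists p (e : hom p x), is_projective p /\ is_epi e &
      exists n (s : 'I_n -> A), forall x, is_simple x -> exists i, isomorphic x (s i)].

End Abelian.

Definition left_exact k (A B : linCat k) (F : functor A B) :=
  forall z x y (i : hom z x) (f : hom x y),
    is_kernel i f -> is_kernel (fmap F i) (fmap F f).

Definition right_exact k (A B : linCat k) (F : functor A B) :=
  forall x y z (p : hom y z) (f : hom x y),
    is_cokernel p f -> is_cokernel (fmap F p) (fmap F f).

Definition is_exact k (A B : linCat k) (F : functor A B) :=
  left_exact F /\ right_exact F.

Record monCat (k : fieldType) := MonCat {
  mon_cat :> linCat k;
  tens : mon_cat -> mon_cat -> mon_cat;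
  tensm : forall x x' y y' : mon_cat,
    hom x x' -> hom y y' -> hom (tens x y) (tens x' y');
  one : mon_cat;
  assoc : forall x y z, hom (tens (tens x y) z) (tens x (tens y z));
  lunit : forall x, hom (tens one x) x;
  runit : forall x, hom (tens x one) x;
  tensm_id : forall x y, tensm (idm x) (idm y) = idm (tens x y);
  tensm_comp : forall x x' x'' y y' y'' (f' : hom x' x'') (f : hom x x')
      (g' : hom y' y'') (g : hom y y'),
    tensm (f' ∘ f) (g' ∘ g) = tensm f' g' ∘ tensm f g;
  tensm_linl : forall x x' y y' (g : hom y y'),
    linear (fun f : hom x x' => tensm f g);
  tensm_linr : forall x x' y y' (f : hom x x'),
    linear (fun g : hom y y' => tensm f g);
  assoc_iso : forall x y z, is_iso (assoc x y z);
  assoc_nat : forall x x' y y' z z' (f : hom x x') (g : hom y y') (h : hom z z'),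
    assoc x' y' z' ∘ tensm (tensm f g) h = tensm f (tensm g h) ∘ assoc x y z;
  lunit_iso : forall x, is_iso (lunit x);
  lunit_nat : forall x x' (f : hom x x'), lunit x' ∘ tensm (idm one) f = f ∘ lunit x;
  runit_iso : forall x, is_iso (runit x);
  runit_nat : forall x x' (f : hom x x'), runit x' ∘ tensm f (idm one) = f ∘ runit x;
  mon_pentagon : forall w x y z,
    assoc w x (tens y z) ∘ assoc (tens w x) y z =
    tensm (idm w) (assoc x y z) ∘ assoc w (tens x y) z ∘ tensm (assoc w x y) (idm z);
  mon_triangle : forall x y,
    tensm (idm x) (lunit y) ∘ assoc x one y = tensm (runit x) (idm y)
}.
Arguments one {k A} : rename.
Arguments assoc {k A} x y z : rename.
Arguments lunit {k A} x : rename.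
Arguments runit {k A} x : rename.
Notation "x ⊗ y" := (tens x y) : tcat_scope.
Notation "f ⊠ g" := (tensm f g) : tcat_scope.

Section Rigid.
Variables (k : fieldType) (A : monCat k).

(** [y] is a left dual of [x], equivalently [x] is a right dual of [y]. *)
Definition is_dual (x y : A) :=
  exists (ev : hom (y ⊗ x) one) (coev : hom one (x ⊗ y)),
    runit x ∘ (idm x ⊠ ev) ∘ assoc x y x ∘ (coev ⊠ idm x) ∘ inv (lunit x) = idm x /\
    lunit y ∘ (ev ⊠ idm y) ∘ inv (assoc y x y) ∘ (idm y ⊠ coev) ∘ inv (runit y)
      = idm y.

Definition is_rigid :=
  forall x : A, (exists y, is_dual x y) /\ (exists y, is_dual y x).

Definition finite_multitensor := is_finite A /\ is_rigid.

Definition finite_tensor :=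
  finite_multitensor /\
  forall f : hom (@one k A) one, exists! a : k, f = a *: idm one.

Record inverse_ob (x : A) := InverseOb {
  iv_ob : A;
  iv_l : hom (iv_ob ⊗ x) one;
  iv_r : hom (x ⊗ iv_ob) one;
  iv_l_iso : is_iso iv_l;
  iv_r_iso : is_iso iv_r
}.

End Rigid.

Record monFunctor k (C D : monCat k) := MonFunctor {
  mon_fun :> functor C D;
  mu : forall x y, hom (mon_fun x ⊗ mon_fun y) (mon_fun (x ⊗ y));
  eps : hom one (mon_fun one);
  mu_iso : forall x y, is_iso (mu x y);
  eps_iso : is_iso eps;
  mu_nat : forall x x' y y' (f : hom x x') (g : hom y y'),
    fmap mon_fun (f ⊠ g) ∘ mu x y = mu x' y' ∘ (fmap mon_fun f ⊠ fmap mon_fun g);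
  mu_assoc : forall x y z,
    fmap mon_fun (assoc x y z) ∘ mu (x ⊗ y) z ∘ (mu x y ⊠ idm (mon_fun z)) =
    mu x (y ⊗ z) ∘ (idm (mon_fun x) ⊠ mu y z)
      ∘ assoc (mon_fun x) (mon_fun y) (mon_fun z);
  mu_lunit : forall x,
    fmap mon_fun (lunit x) ∘ mu one x ∘ (eps ⊠ idm (mon_fun x)) = lunit (mon_fun x);
  mu_runit : forall x,
    fmap mon_fun (runit x) ∘ mu x one ∘ (idm (mon_fun x) ⊠ eps) = runit (mon_fun x)
}.

(** [V ⊗_k x], via its universal property
    [hom (V ⊗_k x) z = Hom_k (V, hom x z)]. *)
Record copower k (A : linCat k) (V : lmodType k) (x : A) := Copower {
  cp_ob :> A;
  cp_in : {linear V -> hom x cp_ob};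
  cp_desc : forall z, {linear V -> hom x z} -> hom cp_ob z;
  cp_descE : forall z (g : {linear V -> hom x z}) v, cp_desc g ∘ cp_in v = g v;
  cp_uniq : forall z (h h' : hom cp_ob z),
    (forall v, h ∘ cp_in v = h' ∘ cp_in v) -> h = h'
}.

Section CopowerMap.
Variables (k : fieldType) (A : linCat k) (V W : lmodType k) (x y : A).
Variables (P : copower V x) (Q : copower W y).
Variables (a : {linear V -> W}) (f : hom x y).

Definition cp_map_fun (v : V) : hom x Q := cp_in Q (a v) ∘ f.

Lemma cp_map_fun_linear : linear cp_map_fun.
Proof. by move=> c u v; rewrite /cp_map_fun !linearP; apply: comp_linl. Qed.

HB.instance Definition _ := GRing.isLinear.Build k V (hom x Q) _ cp_map_fun
  cp_map_fun_linear.

(** The morphism [a ⊗_k f : V ⊗_k x -> W ⊗_k y]. *)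
Definition cp_map : hom P Q := cp_desc P cp_map_fun.

End CopowerMap.

Section Precomp.
Variables (k : fieldType) (A : linCat k) (x y z : A) (f : hom x y).
Definition precomp (g : hom y z) : hom x z := g ∘ f.
HB.instance Definition _ := GRing.isLinear.Build k (hom y z) (hom x z) _ precomp
  (@comp_linl k A x y z f).
End Precomp.

Section Distinguished.
Variables (k : fieldType) (A : monCat k).

(** Wedges over [(y, z) |-> Hom (y, 1) ⊗_k z]. *)
Definition is_wedge (T : forall y z : A, copower (hom y one) z) (d : A)
    (p : forall y, hom d (T y y)) :=
  forall y y' (f : hom y y'),
    cp_map (T y y) (T y y') idfun f ∘ p y
    = cp_map (T y' y') (T y y') (precomp f) (idm y') ∘ p y'.

(** An object representing the end [∫_y Hom (y, 1) ⊗_k y]. *)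
Record distinguished := Distinguished {
  do_cp : forall y z : A, copower (hom y one) z;
  do_ob :> A;
  do_proj : forall y, hom do_ob (do_cp y y);
  do_wedge : is_wedge do_proj;
  do_univ : forall z (p : forall y, hom z (do_cp y y)), is_wedge p ->
    exists! h : hom z do_ob, forall y, do_proj y ∘ h = p y
}.

End Distinguished.

Record modCat k (C : monCat k) := ModCat {
  mod_cat :> linCat k;
  act : C -> mod_cat -> mod_cat;
  actm : forall (c c' : C) (m m' : mod_cat),
    hom c c' -> hom m m' -> hom (act c m) (act c' m');
  massoc : forall c d m, hom (act (c ⊗ d) m) (act c (act d m));
  munit : forall m, hom (act one m) m;
  actm_id : forall c m, actm (idm c) (idm m) = idm (act c m);
  actm_comp : forall c c' c'' m m' m'' (f' : hom c' c'') (f : hom c c')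
      (g' : hom m' m'') (g : hom m m'),
    actm (f' ∘ f) (g' ∘ g) = actm f' g' ∘ actm f g;
  actm_linl : forall c c' m m' (g : hom m m'),
    linear (fun f : hom c c' => actm f g);
  actm_linr : forall c c' m m' (f : hom c c'),
    linear (fun g : hom m m' => actm f g);
  massoc_iso : forall c d m, is_iso (massoc c d m);
  massoc_nat : forall c c' d d' m m' (f : hom c c') (g : hom d d') (h : hom m m'),
    massoc c' d' m' ∘ actm (f ⊠ g) h = actm f (actm g h) ∘ massoc c d m;
  munit_iso : forall m, is_iso (munit m);
  munit_nat : forall m m' (f : hom m m'), munit m' ∘ actm (idm one) f = f ∘ munit m;
  mod_pentagon : forall c d e m,
    massoc c d (act e m) ∘ massoc (c ⊗ d) e m =
    actm (idm c) (massoc d e m) ∘ massoc c (d ⊗ e) m ∘ actm (assoc c d e) (idm m);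
  mod_triangle : forall c m,
    actm (idm c) (munit m) ∘ massoc c one m = actm (runit c) (idm m)
}.
Arguments massoc {k C M} c d m : rename.
Arguments munit {k C M} m : rename.
Notation "c ▷ m" := (act c m) : tcat_scope.
Notation "f ▶ g" := (actm f g) : tcat_scope.

Section ModCat.
Variables (k : fieldType) (C : monCat k).

Section ActionFunctors.
Variable M : modCat C.

Program Definition act_by (c : C) : functor M M :=
  @Functor _ M M (fun m => c ▷ m) (fun m m' f => idm c ▶ f) _ _ _.
Next Obligation. exact: actm_id. Qed.
Next Obligation. by rewrite -actm_comp comp_idl. Qed.
Next Obligation. exact: actm_linr. Qed.

Program Definition act_on (m : M) : functor C M :=
  @Functor _ C M (fun c => c ▷ m) (fun c c' f => f ▶ idm m) _ _ _.
Next Obligation. exact: actm_id. Qed.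
Next Obligation. by rewrite -actm_comp comp_idl. Qed.
Next Obligation. exact: actm_linl. Qed.

Definition finite_module :=
  [/\ is_finite M, forall c, is_exact (act_by c) & forall m, is_exact (act_on m)].

Definition exact_module :=
  finite_module /\
  forall (p : C) (m : M), is_projective p -> is_projective (p ▷ m).

End ActionFunctors.

(** A functor with the data of a module functor, without the axioms. *)
Record premodFunctor (M N : modCat C) := PremodFunctor {
  pm_fun :> functor M N;
  pm_str : forall (c : C) (m : M), hom (pm_fun (c ▷ m)) (c ▷ pm_fun m)
}.

Definition is_modFunctor (M N : modCat C) (H : premodFunctor M N) :=
  [/\ forall c m, is_iso (pm_str H c m),
      forall c c' m m' (f : hom c c') (g : hom m m'),
        pm_str H c' m' ∘ fmap H (f ▶ g) = (f ▶ fmap H g) ∘ pm_str H c m,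
      forall c d m,
        massoc c d (H m) ∘ pm_str H (c ⊗ d) m =
        (idm c ▶ pm_str H d m) ∘ pm_str H c (d ▷ m) ∘ fmap H (massoc c d m) &
      forall m, munit (H m) ∘ pm_str H one m = fmap H (munit m)].

Definition is_modNat (M N : modCat C) (H K : premodFunctor M N)
    (a : forall m, hom (H m) (K m)) :=
  is_natural a /\
  forall c m, pm_str K c m ∘ a (c ▷ m) = (idm c ▶ a m) ∘ pm_str H c m.

Definition is_modIso (M N : modCat C) (H K : premodFunctor M N)
    (a : forall m, hom (H m) (K m)) :=
  is_modNat a /\ forall m, is_iso (a m).

(** Objects of [Fun_C (M, N)]. Right exactness is automatic when [M] is exact. *)
Record modFunctor (M N : modCat C) := ModFunctor {
  mf_pre :> premodFunctor M N;
  mf_ax : is_modFunctor mf_pre;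
  mf_rex : right_exact mf_pre
}.

Record modNat (M N : modCat C) (H K : premodFunctor M N) := ModNat {
  mn_fun :> forall m, hom (H m) (K m);
  mn_ax : is_modNat mn_fun
}.

End ModCat.

Section LinearLemmas.
Variable k : fieldType.
Section Comp.
Variables (A : linCat k) (x y z : A).
Implicit Types (g : hom y z) (f : hom x y).
Lemma comp0l f : (0 : hom y z) ∘ f = 0.
Proof. by have := comp_linl (z:=z) f (-1) 0 0; rewrite scaler0 addr0 scaleN1r addNr. Qed.
Lemma comp0r g : g ∘ (0 : hom x y) = 0.
Proof. by have := comp_linr (x:=x) g (-1) 0 0; rewrite scaler0 addr0 scaleN1r addNr. Qed.
Lemma compDl g g' f : (g + g') ∘ f = g ∘ f + g' ∘ f.
Proof. by have := comp_linl (z:=z) f 1 g g'; rewrite !scale1r. Qed.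
Lemma compDr g f f' : g ∘ (f + f') = g ∘ f + g ∘ f'.
Proof. by have := comp_linr (x:=x) g 1 f f'; rewrite !scale1r. Qed.
Lemma compZl a g f : (a *: g) ∘ f = a *: (g ∘ f).
Proof. by have := comp_linl (z:=z) f a g 0; rewrite comp0l !addr0. Qed.
Lemma compZr a g f : g ∘ (a *: f) = a *: (g ∘ f).
Proof. by have := comp_linr (x:=x) g a f 0; rewrite comp0r !addr0. Qed.
End Comp.

Section Act.
Variables (C : monCat k) (M : modCat C) (c : C) (m m' : M).
Implicit Types g : hom m m'.
Lemma act0r : idm c ▶ (0 : hom m m') = 0.
Proof.
by have := actm_linr (m:=m) (m':=m') (idm c) (-1) 0 0;
  rewrite scaler0 addr0 scaleN1r addNr.
Qed.
Lemma actDr g g' : idm c ▶ (g + g') = (idm c ▶ g) + (idm c ▶ g').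
Proof. by have := actm_linr (m:=m) (m':=m') (idm c) 1 g g'; rewrite !scale1r. Qed.
Lemma actZr a g : idm c ▶ (a *: g) = a *: (idm c ▶ g).
Proof. by have := actm_linr (m:=m) (m':=m') (idm c) a g 0; rewrite act0r !addr0. Qed.
End Act.
End LinearLemmas.

Section ModNatLinear.
Variables (k : fieldType) (C : monCat k) (M N : modCat C) (H K : premodFunctor M N).
Implicit Types a b : modNat H K.

Lemma modNat_ext a b : (forall m, a m = b m) -> a = b.
Proof.
case: a => a ha; case: b => b hb /= e.
have {}e : a = b by apply: functional_extensionality_dep.
by subst b; congr ModNat; apply: Prop_irrelevance.
Qed.

HB.instance Definition _ := gen_eqMixin (modNat H K).
HB.instance Definition _ := gen_choiceMixin (modNat H K).

Program Definition modNat_zero : modNat H K := @ModNat _ _ _ _ H K (fun m => 0) _.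
Next Obligation.
split=> [x y f|c m]; first by rewrite comp0r comp0l.
by rewrite comp0r act0r comp0l.
Qed.

Program Definition modNat_add a b : modNat H K :=
  @ModNat _ _ _ _ H K (fun m => a m + b m) _.
Next Obligation.
case: a b => a [an am] [b [bn bm]]; split=> [x y f|c m] /=.
  by rewrite compDr compDl an bn.
by rewrite compDr actDr compDl am bm.
Qed.

Program Definition modNat_scale (s : k) a : modNat H K :=
  @ModNat _ _ _ _ H K (fun m => s *: a m) _.
Next Obligation.
case: a => a [an am]; split=> [x y f|c m] /=.
  by rewrite compZr compZl an.
by rewrite compZr actZr compZl am.
Qed.

Definition modNat_opp a := modNat_scale (-1) a.

Fact modNat_addA : associative modNat_add.
Proof. by move=> a b c; apply: modNat_ext => m /=; rewrite addrA. Qed.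
Fact modNat_addC : commutative modNat_add.
Proof. by move=> a b; apply: modNat_ext => m /=; rewrite addrC. Qed.
Fact modNat_add0 : left_id modNat_zero modNat_add.
Proof. by move=> a; apply: modNat_ext => m /=; rewrite add0r. Qed.
Fact modNat_addN : left_inverse modNat_zero modNat_opp modNat_add.
Proof. by move=> a; apply: modNat_ext => m /=; rewrite scaleN1r addNr. Qed.

HB.instance Definition _ := GRing.isZmodule.Build (modNat H K)
  modNat_addA modNat_addC modNat_add0 modNat_addN.

Fact modNat_scaleA (s t : k) a : modNat_scale s (modNat_scale t a) = modNat_scale (s * t) a.
Proof. by apply: modNat_ext => m /=; rewrite scalerA. Qed.
Fact modNat_scale1 : left_id 1 modNat_scale.
Proof. by move=> a; apply: modNat_ext => m /=; rewrite scale1r. Qed.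
Fact modNat_scaleDr : right_distributive modNat_scale +%R.
Proof. by move=> s a b; apply: modNat_ext => m /=; rewrite scalerDr. Qed.
Fact modNat_scaleDl a : {morph modNat_scale^~ a : s t / s + t}.
Proof. by move=> s t; apply: modNat_ext => m /=; rewrite scalerDl. Qed.

HB.instance Definition _ := GRing.Zmodule_isLmodule.Build k (modNat H K)
  modNat_scaleA modNat_scale1 modNat_scaleDr modNat_scaleDl.

End ModNatLinear.

Section Isos.
Variables (k : fieldType) (A : linCat k).

Lemma is_iso_id (x : A) : is_iso (idm x).
Proof. by exists (idm x); split; rewrite comp_idl. Qed.

Lemma is_iso_comp (x y z : A) (g : hom y z) (f : hom x y) :
  is_iso g -> is_iso f -> is_iso (g ∘ f).
Proof.
move=> [g' [g1 g2]] [f' [f1 f2]]; exists (f' ∘ g'); split.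
  by rewrite comp_assoc -(comp_assoc f') g1 comp_idr.
by rewrite comp_assoc -(comp_assoc g) f2 comp_idr.
Qed.

Lemma is_iso_fmap (B : linCat k) (F : functor A B) (x y : A) (f : hom x y) :
  is_iso f -> is_iso (fmap F f).
Proof. by move=> [g [h1 h2]]; exists (fmap F g); split; rewrite -fmap_comp ?h1 ?h2 fmap_id. Qed.

Lemma inv_spec (x y : A) (f : hom x y) : is_iso f -> is_inverse f (inv f).
Proof. by rewrite /inv; case: pselect => // h _; case: cid. Qed.

Lemma invL (x y : A) (f : hom x y) : is_iso f -> inv f ∘ f = idm x.
Proof. by case/inv_spec. Qed.

Lemma invR (x y : A) (f : hom x y) : is_iso f -> f ∘ inv f = idm y.
Proof. by case/inv_spec. Qed.

Lemma is_iso_inv (x y : A) (f : hom x y) : is_iso f -> is_iso (inv f).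
Proof. by move=> h; exists f; split; rewrite ?invL ?invR. Qed.

Lemma iso_mono (x y z : A) (f : hom y z) (g h : hom x y) :
  is_iso f -> f ∘ g = f ∘ h -> g = h.
Proof. by move=> hf e; rewrite -(comp_idl g) -(invL hf) -comp_assoc e comp_assoc invL ?comp_idl. Qed.

Lemma iso_epi (x y z : A) (f : hom x y) (g h : hom y z) :
  is_iso f -> g ∘ f = h ∘ f -> g = h.
Proof. by move=> hf e; rewrite -(comp_idr g) -(invR hf) comp_assoc e -comp_assoc invR ?comp_idr. Qed.

End Isos.

Section Composition.
Variable k : fieldType.

Program Definition id_functor (A : linCat k) : functor A A :=
  @Functor _ A A (fun x => x) (fun x y f => f) _ _ _.
Next Obligation. by []. Qed.

Program Definition comp_functor (A B E : linCat k) (G : functor B E) (F : functor A B) :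
  functor A E := @Functor _ A E (fun x => G (F x)) (fun x y f => fmap G (fmap F f)) _ _ _.
Next Obligation. by rewrite !fmap_id. Qed.
Next Obligation. by rewrite !fmap_comp. Qed.
Next Obligation. by move=> a f g; rewrite !fmap_linear. Qed.

Variable C : monCat k.

Definition id_pm (M : modCat C) : premodFunctor M M :=
  @PremodFunctor _ C M M (id_functor M) (fun c m => idm (c ▷ m)).

Definition comp_pm (M N P : modCat C) (K : premodFunctor N P) (H : premodFunctor M N) :
  premodFunctor M P :=
  @PremodFunctor _ C M P (comp_functor K H)
    (fun c m => pm_str K c (H m) ∘ fmap K (pm_str H c m)).

Program Definition id_mf (M : modCat C) : modFunctor M M :=
  @ModFunctor _ C M M (id_pm M) _ _.
Next Obligation.
split=> /= [c m|c c' m m' f g|c d m|m].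
- exact: is_iso_id.
- by rewrite comp_idl comp_idr.
- by rewrite actm_id !comp_idl comp_idr.
- by rewrite comp_idr.
Qed.
Next Obligation. by []. Qed.

Program Definition comp_mf (M N P : modCat C) (K : modFunctor N P) (H : modFunctor M N) :
  modFunctor M P := @ModFunctor _ C M P (comp_pm K H) _ _.
Next Obligation.
case: (mf_ax K) (mf_ax H) => Ki Kn Ka Ku [Hi Hn Ha Hu]; split=> /= [c m|c c' m m' f g|c d m|m].
- by apply: is_iso_comp => //; apply: is_iso_fmap.
- by rewrite -comp_assoc -fmap_comp Hn fmap_comp comp_assoc Kn comp_assoc.
- rewrite comp_assoc Ka -!comp_assoc -fmap_comp Ha !fmap_comp.
  rewrite !comp_assoc -(comp_idl (idm c)) actm_comp !comp_idl; congr (_ ∘ _ ∘ _).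
  by rewrite -!comp_assoc Kn.
- by rewrite comp_assoc Ku -fmap_comp Hu.
Qed.
Next Obligation. by move=> x y z p f h; apply: (mf_rex K); apply: (mf_rex H). Qed.

End Composition.

Section Dual.
Variables (k : fieldType) (C : monCat k) (M : modCat C).
Implicit Types H K : modFunctor M M.

Program Definition modNat_id H : modNat H H :=
  @ModNat _ _ _ _ H H (fun m => idm (H m)) _.
Next Obligation.
by split=> [x y f|c m]; rewrite ?actm_id ?comp_idl ?comp_idr.
Qed.

Program Definition modNat_comp H K L (b : modNat K L) (a : modNat H K) : modNat H L :=
  @ModNat _ _ _ _ H L (fun m => b m ∘ a m) _.
Next Obligation.
case: a b => a [an am] [b [bn bm]]; split=> [x y f|c m] /=.
  by rewrite comp_assoc bn -comp_assoc an comp_assoc.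
by rewrite comp_assoc bm -comp_assoc am comp_assoc -actm_comp comp_idl.
Qed.

Program Definition dual_lin : linCat k :=
  @LinCat k (modFunctor M M) (fun H K => modNat H K) modNat_id modNat_comp _ _ _ _ _.
Next Obligation. by apply: modNat_ext => m; apply: comp_idl. Qed.
Next Obligation. by apply: modNat_ext => m; apply: comp_idr. Qed.
Next Obligation. by apply: modNat_ext => m; apply: comp_assoc. Qed.
Next Obligation. by move=> a u v; apply: modNat_ext => m; apply: comp_linl. Qed.
Next Obligation. by move=> a u v; apply: modNat_ext => m; apply: comp_linr. Qed.

Lemma modNat_iso H K (a : hom (H : dual_lin) K) (b : hom (K : dual_lin) H) :
  (forall m, is_inverse (a m) (b m)) -> is_iso a.
Proof. by move=> h; exists b; split; apply: modNat_ext => m; case: (h m). Qed.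

(** [f ∗ g : H ∘ K -> H' ∘ K']. *)
Program Definition modNat_hcomp H H' K K' (f : modNat H H') (g : modNat K K') :
  modNat (comp_mf H K) (comp_mf H' K') :=
  @ModNat _ _ _ _ (comp_mf H K) (comp_mf H' K') (fun m => f (K' m) ∘ fmap H (g m)) _.
Next Obligation.
case: f g => f [fn fm] [g [gn gm]]; split=> [x y h|c m] /=.
  by rewrite comp_assoc fn -!comp_assoc -!fmap_comp gn.
case: (mf_ax H) => _ Hn _ _.
rewrite -!comp_assoc (comp_assoc (fmap H' _)) fn -!comp_assoc -fmap_comp gm.
rewrite fmap_comp 2!comp_assoc fm -!comp_assoc (comp_assoc (pm_str H c _)) Hn.
by rewrite !comp_assoc -actm_comp comp_idl.
Qed.

Program Definition dual_assoc H K L :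
  modNat (comp_mf (comp_mf H K) L) (comp_mf H (comp_mf K L)) :=
  @ModNat _ _ _ _ (comp_mf (comp_mf H K) L) (comp_mf H (comp_mf K L))
    (fun m => idm (H (K (L m)))) _.
Next Obligation.
split=> [x y f|c m] /=; first by rewrite comp_idl comp_idr.
by rewrite actm_id comp_idl comp_idr fmap_comp comp_assoc.
Qed.

Program Definition dual_assoc' H K L :
  modNat (comp_mf H (comp_mf K L)) (comp_mf (comp_mf H K) L) :=
  @ModNat _ _ _ _ (comp_mf H (comp_mf K L)) (comp_mf (comp_mf H K) L)
    (fun m => idm (H (K (L m)))) _.
Next Obligation.
split=> [x y f|c m] /=; first by rewrite comp_idl comp_idr.
by rewrite actm_id comp_idl comp_idr fmap_comp comp_assoc.
Qed.

Program Definition dual_lunit H : modNat (comp_mf (id_mf M) H) H :=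
  @ModNat _ _ _ _ (comp_mf (id_mf M) H) H (fun m => idm (H m)) _.
Next Obligation.
split=> [x y f|c m] /=; first by rewrite comp_idl comp_idr.
by rewrite actm_id !comp_idl comp_idr.
Qed.

Program Definition dual_lunit' H : modNat H (comp_mf (id_mf M) H) :=
  @ModNat _ _ _ _ H (comp_mf (id_mf M) H) (fun m => idm (H m)) _.
Next Obligation.
split=> [x y f|c m] /=; first by rewrite comp_idl comp_idr.
by rewrite actm_id !comp_idl comp_idr.
Qed.

Program Definition dual_runit H : modNat (comp_mf H (id_mf M)) H :=
  @ModNat _ _ _ _ (comp_mf H (id_mf M)) H (fun m => idm (H m)) _.
Next Obligation.
split=> [x y f|c m] /=; first by rewrite comp_idl comp_idr.
by rewrite actm_id fmap_id ?comp_idl ?comp_idr ?comp_idl.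
Qed.

Program Definition dual_runit' H : modNat H (comp_mf H (id_mf M)) :=
  @ModNat _ _ _ _ H (comp_mf H (id_mf M)) (fun m => idm (H m)) _.
Next Obligation.
split=> [x y f|c m] /=; first by rewrite comp_idl comp_idr.
by rewrite actm_id fmap_id ?comp_idl ?comp_idr ?comp_idl.
Qed.

(** [C^*_M = Fun_C (M, M)], with tensor product [H ⊗ K = H ∘ K]. *)
Program Definition dual : monCat k :=
  @MonCat k dual_lin (fun H K => comp_mf H K) (@modNat_hcomp) (id_mf M)
    (@dual_assoc) (@dual_lunit) (@dual_runit) _ _ _ _ _ _ _ _ _ _ _ _.
Next Obligation. by apply: modNat_ext => m /=; rewrite fmap_id comp_idl. Qed.
Next Obligation.
apply: modNat_ext => m /=; rewrite fmap_comp -!comp_assoc; congr (_ ∘ _).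
by have [fn _] := mn_ax f; rewrite !comp_assoc fn.
Qed.
Next Obligation. by move=> a u v; apply: modNat_ext => m /=; apply: comp_linl. Qed.
Next Obligation.
by move=> a u v; apply: modNat_ext => m /=; rewrite fmap_linear; apply: comp_linr.
Qed.
Next Obligation.
by apply: (@modNat_iso _ _ _ (@dual_assoc' _ _ _)) => m; split; apply: comp_idl.
Qed.
Next Obligation.
by apply: modNat_ext => m /=; rewrite comp_idl comp_idr fmap_comp comp_assoc.
Qed.
Next Obligation.
by apply: (@modNat_iso _ _ _ (@dual_lunit' _)) => m; split; apply: comp_idl.
Qed.
Next Obligation. by apply: modNat_ext => m /=; rewrite !comp_idl comp_idr. Qed.
Next Obligation.
by apply: (@modNat_iso _ _ _ (@dual_runit' _)) => m; split; apply: comp_idl.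
Qed.
Next Obligation. by apply: modNat_ext => m /=; rewrite fmap_id comp_idl !comp_idr. Qed.
Next Obligation. by apply: modNat_ext => m /=; rewrite !fmap_id !comp_idl. Qed.
Next Obligation. by apply: modNat_ext => m /=; rewrite !fmap_id !comp_idl. Qed.

End Dual.

(** Objects and morphisms of [dual M] seen as functors and transformations. *)
Definition as_mf k (C : monCat k) (M : modCat C) (H : dual M) : modFunctor M M := H.
Definition as_mn k (C : monCat k) (M : modCat C) (H K : dual M) (a : hom H K) :
  modNat (as_mf H) (as_mf K) := a.

Section Unimodular.
Variables (k : fieldType) (C : monCat k) (M : modCat C).

Definition unimodular_structure (E : distinguished (dual M))
    (u : forall m : M, hom m (as_mf E m)) :=
  @is_modIso _ _ _ _ (id_mf M) (as_mf E) u.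

Definition unimodular :=
  exact_module M /\
  exists (E : distinguished (dual M)) (u : forall m : M, hom m (as_mf E m)),
    unimodular_structure u.

End Unimodular.

Section Adjoints.
Variables (k : fieldType) (C D : monCat k) (F : monFunctor C D).

(** [C]-bimodule structures of the adjoints of [F : C -> _F D_F], the actions on
    [D] being [F c ⊗ d] and [d ⊗ F c]; they are the mates of [mu]. *)
Section Left.
Variables (L : functor D C) (adj : adjunction L F).

Definition la_left c d : hom (L (F c ⊗ d)) (c ⊗ L d) :=
  adj_counit adj (c ⊗ L d) ∘
  fmap L (mu F c (L d) ∘ (idm (F c) ⊠ adj_unit adj d)).

Definition la_right d c : hom (L (d ⊗ F c)) (L d ⊗ c) :=
  adj_counit adj (L d ⊗ c) ∘
  fmap L (mu F (L d) c ∘ (adj_unit adj d ⊠ idm (F c))).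
End Left.

Section Right.
Variables (R : functor D C) (adj : adjunction F R).

Definition ra_left c d : hom (c ⊗ R d) (R (F c ⊗ d)) :=
  fmap R ((idm (F c) ⊠ adj_counit adj d) ∘ inv (mu F c (R d)))
  ∘ adj_unit adj (c ⊗ R d).

Definition ra_right d c : hom (R d ⊗ c) (R (d ⊗ F c)) :=
  fmap R ((adj_counit adj d ⊠ idm (F c)) ∘ inv (mu F (R d) c))
  ∘ adj_unit adj (R d ⊗ c).

Section Double.
Variables (RR : functor C D) (adj' : adjunction R RR).

Definition rra_left c x : hom (F c ⊗ RR x) (RR (c ⊗ x)) :=
  fmap RR ((idm c ⊠ adj_counit adj' x) ∘ inv (ra_left c (RR x)))
  ∘ adj_unit adj' (F c ⊗ RR x).

Definition rra_right x c : hom (RR x ⊗ F c) (RR (x ⊗ c)) :=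
  fmap RR ((adj_counit adj' x ⊠ idm c) ∘ inv (ra_right (RR x) c))
  ∘ adj_unit adj' (RR x ⊗ F c).

Definition chi : D := RR one.

(** [χ ⊗ F c ≅ RR (1 ⊗ c) ≅ RR c ≅ RR (c ⊗ 1) ≅ F c ⊗ χ]. *)
Definition chi_braid c : hom (chi ⊗ F c) (F c ⊗ chi) :=
  inv (rra_left c one) ∘ fmap RR (inv (runit c)) ∘ fmap RR (lunit c)
  ∘ rra_right one c.

End Double.
End Right.

(** [L ≅ R] as [C]-bimodule functors [_F D_F -> C], for [R] right adjoint
    to [F] and some (hence any) left adjoint [L]. The bimodule structures of [L]
    and [R] are [la_left], [la_right] and the inverses of [ra_left], [ra_right]. *)
Definition tensor_Frobenius (R : functor D C) (adjR : adjunction F R) :=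
  exists (L : functor D C) (adjL : adjunction L F) (t : forall d, hom (L d) (R d)),
    [/\ is_natural t, forall d, is_iso (t d),
        forall c d, ra_left adjR c d ∘ (idm c ⊠ t d) ∘ la_left adjL c d = t (F c ⊗ d) &
        forall d c, ra_right adjR d c ∘ (t d ⊠ idm c) ∘ la_right adjL d c = t (d ⊗ F c)].

End Adjoints.

Section MoreIso.
Variables (k : fieldType).
Lemma is_iso_actm (C : monCat k) (M : modCat C) (c c' : C) (m m' : M)
  (f : hom c c') (g : hom m m') : is_iso f -> is_iso g -> is_iso (f ▶ g).
Proof.
move=> [f' [f1 f2]] [g' [g1 g2]]; exists (f' ▶ g'); split;
  by rewrite -actm_comp ?f1 ?f2 ?g1 ?g2 actm_id.
Qed.

Lemma is_iso_tensm (C : monCat k) (c c' m m' : C)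
  (f : hom c c') (g : hom m m') : is_iso f -> is_iso g -> is_iso (f ⊠ g).
Proof.
move=> [f' [f1 f2]] [g' [g1 g2]]; exists (f' ⊠ g'); split;
  by rewrite -tensm_comp ?f1 ?f2 ?g1 ?g2 tensm_id.
Qed.
End MoreIso.

Section Twist.
Variables (k : fieldType) (C D : monCat k) (F : monFunctor C D).

Lemma mu_inv_nat x x' y y' (f : hom x x') (g : hom y y') :
  (fmap F f ⊠ fmap F g) ∘ inv (mu F x y) = inv (mu F x' y') ∘ fmap F (f ⊠ g).
Proof.
apply: (iso_mono (mu_iso F x' y')); apply: (iso_epi (mu_iso F x y)).
by rewrite !comp_assoc invR ?comp_idl ?mu_nat -?comp_assoc ?invL ?comp_idr;
  try exact: mu_iso.
Qed.

Lemma mu_inv_assoc x y z :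
  (idm (F x) ⊠ inv (mu F y z)) ∘ inv (mu F x (y ⊗ z)) ∘ fmap F (assoc x y z)
  = assoc (F x) (F y) (F z) ∘ (inv (mu F x y) ⊠ idm (F z)) ∘ inv (mu F (x ⊗ y) z).
Proof.
have i := mu_iso F.
have j : is_iso (mu F (x ⊗ y) z ∘ (mu F x y ⊠ idm (F z))).
  by apply: is_iso_comp => //; apply: is_iso_tensm => //; apply: is_iso_id.
apply: (iso_epi j); rewrite -!comp_assoc (comp_assoc (fmap F _)) mu_assoc.
rewrite -!comp_assoc (comp_assoc _ (mu F x _)) invL // comp_idl.
rewrite !comp_assoc -tensm_comp invL // comp_idl tensm_id comp_idl.
rewrite -(comp_assoc _ (inv _)) invL // comp_idr -comp_assoc -tensm_comp.
by rewrite invL // comp_idl tensm_id comp_idr.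
Qed.

Lemma mu_inv_runit x :
  (idm (F x) ⊠ inv (eps F)) ∘ inv (mu F x one) = inv (runit (F x)) ∘ fmap F (runit x).
Proof.
have i := mu_iso F; have e := eps_iso F.
have j : is_iso (mu F x one ∘ (idm (F x) ⊠ eps F)).
  by apply: is_iso_comp => //; apply: is_iso_tensm => //; apply: is_iso_id.
apply: (iso_epi j); rewrite -!comp_assoc (comp_assoc (fmap F _)) mu_runit.
rewrite (comp_assoc _ (mu F _ _)) invL // comp_idl -tensm_comp invL //.
by rewrite comp_idl tensm_id invL //; apply: runit_iso.
Qed.

Section Module.
Variable M : modCat D.

(** [_F M] : the category [M] with the action [F c ▷ m]. *)
Program Definition twist : modCat C :=
  @ModCat k C M (fun c m => F c ▷ m) (fun c c' m m' f g => fmap F f ▶ g)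
    (fun c d m => massoc (F c) (F d) m ∘ (inv (mu F c d) ▶ idm m))
    (fun m => munit m ∘ (inv (eps F) ▶ idm m)) _ _ _ _ _ _ _ _ _ _.
Next Obligation. by rewrite fmap_id actm_id. Qed.
Next Obligation. by rewrite fmap_comp actm_comp. Qed.
Next Obligation. by move=> a u v; rewrite fmap_linear; apply: actm_linl. Qed.
Next Obligation. exact: actm_linr. Qed.
Next Obligation.
apply: is_iso_comp; first exact: massoc_iso.
by apply: is_iso_actm; [apply/is_iso_inv/mu_iso | apply: is_iso_id].
Qed.
Next Obligation.
rewrite -comp_assoc -actm_comp -mu_inv_nat comp_idl comp_assoc -massoc_nat.
by rewrite -comp_assoc -actm_comp comp_idr.
Qed.
Next Obligation.
apply: is_iso_comp; first exact: munit_iso.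
by apply: is_iso_actm; [apply/is_iso_inv/eps_iso | apply: is_iso_id].
Qed.
Next Obligation.
rewrite comp_assoc -munit_nat -!comp_assoc -!actm_comp.
by rewrite fmap_id !comp_idl !comp_idr.
Qed.
Next Obligation.
rewrite fmap_id.
transitivity (massoc (F c) (F d) (F e ▷ m) ∘ massoc (F c ⊗ F d) (F e) m ∘
  (((inv (mu F c d) ⊠ idm (F e)) ∘ inv (mu F (c ⊗ d) e)) ▶ idm m)).
  rewrite -{2}(comp_idl (idm m)) actm_comp !comp_assoc; congr (_ ∘ _).
  by rewrite -!comp_assoc massoc_nat actm_id.
rewrite mod_pentagon -comp_assoc -actm_comp comp_idl comp_assoc -mu_inv_assoc.
have e1 : idm (F c) ▶ (massoc (F d) (F e) m ∘ (inv (mu F d e) ▶ idm m)) =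
    (idm (F c) ▶ massoc (F d) (F e) m) ∘ (idm (F c) ▶ (inv (mu F d e) ▶ idm m)).
  by rewrite -actm_comp comp_idl.
have e2 := massoc_nat (idm (F c)) (inv (mu F d e)) (idm m).
have e3 c1 c2 c3 c4 (f : hom c3 c4) (g : hom c2 c3) (h : hom c1 c2) :
    (f ∘ g ∘ h) ▶ idm m = (f ▶ idm m) ∘ (g ▶ idm m) ∘ (h ▶ idm m).
  by rewrite -!actm_comp !comp_idl.
by rewrite e1 e3 !comp_assoc -(comp_assoc _ (massoc _ (_ ⊗ _) m)) e2 !comp_assoc.
Qed.
Next Obligation.
rewrite fmap_id.
have e1 : idm (F c) ▶ (munit m ∘ (inv (eps F) ▶ idm m)) =
    (idm (F c) ▶ munit m) ∘ (idm (F c) ▶ (inv (eps F) ▶ idm m)).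
  by rewrite -actm_comp comp_idl.
have e2 := massoc_nat (idm (F c)) (inv (eps F)) (idm m).
rewrite e1 !comp_assoc -(comp_assoc _ _ (massoc _ _ m)) -e2 !comp_assoc.
rewrite mod_triangle -comp_assoc -!actm_comp !comp_idl mu_inv_runit.
by rewrite comp_assoc invR ?comp_idl //; apply: runit_iso.
Qed.

End Module.

(** The functor [F^*] from [Fun_D (M, N)] to [Fun_C (_F M, _F N)]. *)
Definition pull_pm (M N : modCat D) (H : premodFunctor M N) :
  premodFunctor (twist M) (twist N) :=
  @PremodFunctor _ C (twist M) (twist N) H (fun c m => pm_str H (F c) m).

Program Definition pull (M N : modCat D) (H : modFunctor M N) :
  modFunctor (twist M) (twist N) := @ModFunctor _ C (twist M) (twist N) (pull_pm H) _ _.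
Next Obligation.
case: (mf_ax H) => Hi Hn Ha Hu; split=> /= [c m|c c' m m' f g|c d m|m].
- exact: Hi.
- exact: Hn.
- have e := Hn _ _ _ _ (inv (mu F c d)) (idm m); rewrite fmap_id in e.
  by rewrite fmap_id -comp_assoc -e fmap_comp !comp_assoc Ha.
- have e := Hn _ _ _ _ (inv (eps F)) (idm m); rewrite fmap_id in e.
  by rewrite -comp_assoc -e fmap_comp comp_assoc Hu.
Qed.
Next Obligation. exact: (mf_rex H). Qed.

End Twist.

Section FrobeniusWrt.
Variables (k : fieldType) (C D : monCat k) (F : monFunctor C D).
Variables (R : functor D C) (adj : adjunction F R).
Variables (RR : functor C D) (adj' : adjunction R RR).
Variable M : modCat D.

(** [χ ▷ - : _F M -> _F M]. *)
Definition chi_act : premodFunctor (twist F M) (twist F M) :=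
  @PremodFunctor _ C (twist F M) (twist F M) (act_by M (chi RR))
    (fun c m => massoc (F c) (chi RR) m ∘ (chi_braid adj adj' c ▶ idm m)
                ∘ inv (massoc (chi RR) (F c) m)).

Definition chi_trivialization (t : forall m : M, hom (chi RR ▷ m) m) :=
  @is_modIso _ _ _ _ chi_act (id_mf (twist F M)) t.

Definition Frobenius_wrt := exists t, chi_trivialization t.

Section Composite.
Variables (E : distinguished (dual M)) (E' : distinguished (dual (twist F M))).
Variables (I : inverse_ob (do_ob E)) (I' : inverse_ob (do_ob E')).

(** Isomorphisms [χ ▷ F^*(D_E^{-1}) ≅ D_E'^{-1}] of [C]-module functors. *)
Definition modular_comparison
    (phi : forall m : M, hom (chi RR ▷ as_mf (iv_ob I) m) (as_mf (iv_ob I') m)) :=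
  @is_modIso _ _ _ _ (comp_pm chi_act (pull F (as_mf (iv_ob I)))) (as_mf (iv_ob I')) phi.

Variables
  (phi : forall m : M, hom (chi RR ▷ as_mf (iv_ob I) m) (as_mf (iv_ob I') m))
  (t : forall m : M, hom (chi RR ▷ m) m).

(** [F^*(D_E^{-1}) ≅ χ ▷ F^*(D_E^{-1}) ≅ D_E'^{-1}]. *)
Definition inv_comparison (m : M) : hom (as_mf (iv_ob I) m) (as_mf (iv_ob I') m) :=
  phi m ∘ inv (t (as_mf (iv_ob I) m)).

(** The isomorphism [F^*(D_E) ≅ D_E'] induced by [inv_comparison] on inverses:
    [D_E ≅ D_E D_E'^{-1} D_E' ≅ D_E D_E^{-1} D_E' ≅ D_E']. *)
Definition comparison (m : M) : hom (as_mf E m) (as_mf E' m) :=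
  as_mn (iv_r I) (as_mf E' m)
  ∘ fmap (as_mf E) (inv (inv_comparison (as_mf E' m)))
  ∘ fmap (as_mf E) (inv (as_mn (iv_l I') m)).

End Composite.
End FrobeniusWrt.

(* Main.v *)
(* Fix a projective generator [p] of [M], its Nakayama object [n], with the perfect
   pairing [Hom (p, x) × Hom (x, n) -> k], and the internal hom [U], right adjoint to
   [- ▷ n]. The identity of [M] represents the end defining the distinguished object of
   the dual category if and only if [- ▷ p] is a right adjoint of [U] whose unit
   [e : 1 -> U (-) ▷ p] is compatible with the pairing: [e] is the component of the
   universal wedge at the functor [U (-) ▷ p], and conversely the wedge is recovered from
   [e] since every natural transformation [U (-) ▷ p -> K] is determined at [n].

   Write [R] and [RR] for the first two right adjoints of [F]. In the twisted module
   category the internal hom is [R U], and the adjunctions [R ⊣ RR] and [U ⊣ - ▷ p] give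
   it the right adjoint [RR (-) ▷ p ≅ χ ▷ (F (-) ▷ p)], with a unit [1 -> χ ▷ (F R U (-) ▷ p)]
   compatible with the same pairing. A trivialization of [χ ▷ -] turns this unit into one of
   the required form. Conversely, a unit [e'] of the required form is the kernel of
   [e' - F R U e'], and factoring the first unit through [χ ▷ e'] gives [1 ≅ χ ▷ -].

   If [F] is tensor Frobenius, [F] and [RR] are both right adjoint to [R] compatibly with
   the bimodule structures, so that [χ = RR 1 ≅ F 1 ≅ 1] with the trivial half-braiding. *)

From HB Require Import structures.
From mathcomp Require Import all_boot all_algebra boolp.
Require Import Defs.
From mathcomp Require Import ssreflect ssralg.

Set Implicit Arguments.
Unset Strict Implicit.
Unset Printing Implicit Defensive.

Import GRing.Theory.
Local Open Scope ring_scope.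
Local Open Scope tcat_scope.

(** * Linear algebra *)

Section LinearAlgebra.
Variable k : fieldType.
Implicit Types V W : lmodType k.

(** The obstacle is that the end for [twist F M] runs over [C]-module endofunctors, which need not
    come from [D]-module ones, so the two ends cannot be compared term by term. A Frobenius datum
    can be: [p], [n] and [lam] depend on the underlying linear category only and survive the twist
    unchanged, and the internal hom merely acquires [R].

    That [U] has right adjoint [- ▷ p] is a statement about one object. The last clause of
    [frob_datum] supplies the missing naturality: when an endomorphism of [n] acts on [U], the
    endomorphism of [p] that corresponds to it under the pairing has the same effect on [e]. In the
    twisted category this clause concerns transformations that are only [C]-linear. Functors
    [U (-) ▷ x] being freely generated at [n], such a transformation is given by one morphism, and
    the same morphism, pushed along the counit of [F ⊣ R], generates a [D]-linear one to which the
    clause for [e] applies.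

    The unit is a kernel by descent: [U] turns the fork of [e] into a split one and reflects zero
    objects. *)

Definition mk_linear V W (f : V -> W) (h : linear f) : {linear V -> W} :=
  HB.pack f (GRing.isLinear.Build k V W _ f h).

(** [fin_dim] only provides a spanning family. One of least length is independent: a vector with
    non-zero coefficient in a relation could be dropped. *)
Lemma dual_basis V : fin_dim V ->
  exists n (b : 'I_n -> V) (beta : 'I_n -> {linear V -> k^o}),
    (forall v, v = \sum_i beta i v *: b i) /\ forall i j, beta i (b j) = (i == j)%:R.
Proof.
move=> hV.
pose spans n := exists b : 'I_n -> V, forall v, exists a : 'I_n -> k, v = \sum_i a i *: b i.
have hex : exists n, `[< spans n >] by case: hV => n hn; exists n; apply/asboolP.
case: (ex_minnP hex) => n /asboolP [b hb] hmin.
have indep a : \sum_i a i *: b i = 0 -> forall i, a i = 0.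
  move=> ha j; case: (eqVneq (a j) 0) => // aj; exfalso.
  case: n b hb hmin a ha j aj => [|n] b hb hmin a ha j aj; first by case: j aj.
  suff : spans n by move/asboolP/hmin; rewrite ltnn.
  exists (fun i => b (lift j i)) => v; case: (hb v) => c ->.
  exists (fun i => c (lift j i) - c j / a j * a (lift j i)).
  rewrite (bigD1_ord j) // [in RHS](eq_bigr (fun i => c (lift j i) *: b (lift j i)
    - (c j / a j) *: (a (lift j i) *: b (lift j i)))); last first.
    by move=> i _; rewrite scalerBl scalerA.
  rewrite sumrB -scaler_sumr addrC; congr (_ + _).
  move: ha; rewrite (bigD1_ord j) //= => /eqP; rewrite addr_eq0 => /eqP e.
  by rewrite -scalerN -e scalerA divfK.
have uniq a a' : \sum_i a i *: b i = \sum_i a' i *: b i -> a = a'.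
  move=> e; apply: functional_extensionality_dep => i; apply/eqP; rewrite -subr_eq0.
  apply/eqP; apply: (indep (fun i => a i - a' i)).
  rewrite (eq_bigr (fun i => a i *: b i - a' i *: b i)) => [|j _].
    by rewrite sumrB e subrr.
  by rewrite scalerBl.
pose coord v := projT1 (cid (hb v)).
have coordE v : v = \sum_i coord v i *: b i by rewrite /coord; case: cid.
have lin i : linear (fun v => coord v i : k^o).
  move=> c u v /=; suff -> : coord (c *: u + v) = fun i => c * coord u i + coord v i by [].
  apply: uniq; rewrite -coordE {1}(coordE u) {1}(coordE v) scaler_sumr -big_split /=.
  by apply: eq_bigr => j _; rewrite scalerDl scalerA.
exists n, b, (fun i => mk_linear (lin i)); split=> [v|i j]; first by rewrite {1}(coordE v).
suff /= -> : coord (b j) = fun i => (i == j)%:R by [].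
apply: uniq; rewrite -coordE (bigD1 j) //= eqxx scale1r big1 ?addr0 // => l /negPf ->.
by rewrite scale0r.
Qed.

(** A family in [P] whose coordinate matrix has maximal rank spans all of [P], for any predicate
    [P]. The functionals [beta] are linear on the whole of [W], but give an expansion on [P]
    only. *)
Lemma subset_basis W (P : W -> Prop) : fin_dim W ->
  exists N (b : 'I_N -> W) (beta : 'I_N -> {linear W -> k^o}),
    (forall i, P (b i)) /\ forall w, P w -> w = \sum_i beta i w *: b i.
Proof.
move=> /dual_basis [m [w [c [hw _]]]].
pose co (x : W) : 'rV_m := \row_i c i x.
have coL a x y : co (a *: x + y) = a *: co x + co y.
  by apply/rowP => i; rewrite !mxE linearP.
have co_inj x y : co x = co y -> x = y.
  move=> e; rewrite (hw x) (hw y); apply: eq_bigr => i _.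
  by have /rowP/(_ i) := e; rewrite !mxE => ->.
pose mx r (v : 'I_r -> W) := \matrix_(i < r) co (v i).
pose good r := `[< exists N (v : 'I_N -> W), (forall i, P (v i)) /\ \rank (mx N v) = r >].
have g0 : exists r, good r.
  exists (\rank (mx 0%N (fun _ => 0))); apply/asboolP; exists 0%N, (fun _ => 0).
  by split=> // -[].
have gb r : good r -> (r <= m)%N by case/asboolP => N [v [_ <-]]; apply: rank_leq_col.
case: (ex_maxnP g0 gb) => r /asboolP [N [v [vP hv]]] hmax.
have sub x : P x -> (co x <= mx N v)%MS.
  move=> Px; pose v' (i : 'I_(1 + N)) := if split i is inr j then v j else x.
  have e : mx _ v' = col_mx (co x) (mx N v).
    apply/matrixP => i j; rewrite !mxE /v'; case: (split i) => i'; first by rewrite !mxE.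
    by rewrite !mxE.
  have le : (mx N v <= mx _ v')%MS by rewrite e -addsmxE addsmxSr.
  have : (mx _ v' <= mx N v)%MS.
    rewrite -(mxrank_leqif_sup le) eqn_leq mxrankS //= hv.
    apply: hmax; apply/asboolP; exists _, v'; split=> // i.
    by rewrite /v'; case: (split i).
  by rewrite e -addsmxE addsmx_sub => /andP [].
(* The pseudo-inverse turns membership in the row space into coefficients that depend linearly on
   [x]. *)
pose rf i (x : W) : k^o := (co x *m pinvmx (mx N v)) 0 i.
have rl i : linear (rf i).
  by move=> a x y; rewrite /rf coL mulmxDl -scalemxAl !mxE.
exists N, v, (fun i => mk_linear (rl i)); split=> // x /sub /mulmxKpV e; apply: co_inj.
apply/rowP => j; rewrite -{1}e !mxE linear_sum; apply: eq_bigr => i _.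
by rewrite [mx N v i j]mxE [co (v i) _ _]mxE linearZ.
Qed.

Lemma linear_retraction V W (f : {linear V -> W}) :
  fin_dim W -> injective f -> exists r : {linear W -> V}, forall v, r (f v) = v.
Proof.
move=> hW inj.
case: (subset_basis (fun w => exists v, f v = w) hW) => N [b [beta [hb hw]]].
pose v i := projT1 (cid (hb i)); have vE i : f (v i) = b i by rewrite /v; case: cid.
have l : linear (fun w => \sum_i beta i w *: v i).
  move=> a x y; rewrite scaler_sumr -big_split /=; apply: eq_bigr => i _.
  by rewrite linearP scalerDl scalerA.
exists (mk_linear l) => x; apply: inj; rewrite /= linear_sum /= [RHS](hw (f x)); last by exists x.
by apply: eq_bigr => i _; rewrite linearZ /= vE.
Qed.

Lemma fin_dim_sub V W (f : {linear V -> W}) : fin_dim W -> injective f -> fin_dim V.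
Proof.
move=> hW inj; case: (linear_retraction hW inj) => r hr; case: hW => n [b hb].
exists n, (r \o b) => v; case: (hb (f v)) => a e; exists a.
by rewrite -{1}(hr v) e linear_sum; apply: eq_bigr => i _; rewrite linearZ.
Qed.

Lemma functional_extension V W (f : {linear V -> W}) (t : {linear V -> k^o}) :
  fin_dim W -> injective f -> exists t' : {linear W -> k^o}, forall v, t' (f v) = t v.
Proof.
move=> hW /(linear_retraction hW) [r hr]; have l : linear (fun w => t (r w) : k^o).
  by move=> a u v; rewrite !linearP.
by exists (mk_linear l) => v /=; rewrite hr.
Qed.

End LinearAlgebra.

(** * Abelian categories *)

Section AbelianLemmas.
Variables (k : fieldType) (A : linCat k).
Implicit Types x y z w : A.

Lemma comp_suml n x y z (f : hom x y) (g : 'I_n -> hom y z) :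
  (\sum_i g i) ∘ f = \sum_i (g i ∘ f).
Proof.
elim: n g => [|n ih] g; first by rewrite !big_ord0 comp0l.
by rewrite !big_ord_recr /= compDl ih.
Qed.

Lemma comp_sumr n x y z (g : hom y z) (f : 'I_n -> hom x y) :
  g ∘ (\sum_i f i) = \sum_i (g ∘ f i).
Proof.
elim: n f => [|n ih] f; first by rewrite !big_ord0 comp0r.
by rewrite !big_ord_recr /= compDr ih.
Qed.

Lemma compNl x y z (f : hom x y) (g : hom y z) : (- g) ∘ f = - (g ∘ f).
Proof. by rewrite -scaleN1r compZl scaleN1r. Qed.
Lemma compNr x y z (f : hom x y) (g : hom y z) : g ∘ (- f) = - (g ∘ f).
Proof. by rewrite -scaleN1r compZr scaleN1r. Qed.
Lemma compBl x y z (f : hom x y) (g g' : hom y z) : (g - g') ∘ f = g ∘ f - g' ∘ f.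
Proof. by rewrite compDl compNl. Qed.
Lemma compBr x y z (f f' : hom x y) (g : hom y z) : g ∘ (f - f') = g ∘ f - g ∘ f'.
Proof. by rewrite compDr compNr. Qed.

Lemma is_inverse_inv x y (f : hom x y) g : is_inverse f g -> inv f = g.
Proof.
move=> [e1 e2]; have i : is_iso f by exists g.
by apply: (iso_mono i); rewrite invR // e2.
Qed.

Lemma inv_idm x : inv (idm x) = idm x.
Proof. by apply: is_inverse_inv; split; rewrite comp_idl. Qed.

Lemma inv_comp x y z (g : hom y z) (f : hom x y) :
  is_iso g -> is_iso f -> inv (g ∘ f) = inv f ∘ inv g.
Proof.
move=> hg hf; apply: is_inverse_inv; split.
  by rewrite comp_assoc -(comp_assoc _ (inv g)) invL // comp_idr invL.
by rewrite comp_assoc -(comp_assoc g) invR // comp_idr invR.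
Qed.

Lemma inv_inv x y (f : hom x y) : is_iso f -> inv (inv f) = f.
Proof. by move=> h; apply: is_inverse_inv; split; [apply: invR | apply: invL]. Qed.

Lemma invK x y z (f : hom y z) (g : hom x y) : is_iso f -> inv f ∘ (f ∘ g) = g.
Proof. by move=> i; rewrite comp_assoc invL // comp_idl. Qed.
Lemma invKV x y z (f : hom z y) (g : hom x y) : is_iso f -> f ∘ (inv f ∘ g) = g.
Proof. by move=> i; rewrite comp_assoc invR // comp_idl. Qed.

Lemma zero_homl x y (f : hom x y) : is_zero_ob x -> f = 0.
Proof. by move=> h; rewrite -(comp_idr f) h comp0r. Qed.
Lemma zero_homr x y (f : hom x y) : is_zero_ob y -> f = 0.
Proof. by move=> h; rewrite -(comp_idl f) h comp0l. Qed.

Lemma is_mono0 x y (f : hom x y) :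
  (forall w (g : hom w x), f ∘ g = 0 -> g = 0) -> is_mono f.
Proof.
move=> h w g g' e; apply/eqP; rewrite -subr_eq0; apply/eqP; apply: h.
by rewrite compBr e subrr.
Qed.

Lemma is_epi0 x y (f : hom x y) :
  (forall w (g : hom y w), g ∘ f = 0 -> g = 0) -> is_epi f.
Proof.
move=> h w g g' e; apply/eqP; rewrite -subr_eq0; apply/eqP; apply: h.
by rewrite compBl e subrr.
Qed.

Lemma mono0 x y w (f : hom x y) (g : hom w x) : is_mono f -> f ∘ g = 0 -> g = 0.
Proof. by move=> h e; apply: h; rewrite e comp0r. Qed.
Lemma epi0 x y w (f : hom x y) (g : hom y w) : is_epi f -> g ∘ f = 0 -> g = 0.
Proof. by move=> h e; apply: h; rewrite e comp0l. Qed.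

Lemma kernel_mono z x y (i : hom z x) (f : hom x y) : is_kernel i f -> is_mono i.
Proof.
move=> [e h]; apply: is_mono0 => w g hg.
have [|u [_ u2]] := h w (0 : hom w x); first by rewrite comp0r.
by rewrite -(u2 g hg) (u2 0) ?comp0r.
Qed.

Lemma cokernel_epi x y z (p : hom y z) (f : hom x y) : is_cokernel p f -> is_epi p.
Proof.
move=> [e h]; apply: is_epi0 => w g hg.
have [|u [_ u2]] := h w (0 : hom y w); first by rewrite comp0l.
by rewrite -(u2 g hg) (u2 0) ?comp0l.
Qed.

Lemma kernel_lift z x y w (i : hom z x) (f : hom x y) (g : hom w x) :
  is_kernel i f -> f ∘ g = 0 -> exists h, i ∘ h = g.
Proof. by move=> [_ h] /h [u [e _]]; exists u. Qed.

Lemma cokernel_desc x y z w (p : hom y z) (f : hom x y) (g : hom y w) :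
  is_cokernel p f -> g ∘ f = 0 -> exists h, h ∘ p = g.
Proof. by move=> [_ h] /h [u [e _]]; exists u. Qed.

Lemma mk_kernel z x y (i : hom z x) (f : hom x y) : f ∘ i = 0 -> is_mono i ->
  (forall w (g : hom w x), f ∘ g = 0 -> exists h, i ∘ h = g) -> is_kernel i f.
Proof.
move=> e m l; split=> // w g /l [h eh]; exists h; split=> // h' eh'.
by apply: m; rewrite eh.
Qed.

Lemma mk_cokernel x y z (p : hom y z) (f : hom x y) : p ∘ f = 0 -> is_epi p ->
  (forall w (g : hom y w), g ∘ f = 0 -> exists h, h ∘ p = g) -> is_cokernel p f.
Proof.
move=> e m l; split=> // w g /l [h eh]; exists h; split=> // h' eh'.
by apply: m; rewrite eh.
Qed.

Hypothesis ab : is_abelian A.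

Lemma ker_ex x y (f : hom x y) : exists z (i : hom z x), is_kernel i f.
Proof. by case: ab => _ _ /(_ x y f) []. Qed.
Lemma coker_ex x y (f : hom x y) : exists z (p : hom y z), is_cokernel p f.
Proof. by case: ab => _ _ /(_ x y f) []. Qed.
Lemma mono_kernel x y (f : hom x y) : is_mono f -> exists z (g : hom y z), is_kernel f g.
Proof. by case: ab => _ _ _ h _; apply: h. Qed.
Lemma epi_cokernel x y (f : hom x y) : is_epi f -> exists z (g : hom z x), is_cokernel f g.
Proof. by case: ab => _ _ _ _ h; apply: h. Qed.

Lemma mono_epi_iso x y (f : hom x y) : is_mono f -> is_epi f -> is_iso f.
Proof.
move=> m e; case: (mono_kernel m) => z [g hg].
have g0 : g = 0 by apply: (epi0 e); case: hg.
case: (kernel_lift (g := idm y) hg) => [|h eh]; first by rewrite g0 comp0l.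
by exists h; split=> //; apply: m; rewrite comp_assoc eh comp_idl comp_idr.
Qed.

Lemma mono_of_ker x y (f : hom x y) :
  (forall z (i : hom z x), is_kernel i f -> is_zero_ob z) -> is_mono f.
Proof.
move=> h; apply: is_mono0 => w g e; case: (ker_ex f) => z [i hi].
by case: (kernel_lift hi e) => u <-; rewrite (zero_homl i (h _ _ hi)) comp0l.
Qed.

Lemma epi_of_coker x y (f : hom x y) :
  (forall z (p : hom y z), is_cokernel p f -> is_zero_ob z) -> is_epi f.
Proof.
move=> h; apply: is_epi0 => w g e; case: (coker_ex f) => z [i hi].
by case: (cokernel_desc hi e) => u <-; rewrite (zero_homr i (h _ _ hi)) comp0r.
Qed.

(** If [h] kills [f'], then [f] factors through the subobject [i ∘ j], which is the kernel of some
    [g]. This [g] kills [f], so it factors through [p] and kills [i]. Hence [i] factors through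
    [i ∘ j], the mono [j] is split epi, and [h] vanishes. *)
Lemma coimage_epi x y z w (f : hom x y) (p : hom y z) (i : hom w y) (f' : hom x w) :
  is_cokernel p f -> is_kernel i p -> i ∘ f' = f -> is_epi f'.
Proof.
move=> hp hi e; apply: is_epi0 => v h h0.
case: (ker_ex h) => u [j hj]; case: (kernel_lift hj h0) => f2 e2.
have m : is_mono (i ∘ j).
  move=> a s t; rewrite -!comp_assoc => /(kernel_mono hi); exact: (kernel_mono hj).
case: (mono_kernel m) => c [g hg].
have : g ∘ f = 0.
  by rewrite -e -e2 comp_assoc comp_assoc -(comp_assoc g); case: hg => ->; rewrite comp0l.
case/(cokernel_desc hp) => g' eg.
case: (kernel_lift (g := i) hg) => [|r er].
  by rewrite -eg -comp_assoc; case: hi => ->; rewrite comp0r.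
have : j ∘ r = idm w by apply: (kernel_mono hi); rewrite comp_assoc er comp_idr.
by case: hj => hj _ jr; rewrite -(comp_idr h) -jr comp_assoc hj comp0l.
Qed.

Lemma projective_lift x y z q (p : hom y z) (f : hom x y) (g : hom q y) :
  is_projective q -> is_cokernel p f -> p ∘ g = 0 -> exists t, f ∘ t = g.
Proof.
move=> pq hp e; case: (ker_ex p) => w [i hi].
case: (kernel_lift (g := f) hi) => [|f' ef]; first by case: hp.
case: (kernel_lift hi e) => g' <-.
by case: (pq _ _ f' g' (coimage_epi hp hi ef)) => t <-; exists t; rewrite comp_assoc ef.
Qed.

End AbelianLemmas.

(** * Finite direct sums and projective generators *)

Section DirectSums.
Variables (k : fieldType) (A : linCat k).

Record dsum n (x : A) := Dsum {
  ds_ob :> A;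
  ds_in : 'I_n -> hom x ds_ob;
  ds_pr : 'I_n -> hom ds_ob x;
  ds_id : forall j, ds_pr j ∘ ds_in j = idm x;
  ds_0 : forall i j, i <> j -> ds_pr i ∘ ds_in j = 0;
  ds_sum : \sum_j (ds_in j ∘ ds_pr j) = idm ds_ob
}.

Lemma dsum_ex n (x : A) : is_abelian A -> inhabited (dsum n x).
Proof.
move=> [[z hz] bi _ _ _].
elim: n => [|n [s]].
  split; apply: (@Dsum _ _ z (fun j => 0) (fun j => 0)); try by case.
  by rewrite big_ord0 hz.
have [t [i [j [p [q [pi qj e]]]]]] := bi s x.
(* The mixed composites are not part of [is_biproduct]: placing the decomposition of the identity
   between [q] and [i] gives [q ∘ i] twice. *)
have qi : q ∘ i = 0.
  have : q ∘ (i ∘ p + j ∘ q) ∘ i = q ∘ i by rewrite e comp_idr.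
  rewrite compDr compDl !comp_assoc qj comp_idl -comp_assoc pi comp_idr => /eqP.
  by rewrite -subr_eq0 addrK => /eqP.
have pj : p ∘ j = 0.
  have : p ∘ (i ∘ p + j ∘ q) ∘ j = p ∘ j by rewrite e comp_idr.
  rewrite compDr compDl !comp_assoc pi comp_idl -(comp_assoc _ q) qj comp_idr => /eqP.
  by rewrite -subr_eq0 addrK => /eqP.
split; apply: (@Dsum n.+1 x t
  (fun l => if unlift ord_max l is Some l' then i ∘ ds_in s l' else j)
  (fun l => if unlift ord_max l is Some l' then ds_pr s l' ∘ p else q)).
- move=> l; case: (unliftP ord_max l) => [l' _|_] //.
  by rewrite -comp_assoc (comp_assoc p) pi comp_idl ds_id.
- move=> a b; case: (unliftP ord_max a) => [a' ->|->]; case: (unliftP ord_max b) => [b' ->|->] //.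
  + move=> ab; rewrite -comp_assoc (comp_assoc p) pi comp_idl ds_0 // => e'.
    by apply: ab; rewrite e'.
  + by move=> _; rewrite -comp_assoc pj comp0r.
  + by move=> _; rewrite comp_assoc qi comp0l.
- rewrite (bigD1_ord ord_max) //= unlift_none -e addrC; congr (_ + _).
  rewrite (eq_bigr (fun l => i ∘ (ds_in s l ∘ ds_pr s l ∘ p))) => [|l _].
    by rewrite -comp_sumr -comp_suml ds_sum comp_idl.
  by rewrite liftK !comp_assoc.
Qed.

Lemma dsum_inP n x (s : dsum n x) y (f g : hom s y) :
  (forall j, f ∘ ds_in s j = g ∘ ds_in s j) -> f = g.
Proof.
move=> h; rewrite -(comp_idr f) -(comp_idr g) -ds_sum !comp_sumr.
by apply: eq_bigr => j _; rewrite !comp_assoc h.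
Qed.

Definition dsum_desc n x (s : dsum n x) y (f : 'I_n -> hom x y) : hom s y :=
  \sum_j (f j ∘ ds_pr s j).

Lemma dsum_descE n x (s : dsum n x) y (f : 'I_n -> hom x y) j :
  dsum_desc s f ∘ ds_in s j = f j.
Proof.
rewrite /dsum_desc comp_suml (bigD1 j) //= -comp_assoc ds_id comp_idr big1 ?addr0 //.
by move=> i /eqP ij; rewrite -comp_assoc ds_0 ?comp0r.
Qed.

End DirectSums.

Section Generator.
Variables (k : fieldType) (A : linCat k).

(* A projective [p] such that every object is a quotient of some [p^n]. *)
Definition proj_gen (p : A) := is_projective p /\
  forall x, exists n (q : 'I_n -> hom p x),
    forall y (g : hom x y), (forall i, g ∘ q i = 0) -> g = 0.

Lemma proj_gen_ex : is_finite A -> exists p : A, proj_gen p.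
Proof.
move=> [ab _ fl pr [n [s hs]]].
have : exists (p : A), is_projective p /\ forall i, exists e : hom p (s i), is_epi e.
  elim: n s {hs} => [|n ih] s.
    by case: ab => -[z hz] _ _ _ _; exists z; split=> [a b e f _|[]//];
      exists 0; rewrite (zero_homl f hz) comp0r.
  have [p [pp he]] := ih (fun i => s (lift ord0 i)).
  have [p' [e' [pp' he']]] := pr (s ord0).
  have [_ /(_ p p') [t [i [j [a [b [ai bj e]]]]]] _ _ _] := ab.
  exists t; split.
    move=> u v h f hh; have [g1 e1] := pp _ _ h (f ∘ i) hh.
    have [g2 e2] := pp' _ _ h (f ∘ j) hh.
    exists (g1 ∘ a + g2 ∘ b).
    by rewrite compDr !comp_assoc e1 e2 -!comp_assoc -compDr e comp_idr.
  move=> l; case: (unliftP ord0 l) => [l' ->|->].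
    have [q hq] := he l'; exists (q ∘ a); apply: is_epi0 => w g h0.
    by apply: (epi0 hq); rewrite -(comp_idr (g ∘ q)) -ai -comp_assoc (comp_assoc q) comp_assoc h0 comp0l.
  exists (e' ∘ b); apply: is_epi0 => w g h0.
  by apply: (epi0 he'); rewrite -(comp_idr (g ∘ e')) -bj -comp_assoc (comp_assoc e') comp_assoc h0 comp0l.
(* Since [p] maps onto every simple object, induction on length applies: for an extension of a
   simple [t] by [y], the maps that generate [y] are completed by one lift [v : p -> x] of a map
   onto [t]. *)
move=> [p [pp he]]; exists p; split=> // x; elim: {x}(fl x) => [x hx|y x t i q _ [m [f hf]] st ki cq].
  exists 0%N, (fun _ => 0) => y g _; exact: zero_homl.
have [j [u [u' [e1 e2]]]] := hs t st; have [e he'] := he j.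
have [v ev] := pp _ _ q (u' ∘ e) (cokernel_epi cq).
exists m.+1, (fun l => if unlift ord_max l is Some l' then i ∘ f l' else v) => z g hg.
have gi : g ∘ i = 0.
  by apply: hf => l; have := hg (lift ord_max l); rewrite liftK comp_assoc.
have [h eh] := cokernel_desc cq gi.
have := hg ord_max; rewrite unlift_none -eh -comp_assoc ev comp_assoc => /(epi0 he') h0.
by rewrite -(comp_idr h) -e1 comp_assoc h0 comp0l comp0l.
Qed.

Lemma proj_gen_cover (p x : A) : is_abelian A -> proj_gen p ->
  exists n (s : dsum n p) (q : hom s x), is_epi q.
Proof.
move=> ab [_ /(_ x) [n [q hq]]]; have [s] := dsum_ex n p ab.
exists n, s, (dsum_desc s q); apply: is_epi0 => y g e; apply: hq => i.
by rewrite -(dsum_descE s q) comp_assoc e comp0l.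
Qed.

End Generator.

(* Left exact contravariant functors with finite-dimensional values on a finite
   category are representable: start from the tautological element over a sum of
   copies of the generator, one for each element of a spanning family, and divide
   by the maps from the generator that kill it. *)
Section Representability.
Variables (k : fieldType) (A : linCat k) (Phi : A -> lmodType k).
Variable Phm : forall x y, hom x y -> {linear Phi y -> Phi x}.
Hypotheses (finA : is_finite A) (Phi_fd : forall x, fin_dim (Phi x)).
Hypothesis Phm_id : forall x s, Phm (idm x) s = s.
Hypothesis Phm_comp : forall x y z (g : hom y z) (f : hom x y) s,
  Phm (g ∘ f) s = Phm f (Phm g s).
Hypothesis Phm_linear : forall x y s, linear (fun f : hom x y => Phm f s).
Hypothesis Phm_exact : forall x y z (p : hom y z) (f : hom x y), is_cokernel p f ->
  forall s, Phm f s = 0 -> exists! s', Phm p s' = s.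

Lemma Phm_sum n x y (f : 'I_n -> hom x y) s :
  Phm (\sum_i f i) s = \sum_i Phm (f i) s.
Proof.
have l := @Phm_linear x y s.
exact: (linear_sum (mk_linear l) (index_enum 'I_n) xpredT f).
Qed.

Lemma PhmZ x y a (f : hom x y) s : Phm (a *: f) s = a *: Phm f s.
Proof. by rewrite -[LHS]/(mk_linear (@Phm_linear x y s) (a *: f)) linearZ. Qed.

Lemma PhmB x y (f g : hom x y) s : Phm (f - g) s = Phm f s - Phm g s.
Proof. by rewrite -[LHS]/(mk_linear (@Phm_linear x y s) (f - g)) linearB. Qed.

Theorem representable :
  exists X (s : Phi X), forall x (t : Phi x), exists! f : hom x X, Phm f s = t.
Proof.
have [ab hfd _ _ _] := finA; have [p pg] := proj_gen_ex finA; have [pp _] := pg.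
have [n [b hb]] := Phi_fd p; have [U] := dsum_ex n p ab.
pose s0 := \sum_i Phm (ds_pr U i) (b i).
have s0E i : Phm (ds_in U i) s0 = b i.
  rewrite /s0 linear_sum (bigD1 i) //= -Phm_comp ds_id Phm_id big1 ?addr0 // => j /eqP ji.
  rewrite -Phm_comp ds_0 //; have := PhmZ 0 (0 : hom p p) (b j); by rewrite !scale0r.
have [r [f [beta [fK hf]]]] :=
  subset_basis (fun f : hom p U => Phm f s0 = 0) (hfd p U).
have [V] := dsum_ex r p ab.
have [X [q hq]] := coker_ex ab (dsum_desc V f).
have qf j : q ∘ f j = 0 by case: hq => h _; rewrite -(dsum_descE V f) comp_assoc h comp0l.
have [s [es _]] : exists! s, Phm q s = s0.
  apply: (Phm_exact hq); rewrite /dsum_desc Phm_sum big1 // => j _.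
  by rewrite Phm_comp fK linear0.
have inj_p (g : hom p X) : Phm g s = 0 -> g = 0.
  have [g' <-] := pp _ _ q g (cokernel_epi hq).
  rewrite Phm_comp es => /hf ->; rewrite comp_sumr big1 // => j _.
  by rewrite compZr qf scaler0.
have surj_p (t : Phi p) : exists g : hom p X, Phm g s = t.
  have [a ->] := hb t; exists (q ∘ \sum_i a i *: ds_in U i).
  rewrite Phm_comp es Phm_sum; apply: eq_bigr => i _; by rewrite PhmZ s0E.
have inj_x x (g : hom x X) : Phm g s = 0 -> g = 0.
  move=> e; have [_ [m [h hh]]] := (pp, pg.2 x); apply: hh => i; apply: inj_p.
  by rewrite Phm_comp e linear0.
exists X, s => x t.
have [m [W [e he]]] := proj_gen_cover x ab pg.
have [z [d hd]] := epi_cokernel ab he.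
(* The map is prescribed on each copy of [p] in the cover [W] of [x]. It kills the relations [d]
   because evaluation at [s] is injective, and so descends to [x]. *)
pose v : hom W X := dsum_desc W (fun i => projT1 (cid (surj_p (Phm (e ∘ ds_in W i) t)))).
have vE : Phm v s = Phm e t.
  rewrite -(Phm_id (Phm v s)) -(Phm_id (Phm e t)) -(ds_sum W) !(Phm_sum (fun j => ds_in W j ∘ ds_pr W j)).
  apply: eq_bigr => i _; rewrite !Phm_comp -!(Phm_comp _ (ds_in W i)) dsum_descE.
  by case: (cid (surj_p _)) => g /= ->.
have vd : v ∘ d = 0.
  apply: inj_x; rewrite Phm_comp vE -Phm_comp; case: hd => -> _.
  have := PhmZ 0 (0 : hom z x) t; by rewrite !scale0r.
have [g eg] := cokernel_desc hd vd.
have gE : Phm g s = t.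
  have [|u [_ hu]] := Phm_exact hd (s := Phm e t).
    rewrite -Phm_comp; case: hd => -> _.
    have := PhmZ 0 (0 : hom z x) t; by rewrite !scale0r.
  by rewrite -(hu t) // (hu (Phm g s)) // -Phm_comp eg.
exists g; split=> // g' eg'; apply/eqP; rewrite -subr_eq0; apply/eqP; apply: inj_x.
by rewrite PhmB gE eg' subrr.
Qed.

End Representability.

(** * Module categories *)

Section ActionLemmas.
Variables (k : fieldType) (C : monCat k) (M : modCat C).
Implicit Types (c d : C) (m : M).

Lemma act_compl c c' c'' m (f' : hom c' c'') (f : hom c c') :
  (f' ∘ f) ▶ idm m = (f' ▶ idm m) ∘ (f ▶ idm m).
Proof. by rewrite -actm_comp comp_idl. Qed.

Lemma act_compr c m m' m'' (g' : hom m' m'') (g : hom m m') :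
  idm c ▶ (g' ∘ g) = (idm c ▶ g') ∘ (idm c ▶ g).
Proof. by rewrite -actm_comp comp_idl. Qed.

Lemma act_lr c c' m m' (f : hom c c') (g : hom m m') :
  f ▶ g = (f ▶ idm m') ∘ (idm c ▶ g).
Proof. by rewrite -actm_comp comp_idl comp_idr. Qed.

Lemma act_rl c c' m m' (f : hom c c') (g : hom m m') :
  f ▶ g = (idm c' ▶ g) ∘ (f ▶ idm m).
Proof. by rewrite -actm_comp comp_idl comp_idr. Qed.

Lemma act_swap c c' m m' (f : hom c c') (g : hom m m') :
  (idm c' ▶ g) ∘ (f ▶ idm m) = (f ▶ idm m') ∘ (idm c ▶ g).
Proof. by rewrite -act_rl act_lr. Qed.

Lemma act0l c c' m m' (g : hom m m') : (0 : hom c c') ▶ g = 0.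
Proof.
by have := actm_linl (c:=c) (c':=c') g (-1) 0 0; rewrite scaler0 addr0 scaleN1r addNr.
Qed.

Lemma inv_act c c' m m' (f : hom c c') (g : hom m m') : is_iso f -> is_iso g ->
  inv (f ▶ g) = inv f ▶ inv g.
Proof.
by move=> hf hg; apply: is_inverse_inv; split;
  rewrite -actm_comp ?invL ?invR ?actm_id.
Qed.

Lemma inv_actr c m m' (g : hom m m') : is_iso g -> inv (idm c ▶ g) = idm c ▶ inv g.
Proof. by move=> h; rewrite inv_act ?inv_idm //; apply: is_iso_id. Qed.
Lemma inv_actl c c' m (f : hom c c') : is_iso f -> inv (f ▶ idm m) = inv f ▶ idm m.
Proof. by move=> h; rewrite inv_act ?inv_idm //; apply: is_iso_id. Qed.

Lemma iso_actr c m m' (g : hom m m') : is_iso g -> is_iso (idm c ▶ g).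
Proof. by apply: is_iso_actm; apply: is_iso_id. Qed.
Lemma iso_actl c c' m (f : hom c c') : is_iso f -> is_iso (f ▶ idm m).
Proof. by move=> h; apply: is_iso_actm => //; apply: is_iso_id. Qed.

Lemma act_one_inj m m' (f g : hom m m') : idm (@one k C) ▶ f = idm one ▶ g -> f = g.
Proof. by move=> e; apply: (iso_epi (munit_iso m)); rewrite -!munit_nat e. Qed.

Lemma massoc_natr c d m m' (h : hom m m') :
  massoc c d m' ∘ (idm (c ⊗ d) ▶ h) = (idm c ▶ (idm d ▶ h)) ∘ massoc c d m.
Proof. by rewrite -massoc_nat tensm_id. Qed.

(* Kelly's coherence: the second unit triangle follows from the first. *)
Lemma munit_act c m : munit (c ▷ m) ∘ massoc one c m = lunit c ▶ idm m.
Proof.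
apply: act_one_inj; rewrite act_compr.
apply: (iso_epi (massoc_iso one (one ⊗ c) m)).
apply: (iso_epi (iso_actl m (assoc_iso one one c))).
rewrite -!comp_assoc (comp_assoc _ (massoc _ _ _)) -mod_pentagon.
rewrite comp_assoc mod_triangle (comp_assoc _ (massoc _ _ _)) -massoc_nat.
rewrite -comp_assoc -act_compl mon_triangle.
by rewrite massoc_nat actm_id.
Qed.

Lemma massoc_munit c m :
  inv (massoc c one m) ∘ (idm c ▶ inv (munit m)) = inv (runit c) ▶ idm m.
Proof.
have i := massoc_iso c one m; have j := munit_iso m; have r := runit_iso c.
rewrite -inv_actr // -inv_comp //; last exact: iso_actr.
by rewrite mod_triangle inv_actl.
Qed.

Lemma mod_pentagon_inv c d e m :
  (assoc c d e ▶ idm m) ∘ (inv (massoc (c ⊗ d) e m) ∘ inv (massoc c d (e ▷ m))) =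
  inv (massoc c (d ⊗ e) m) ∘ (idm c ▶ inv (massoc d e m)).
Proof.
have i a b x := @massoc_iso k C M a b x.
rewrite -(inv_actr c (i d e m)) -!inv_comp //; last exact: iso_actr.
apply: (iso_epi (is_iso_comp (i c d (e ▷ m)) (i (c ⊗ d) e m))).
rewrite -comp_assoc invL ?comp_idr; last exact: is_iso_comp.
rewrite mod_pentagon comp_assoc invL ?comp_idl //.
by apply: is_iso_comp => //; apply: iso_actr.
Qed.

End ActionLemmas.

Section Regular.
Variable k : fieldType.

Definition reg (C : monCat k) : modCat C :=
  @ModCat k C C (@tens k C) (@tensm k C) (@assoc k C) (@lunit k C)
    (@tensm_id k C) (@tensm_comp k C) (@tensm_linl k C) (@tensm_linr k C)
    (@assoc_iso k C) (@assoc_nat k C) (@lunit_iso k C) (@lunit_nat k C)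
    (@mon_pentagon k C) (@mon_triangle k C).

Variable C : monCat k.

Lemma tens_compr (x y y' y'' : C) (g' : hom y' y'') (g : hom y y') :
  idm x ⊠ (g' ∘ g) = (idm x ⊠ g') ∘ (idm x ⊠ g).
Proof. by rewrite -tensm_comp comp_idl. Qed.

Lemma tens_compl (x x' x'' y : C) (f' : hom x' x'') (f : hom x x') :
  (f' ∘ f) ⊠ idm y = (f' ⊠ idm y) ∘ (f ⊠ idm y).
Proof. by rewrite -tensm_comp comp_idl. Qed.

Lemma lunit_tens (x y : C) : lunit (x ⊗ y) ∘ assoc one x y = lunit x ⊠ idm y.
Proof. exact: (@munit_act k C (reg C) x y). Qed.

(** Statements about right actions are obtained below as the left-handed ones for the reversed
    categories. *)
Program Definition rev : monCat k :=
  @MonCat k C (fun x y => y ⊗ x) (fun x x' y y' f g => g ⊠ f) one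
    (fun x y z => inv (assoc z y x)) (fun x => runit x) (fun x => lunit x)
    _ _ _ _ _ _ _ _ _ _ _ _.
Next Obligation. exact: tensm_id. Qed.
Next Obligation. exact: tensm_comp. Qed.
Next Obligation. exact: tensm_linr. Qed.
Next Obligation. exact: tensm_linl. Qed.
Next Obligation. exact/is_iso_inv/assoc_iso. Qed.
Next Obligation.
have i := assoc_iso z y x; have j := assoc_iso z' y' x'.
apply: (iso_mono j); apply: (iso_epi i).
by rewrite comp_assoc invR // comp_idl !comp_assoc assoc_nat -!comp_assoc invL // comp_idr.
Qed.
Next Obligation. exact: runit_iso. Qed.
Next Obligation. exact: runit_nat. Qed.
Next Obligation. exact: lunit_iso. Qed.
Next Obligation. exact: lunit_nat. Qed.
Next Obligation.
have i a b c := @assoc_iso k C a b c.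
have it (a b c d : C) : is_iso (idm d ⊠ assoc a b c) by apply: is_iso_tensm; [apply: is_iso_id | apply: i].
have ti (a b c d : C) : is_iso (assoc a b c ⊠ idm d) by apply: is_iso_tensm; [apply: i | apply: is_iso_id].
have e := mon_pentagon z y x w; have {}e := congr1 (@inv _ _ _ _) e.
rewrite !inv_comp // in e; last exact: is_iso_comp.
have t1 (a b c d : C) : inv (assoc a b c ⊠ idm d) = inv (assoc a b c) ⊠ idm d.
  exact: (@inv_actl k C (reg C) _ _ d _ (i a b c)).
have t2 (a b c d : C) : inv (idm d ⊠ assoc a b c) = idm d ⊠ inv (assoc a b c).
  exact: (@inv_actr k C (reg C) d _ _ _ (i a b c)).
by rewrite -t1 -t2 e comp_assoc.
Qed.
Next Obligation.
have i := assoc_iso y one x; apply: (iso_epi i).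
by rewrite -comp_assoc invL // comp_idr mon_triangle.
Qed.

End Regular.

(** * Dual objects acting on module categories *)

Section DualAction.
Variables (k : fieldType) (C : monCat k) (M : modCat C) (c c' : C).
Variables (ev : hom (c' ⊗ c) one) (coev : hom one (c ⊗ c')).
Hypothesis zig :
  runit c ∘ (idm c ⊠ ev) ∘ assoc c c' c ∘ (coev ⊠ idm c) ∘ inv (lunit c) = idm c.
Hypothesis zag :
  lunit c' ∘ (ev ⊠ idm c') ∘ inv (assoc c' c c') ∘ (idm c' ⊠ coev) ∘ inv (runit c')
  = idm c'.

(** With [act_coev], the counit and unit of the adjunction between [c' ▷ -] and its right adjoint
    [c ▷ -]. *)
Definition act_ev (m : M) : hom (c' ▷ (c ▷ m)) m :=
  munit m ∘ ((ev ▶ idm m) ∘ inv (massoc c' c m)).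
Definition act_coev (m : M) : hom m (c ▷ (c' ▷ m)) :=
  massoc c c' m ∘ ((coev ▶ idm m) ∘ inv (munit m)).

Lemma inv_massoc_nat a b a' b' m m' (f : hom a a') (g : hom b b') (h : hom m m') :
  inv (massoc a' b' m') ∘ (f ▶ (g ▶ h)) = ((f ⊠ g) ▶ h) ∘ inv (massoc a b m) :> hom _ (_ ▷ (m' : M)).
Proof.
apply: (iso_mono (massoc_iso a' b' m')); apply: (iso_epi (massoc_iso a b m)).
by rewrite -!comp_assoc invL ?comp_idr ?massoc_nat; try exact: massoc_iso;
  rewrite invKV //; apply: massoc_iso.
Qed.

Lemma inv_munit_nat m m' (f : hom m m') :
  inv (munit m') ∘ f = (idm one ▶ f) ∘ inv (munit m) :> hom _ (_ ▷ (m' : M)).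
Proof.
apply: (iso_mono (munit_iso m')); apply: (iso_epi (munit_iso m)).
by rewrite -!comp_assoc invL ?comp_idr ?munit_nat; try exact: munit_iso;
  rewrite invKV //; apply: munit_iso.
Qed.

Lemma act_ev_nat m m' (f : hom m m') :
  act_ev m' ∘ (idm c' ▶ (idm c ▶ f)) = f ∘ act_ev m.
Proof.
rewrite /act_ev -!comp_assoc inv_massoc_nat tensm_id (comp_assoc (ev ▶ _)).
by rewrite -act_swap !comp_assoc munit_nat.
Qed.

Lemma act_coev_nat m m' (f : hom m m') :
  act_coev m' ∘ f = (idm c ▶ (idm c' ▶ f)) ∘ act_coev m.
Proof.
rewrite /act_coev -!comp_assoc inv_munit_nat (comp_assoc (coev ▶ _)) -act_swap.
by rewrite !comp_assoc massoc_natr.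
Qed.

Lemma act_zig m : (idm c ▶ act_ev m) ∘ act_coev (c ▷ m) = idm (c ▷ m).
Proof.
have i a b := @massoc_iso k C M a b m; have j := munit_iso.
rewrite /act_ev /act_coev !act_compr -!comp_assoc.
rewrite -(inv_actr c (i c' c)).
have -> : inv (idm c ▶ massoc c' c m) ∘ (massoc c c' (c ▷ m)
    ∘ (coev ▶ idm (c ▷ m) ∘ inv (munit (c ▷ m)))) =
  massoc c (c' ⊗ c) m ∘ ((assoc c c' c ∘ (coev ⊠ idm c) ∘ inv (lunit c)) ▶ idm m).
  apply: (iso_mono (iso_actr c (i c' c))); rewrite invKV; last exact: iso_actr.
  rewrite !act_compl -inv_actl; last exact: lunit_iso.
  rewrite -munit_act inv_comp ?massoc_iso // !comp_assoc -mod_pentagon.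
  have e := massoc_nat coev (idm c) (idm m); rewrite actm_id in e.
  by rewrite -(comp_assoc _ (massoc (c ⊗ c') c m)) e -!comp_assoc invKV //.
rewrite (comp_assoc _ (massoc c (c' ⊗ c) m)) -massoc_nat -comp_assoc -act_compl.
by rewrite (comp_assoc _ (massoc c one m)) mod_triangle -act_compl !comp_assoc zig actm_id.
Qed.

Lemma act_zag m : act_ev (c' ▷ m) ∘ (idm c' ▶ act_coev m) = idm (c' ▷ m).
Proof.
have i a b x := @massoc_iso k C M a b x; have j := munit_iso.
rewrite /act_ev /act_coev !act_compr -!comp_assoc.
have -> : inv (massoc c' c (c' ▷ m)) ∘ ((idm c' ▶ massoc c c' m)
    ∘ ((idm c' ▶ (coev ▶ idm m)) ∘ (idm c' ▶ inv (munit m)))) =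
  massoc (c' ⊗ c) c' m ∘ ((inv (assoc c' c c') ∘ (idm c' ⊠ coev) ∘ inv (runit c')) ▶ idm m).
  apply: (iso_mono (i c' c (c' ▷ m))); rewrite invKV //.
  rewrite (comp_assoc (massoc c' c _)) mod_pentagon !act_compl.
  rewrite -!comp_assoc (comp_assoc (assoc c' c c' ▶ _)) -act_compl invR ?actm_id ?comp_idl;
    last exact: assoc_iso.
  rewrite (comp_assoc (massoc c' _ _)) massoc_nat -!comp_assoc; congr (_ ∘ (_ ∘ _)).
  by rewrite -massoc_munit invKV.
have e := massoc_nat ev (idm c') (idm m); rewrite actm_id in e.
rewrite (comp_assoc _ (massoc (c' ⊗ c) c' m)) -e -comp_assoc -act_compl.
by rewrite (comp_assoc _ (massoc one c' m)) munit_act -act_compl !comp_assoc zag actm_id.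
Qed.

End DualAction.

(* A lax module functor over a rigid category is strong: the inverse of the
   constraint at [c] is the transpose of the constraint at a dual of [c]. *)
Section LaxStrong.
Variables (k : fieldType) (C : monCat k) (N M : modCat C) (U : functor M N).
Variable l : forall (c : C) (y : M), hom (c ▷ U y) (U (c ▷ y)).
Hypothesis rigC : is_rigid C.
Hypothesis l_nat : forall c c' y y' (f : hom c c') (g : hom y y'),
  l c' y' ∘ (f ▶ fmap U g) = fmap U (f ▶ g) ∘ l c y.
Hypothesis l_assoc : forall c d y,
  l c (d ▷ y) ∘ ((idm c ▶ l d y) ∘ massoc c d (U y)) = fmap U (massoc c d y) ∘ l (c ⊗ d) y.
Hypothesis l_unit : forall y, fmap U (munit y) ∘ l one y = munit (U y).

Lemma lax_strong c y : is_iso (l c y).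
Proof.
have [[c' [ev [coev [zig zag]]]] _] := rigC c.
have l_ev z : fmap U (act_ev ev z) ∘ (l c' (c ▷ z) ∘ (idm c' ▶ l c z)) = act_ev ev (U z).
  have e : l c' (c ▷ z) ∘ (idm c' ▶ l c z) =
      fmap U (massoc c' c z) ∘ l (c' ⊗ c) z ∘ inv (massoc c' c (U z)).
    by rewrite -l_assoc -!comp_assoc invR ?comp_idr //; apply: massoc_iso.
  rewrite e /act_ev !fmap_comp -!comp_assoc (comp_assoc (fmap U (inv _))) -fmap_comp.
  rewrite invL ?fmap_id ?comp_idl; last exact: massoc_iso.
  rewrite (comp_assoc _ (l (c' ⊗ c) z)).
  have := l_nat ev (idm z); rewrite fmap_id => <-.
  by rewrite !comp_assoc l_unit.
have l_coev z : l c (c' ▷ z) ∘ ((idm c ▶ l c' z) ∘ act_coev coev (U z)) =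
    fmap U (act_coev coev z).
  rewrite /act_coev !comp_assoc -(comp_assoc (l c _)) l_assoc.
  rewrite !fmap_comp -!comp_assoc; congr (_ ∘ _).
  have := l_nat coev (idm z); rewrite fmap_id comp_assoc => ->.
  rewrite -comp_assoc; congr (_ ∘ _); apply: (iso_mono (is_iso_fmap U (munit_iso z))).
  by rewrite comp_assoc l_unit -fmap_comp invR ?invR ?fmap_id //; apply: munit_iso.
pose r := (idm c ▶ fmap U (act_ev ev y)) ∘ ((idm c ▶ l c' (c ▷ y)) ∘ act_coev coev (U (c ▷ y))).
exists r; split; rewrite /r.
  rewrite -comp_assoc -(comp_assoc (idm c ▶ l c' _)) act_coev_nat.
  rewrite (comp_assoc (idm c ▶ l c' _)) -act_compr comp_assoc -act_compr l_ev.
  exact: act_zig.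
rewrite (comp_assoc _ (idm c ▶ fmap U _)).
have := l_nat (idm c) (act_ev ev y) => ->.
by rewrite -comp_assoc l_coev -fmap_comp act_zig // fmap_id.
Qed.

End LaxStrong.

(** * Module transformations and module adjunctions *)

Section ModNatCalculus.
Variables (k : fieldType) (C : monCat k).
Implicit Types L M N P : modCat C.

(** Left whiskering uses exactly this half of naturality, which for [chi_act] is checked
    directly. *)
Definition str_nat M N (H : premodFunctor M N) := forall c m m' (g : hom m m'),
  pm_str H c m' ∘ fmap H (idm c ▶ g) = (idm c ▶ fmap H g) ∘ pm_str H c m.

Lemma mf_str_nat M N (H : premodFunctor M N) : is_modFunctor H -> str_nat H.
Proof. by case=> _ h _ _ c m m' g; apply: h. Qed.

Lemma mn_id M N (H : premodFunctor M N) : @is_modNat _ _ _ _ H H (fun m => idm (H m)).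
Proof. by split=> [x y f|c m]; rewrite ?actm_id ?comp_idl ?comp_idr. Qed.

Lemma mn_comp M N (H K L : premodFunctor M N) a b :
  @is_modNat _ _ _ _ H K a -> @is_modNat _ _ _ _ K L b ->
  @is_modNat _ _ _ _ H L (fun m => b m ∘ a m).
Proof.
move=> [an am] [bn bm]; split=> [x y f|c m] /=.
  by rewrite comp_assoc bn -comp_assoc an comp_assoc.
by rewrite comp_assoc bm -comp_assoc am comp_assoc -actm_comp comp_idl.
Qed.

Lemma mn_inv M N (H K : premodFunctor M N) a :
  @is_modNat _ _ _ _ H K a -> (forall m, is_iso (a m)) ->
  @is_modNat _ _ _ _ K H (fun m => inv (a m)).
Proof.
move=> [an am] ia; split=> [x y f|c m].
  apply: (iso_mono (ia y)); apply: (iso_epi (ia x)).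
  by rewrite -!comp_assoc invL // comp_idr (comp_assoc (a y)) invR // comp_idl an.
apply: (iso_mono (iso_actr c (ia m))); apply: (iso_epi (ia (c ▷ m))).
rewrite -!comp_assoc invL // comp_idr (comp_assoc (idm c ▶ a m)) -act_compr invR //.
by rewrite actm_id comp_idl am.
Qed.

Lemma mn_whl M N P (K : premodFunctor N P) (H H' : premodFunctor M N) a :
  str_nat K -> @is_modNat _ _ _ _ H H' a ->
  @is_modNat _ _ _ _ (comp_pm K H) (comp_pm K H') (fun m => fmap K (a m)).
Proof.
move=> sK [an am]; split=> [x y f|c m] /=; first by rewrite -!fmap_comp an.
by rewrite -comp_assoc -fmap_comp am fmap_comp !comp_assoc sK.
Qed.

Lemma mn_whr M N P (K : premodFunctor M N) (H H' : premodFunctor N P) a :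
  @is_modNat _ _ _ _ H H' a ->
  @is_modNat _ _ _ _ (comp_pm H K) (comp_pm H' K) (fun m => a (K m)).
Proof.
move=> [an am]; split=> [x y f|c m] /=; first exact: an.
by rewrite -comp_assoc an !comp_assoc am.
Qed.

Lemma mn_ext M N (H K : premodFunctor M N) a b : (forall m, a m = b m) ->
  @is_modNat _ _ _ _ H K a -> @is_modNat _ _ _ _ H K b.
Proof. by move=> e; have -> : a = b by apply: functional_extensionality_dep. Qed.

Lemma pm_comp_mf M N P (K : premodFunctor N P) (H : premodFunctor M N) :
  is_modFunctor K -> is_modFunctor H -> is_modFunctor (comp_pm K H).
Proof.
case=> Ki Kn Ka Ku [Hi Hn Ha Hu]; split=> /= [c m|c c' m m' f g|c d m|m].
- by apply: is_iso_comp => //; apply: is_iso_fmap.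
- by rewrite -comp_assoc -fmap_comp Hn fmap_comp comp_assoc Kn comp_assoc.
- rewrite comp_assoc Ka -!comp_assoc -fmap_comp Ha !fmap_comp.
  rewrite !comp_assoc -(comp_idl (idm c)) actm_comp !comp_idl; congr (_ ∘ _ ∘ _).
  by rewrite -!comp_assoc Kn.
- by rewrite comp_assoc Ku -fmap_comp Hu.
Qed.

End ModNatCalculus.

Section ModAdjunction.
Variables (k : fieldType) (C : monCat k).

Record madj (N M : modCat C) (A : premodFunctor N M) (U : premodFunctor M N) := Madj {
  un : forall x : N, hom x (U (A x));
  co : forall y : M, hom (A (U y)) y;
  un_mn : @is_modNat _ _ _ _ (id_pm N) (comp_pm U A) un;
  co_mn : @is_modNat _ _ _ _ (comp_pm A U) (id_pm M) co;
  triL : forall x, co (A x) ∘ fmap A (un x) = idm (A x);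
  triR : forall y, fmap U (co y) ∘ un (U y) = idm (U y)
}.

Section Lax.
Variables (N M : modCat C) (A : premodFunctor N M) (hA : is_modFunctor A).
Variables (U : functor M N) (adj : adjunction A U).

(* Locked to prevent rewriting from unfolding it. *)
Fact ra_lax_key : unit. Proof. exact: tt. Qed.
Definition ra_lax c y : hom (c ▷ U y) (U (c ▷ y)) := locked_with ra_lax_key
  (fmap U ((idm c ▶ adj_counit adj y) ∘ pm_str A c (U y)) ∘ adj_unit adj (c ▷ U y)).
Lemma ra_lax_def c y : ra_lax c y =
  fmap U ((idm c ▶ adj_counit adj y) ∘ pm_str A c (U y)) ∘ adj_unit adj (c ▷ U y).
Proof. exact: unlock. Qed.

Lemma adj_inj x y (f g : hom x (U y)) :
  adj_counit adj y ∘ fmap A f = adj_counit adj y ∘ fmap A g -> f = g.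
Proof.
move=> e; rewrite -(comp_idl f) -(comp_idl g) -(adj_triR adj) -!comp_assoc.
by rewrite -!adj_unit_nat !comp_assoc -!fmap_comp e.
Qed.

Lemma ra_laxE c y : adj_counit adj (c ▷ y) ∘ fmap A (ra_lax c y) =
  (idm c ▶ adj_counit adj y) ∘ pm_str A c (U y).
Proof.
by rewrite ra_lax_def fmap_comp comp_assoc -adj_counit_nat -comp_assoc adj_triL comp_idr.
Qed.

Lemma ra_lax_nat c c' y y' (f : hom c c') (g : hom y y') :
  ra_lax c' y' ∘ (f ▶ fmap U g) = fmap U (f ▶ g) ∘ ra_lax c y.
Proof.
case: hA => _ hn _ _; apply: adj_inj; rewrite !fmap_comp !comp_assoc ra_laxE.
rewrite -adj_counit_nat -!comp_assoc ra_laxE hn !comp_assoc -!actm_comp.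
by rewrite comp_idl comp_idr -adj_counit_nat.
Qed.

Lemma ra_lax_assoc c d y :
  ra_lax c (d ▷ y) ∘ ((idm c ▶ ra_lax d y) ∘ massoc c d (U y)) =
  fmap U (massoc c d y) ∘ ra_lax (c ⊗ d) y.
Proof.
case: hA => _ hn ha _; apply: adj_inj; rewrite !fmap_comp !comp_assoc ra_laxE.
rewrite -adj_counit_nat -!comp_assoc ra_laxE (comp_assoc (pm_str A c _)) hn.
rewrite !comp_assoc -act_compr ra_laxE act_compr massoc_natr -!comp_assoc ha.
by rewrite !comp_assoc.
Qed.

Lemma ra_lax_unit y : fmap U (munit y) ∘ ra_lax one y = munit (U y).
Proof.
case: hA => _ hn _ hu; apply: adj_inj; rewrite fmap_comp comp_assoc -adj_counit_nat.
by rewrite -comp_assoc ra_laxE comp_assoc munit_nat -comp_assoc hu.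
Qed.

Hypothesis rigC : is_rigid C.

(** The right adjoint of a module functor inherits a lax structure; rigidity of [C] makes it
    strong. *)
Lemma ra_lax_iso c y : is_iso (ra_lax c y).
Proof. exact: (lax_strong rigC ra_lax_nat ra_lax_assoc ra_lax_unit). Qed.

Definition ra_pm : premodFunctor M N :=
  @PremodFunctor _ C M N U (fun c y => inv (ra_lax c y)).

Lemma ra_pm_mf : is_modFunctor ra_pm.
Proof.
have i := ra_lax_iso; split=> /= [c y|c c' y y' f g|c d y|y].
- exact/is_iso_inv/i.
- apply: (iso_mono (i c' y')); rewrite invKV // comp_assoc ra_lax_nat -comp_assoc.
  by rewrite invR // comp_idr.
- apply: (iso_epi (i (c ⊗ d) y)); rewrite -!comp_assoc invL // comp_idr.
  rewrite -ra_lax_assoc invK // comp_assoc -act_compr invL // actm_id comp_idl //.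
- by apply: (iso_epi (i one y)); rewrite -comp_assoc invL // comp_idr ra_lax_unit.
Qed.

Program Definition ra_madj : madj A ra_pm :=
  @Madj N M A ra_pm (adj_unit adj) (adj_counit adj) _ _ (adj_triL adj) (adj_triR adj).
Next Obligation.
split=> [x y f|c m] /=; first exact: adj_unit_nat.
have i := ra_lax_iso; case: hA => _ hn _ _.
apply: (iso_mono (i c (A m))); rewrite comp_idr -comp_assoc invKV //; apply: adj_inj.
rewrite !fmap_comp !comp_assoc -adj_counit_nat ra_laxE -!comp_assoc adj_triL comp_idr.
by rewrite hn comp_assoc -act_compr adj_triL actm_id comp_idl.
Qed.
Next Obligation.
split=> [x y f|c m] /=; first exact: adj_counit_nat.
have i := ra_lax_iso; apply: (iso_epi (is_iso_fmap A (i c m))).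
rewrite comp_idl ra_laxE -!comp_assoc -fmap_comp invL // fmap_id comp_idr //.
Qed.

End Lax.
End ModAdjunction.

(** * Exactness and adjoint functors *)

Section FunctorExactness.
Variables (k : fieldType) (A B : linCat k) (F : functor A B).

Lemma fmap0 x y : fmap F (0 : hom x y) = 0.
Proof.
by have := @fmap_linear _ _ _ F x y (-1) 0 0; rewrite scaler0 addr0 scaleN1r addNr.
Qed.
Lemma fmapD x y (f g : hom x y) : fmap F (f + g) = fmap F f + fmap F g.
Proof. by have := @fmap_linear _ _ _ F x y 1 f g; rewrite !scale1r. Qed.
Lemma fmapZ x y a (f : hom x y) : fmap F (a *: f) = a *: fmap F f.
Proof. by have := @fmap_linear _ _ _ F x y a f 0; rewrite fmap0 !addr0. Qed.
Lemma fmapB x y (f g : hom x y) : fmap F (f - g) = fmap F f - fmap F g.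
Proof. by rewrite fmapD -scaleN1r fmapZ scaleN1r. Qed.
Lemma fmap_sum n x y (f : 'I_n -> hom x y) : fmap F (\sum_i f i) = \sum_i fmap F (f i).
Proof.
elim: n f => [|n ih] f; first by rewrite !big_ord0 fmap0.
by rewrite !big_ord_recr /= fmapD ih.
Qed.

Lemma fmap_inv x y (f : hom x y) : is_iso f -> fmap F (inv f) = inv (fmap F f).
Proof.
by move=> h; symmetry; apply: is_inverse_inv; split; rewrite -fmap_comp ?invL ?invR ?fmap_id.
Qed.

Lemma right_exact_epi x y (f : hom x y) : is_abelian A -> right_exact F ->
  is_epi f -> is_epi (fmap F f).
Proof. by move=> ab r /(epi_cokernel ab) [z [g hg]]; apply: cokernel_epi (r _ _ _ _ _ hg). Qed.

Lemma left_exact_mono x y (f : hom x y) : is_abelian A -> left_exact F ->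
  is_mono f -> is_mono (fmap F f).
Proof. by move=> ab r /(mono_kernel ab) [z [g hg]]; apply: kernel_mono (r _ _ _ _ _ hg). Qed.

Definition reflects_zero := forall x, is_zero_ob (F x) -> is_zero_ob x.

Lemma reflect_epi x y (f : hom x y) : is_abelian A -> right_exact F -> reflects_zero ->
  is_epi (fmap F f) -> is_epi f.
Proof.
move=> ab r z e; apply: epi_of_coker => // c p hp; apply: z.
have h0 : fmap F p = 0 by apply: (epi0 e); rewrite -fmap_comp; case: hp => -> _; rewrite fmap0.
apply: (cokernel_epi (r _ _ _ _ _ hp)); by rewrite h0 !comp0r.
Qed.

Lemma reflect_mono x y (f : hom x y) : is_abelian A -> left_exact F -> reflects_zero ->
  is_mono (fmap F f) -> is_mono f.
Proof.
move=> ab r z e; apply: mono_of_ker => // c p hp; apply: z.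
have h0 : fmap F p = 0 by apply: (mono0 e); rewrite -fmap_comp; case: hp => -> _; rewrite fmap0.
apply: (kernel_mono (r _ _ _ _ _ hp)); by rewrite h0 !comp0l.
Qed.

End FunctorExactness.

Section AdjointExactness.
Variables (k : fieldType) (A B : linCat k) (L : functor A B) (R : functor B A).
Variable adj : adjunction L R.

Lemma adj_tr x y (f : hom x (R y)) :
  fmap R (adj_counit adj y ∘ fmap L f) ∘ adj_unit adj x = f.
Proof. by rewrite fmap_comp -comp_assoc adj_unit_nat comp_assoc adj_triR comp_idl. Qed.

Lemma adj_tr' x y (f : hom (L x) y) :
  adj_counit adj y ∘ fmap L (fmap R f ∘ adj_unit adj x) = f.
Proof. by rewrite fmap_comp comp_assoc -adj_counit_nat -comp_assoc adj_triL comp_idr. Qed.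

Lemma radj_left_exact : left_exact R.
Proof.
move=> z x y i f hi; apply: mk_kernel.
- by rewrite -fmap_comp; case: hi => -> _; rewrite fmap0.
- apply: is_mono0 => w g e; rewrite -(adj_tr g).
  suff -> : adj_counit adj z ∘ fmap L g = 0 by rewrite fmap0 comp0l.
  apply: (mono0 (kernel_mono hi)).
  by rewrite comp_assoc adj_counit_nat -comp_assoc -fmap_comp e fmap0 comp0r.
- move=> w g e; have [|h eh] := kernel_lift hi (g := adj_counit adj x ∘ fmap L g).
    by rewrite comp_assoc adj_counit_nat -comp_assoc -fmap_comp e fmap0 comp0r.
  by exists (fmap R h ∘ adj_unit adj w); rewrite comp_assoc -fmap_comp eh adj_tr.
Qed.

Lemma ladj_right_exact : right_exact L.
Proof.
move=> x y z p f hp; apply: mk_cokernel.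
- by rewrite -fmap_comp; case: hp => -> _; rewrite fmap0.
- apply: is_epi0 => w g e; rewrite -(adj_tr' g).
  suff -> : fmap R g ∘ adj_unit adj z = 0 by rewrite fmap0 comp0r.
  apply: (epi0 (cokernel_epi hp)).
  by rewrite -comp_assoc -adj_unit_nat comp_assoc -fmap_comp e fmap0 comp0l.
- move=> w g e; have [|h eh] := cokernel_desc hp (g := fmap R g ∘ adj_unit adj y).
    by rewrite -comp_assoc -adj_unit_nat comp_assoc -fmap_comp e fmap0 comp0l.
  by exists (adj_counit adj w ∘ fmap L h); rewrite -comp_assoc -fmap_comp eh adj_tr'.
Qed.

Lemma ladj_projective p : is_abelian B -> right_exact R ->
  is_projective p -> is_projective (L p).
Proof.
move=> ab rR pp x y e f he.
have [g eg] := pp _ _ (fmap R e) (fmap R f ∘ adj_unit adj p) (right_exact_epi ab rR he).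
exists (adj_counit adj x ∘ fmap L g).
by rewrite comp_assoc adj_counit_nat -comp_assoc -fmap_comp eg adj_tr'.
Qed.

End AdjointExactness.

Section AdjointExistence.
Variables (k : fieldType) (A B : linCat k) (L : functor A B).

Lemma fmap_precomp_linear x y z (f : hom x y) :
  linear (fun s : hom (L y) z => s ∘ fmap L f).
Proof. exact: comp_linl. Qed.

(** For right exact [L], the functor [x |-> Hom (L x, y)] is contravariant left exact, hence
    representable; [R y] is the representing object. *)
Theorem right_adjoint_ex : is_finite A -> right_exact L ->
  (forall x y : B, fin_dim (hom x y)) -> exists R : functor B A, inhabited (adjunction L R).
Proof.
move=> fA rL fB.
have rep y : exists X (s : hom (L X) y),
    forall x (t : hom (L x) y), exists! f : hom x X, s ∘ fmap L f = t.
  apply: (@representable k A (fun x => hom (L x) y)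
    (fun x x' f => mk_linear (@fmap_precomp_linear x x' y f))) => //.
  - by move=> x s /=; rewrite fmap_id comp_idr.
  - by move=> x x' x'' g f s /=; rewrite fmap_comp comp_assoc.
  - by move=> x x' s a u v /=; rewrite fmap_linear comp_linr.
  - by move=> x x' x'' p f /rL [_ h] s /h.
pose X y := projT1 (cid (rep y)).
pose s y : hom (L (X y)) y := projT1 (cid (projT2 (cid (rep y)))).
have hs y : forall x (t : hom (L x) y), exists! f : hom x (X y), s y ∘ fmap L f = t.
  by rewrite /s; case: (cid (projT2 (cid (rep y)))).
pose tr x y (t : hom (L x) y) : hom x (X y) := projT1 (cid (hs y x t)).
have trE x y (t : hom (L x) y) : s y ∘ fmap L (tr x y t) = t.
  by rewrite /tr; case: cid => f [].
have trU x y (f g : hom x (X y)) : s y ∘ fmap L f = s y ∘ fmap L g -> f = g.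
  move=> e; have [h [_ hU]] := hs y x (s y ∘ fmap L g).
  by rewrite -(hU g) // -(hU f).
pose fm y y' (g : hom y y') : hom (X y) (X y') := tr _ _ (g ∘ s y).
have fm1 y : fm y y (idm y) = idm (X y).
  by apply: trU; rewrite trE fmap_id comp_idl comp_idr.
have fmM x y z (g : hom y z) (f : hom x y) : fm x z (g ∘ f) = fm y z g ∘ fm x y f.
  by apply: trU; rewrite trE fmap_comp comp_assoc trE -!comp_assoc trE.
have fmL x y : linear (fm x y).
  move=> a f g; apply: trU; rewrite trE fmap_linear compDr compZr !trE.
  by rewrite compDl compZl.
pose R := @Functor k B A X fm fm1 fmM fmL.
exists R; split; apply: (@Adjunction k A B L R (fun x => tr x (L x) (idm (L x))) s).
- move=> x x' f; apply: trU => /=.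
  by rewrite !fmap_comp !comp_assoc !trE comp_idl -comp_assoc trE comp_idr.
- by move=> y y' g /=; rewrite trE.
- by move=> x; rewrite trE.
- move=> y /=; apply: trU; rewrite fmap_comp comp_assoc trE -comp_assoc trE.
  by rewrite fmap_id.
Qed.

End AdjointExistence.

Section ModuleExactness.
Variables (k : fieldType) (C : monCat k).
Hypothesis rigC : is_rigid C.

Definition act_adjunction (M : modCat C) (c c' : C)
    (ev : hom (c' ⊗ c) one) (coev : hom one (c ⊗ c'))
    (zig : runit c ∘ (idm c ⊠ ev) ∘ assoc c c' c ∘ (coev ⊠ idm c) ∘ inv (lunit c) = idm c)
    (zag : lunit c' ∘ (ev ⊠ idm c') ∘ inv (assoc c' c c') ∘ (idm c' ⊠ coev)
       ∘ inv (runit c') = idm c') : adjunction (act_by M c') (act_by M c) :=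
  @Adjunction _ _ _ (act_by M c') (act_by M c) (act_coev coev) (act_ev ev)
    (fun x x' f => esym (act_coev_nat coev f)) (fun x x' f => esym (act_ev_nat ev f))
    (act_zag zag) (act_zig zig).

(** The two duals of [c] provide adjoints of [c ▷ -] on both sides. *)
Lemma act_by_exact (M : modCat C) c : is_exact (act_by M c).
Proof.
split.
  by have [[c' [ev [coev [h1 h2]]]] _] := rigC c; apply: radj_left_exact (act_adjunction M h1 h2).
by have [_ [c' [ev [coev [h1 h2]]]]] := rigC c; apply: ladj_right_exact (act_adjunction M h1 h2).
Qed.

Lemma rev_rigid : is_rigid (rev C).
Proof.
have sw (x y : C) : is_dual y x -> @is_dual k (rev C) x y.
  move=> [ev [coev [zig zag]]]; exists ev, coev; split; first exact: zag.
  by rewrite /= inv_inv //; apply: assoc_iso.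
by move=> x; have [[y hy] [z hz]] := rigC x; split; [exists z | exists y]; apply: sw.
Qed.

End ModuleExactness.

Section RegularModule.
Variables (k : fieldType) (C : monCat k).
Hypothesis tC : finite_multitensor C.

Lemma reg_finite : finite_module (reg C).
Proof.
case: tC => fC rC; split=> // [c|m]; first exact: act_by_exact.
have [h1 h2] := act_by_exact (rev_rigid rC) (reg (rev C)) m.
by split=> ? ? ? ? ? h; [apply: h1 h | apply: h2 h].
Qed.

Lemma act_cover (M : modCat C) (Q : C) (e : hom Q one) (x : M) :
  finite_module M -> is_epi e -> is_epi (munit x ∘ (e ▶ idm x)).
Proof.
move=> [fM _ /(_ x) [_ r]] he; have abC : is_abelian C by case: tC => -[].
have h : is_epi (e ▶ idm x) := right_exact_epi abC r he.
by move=> w f g; rewrite !comp_assoc => /h; apply: iso_epi; apply: munit_iso.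
Qed.

(** Tensoring [e] with [x] shows that [Q ▷ x] covers [x]. *)
Lemma act_by_reflects_zero (M : modCat C) (Q : C) (e : hom Q one) :
  finite_module M -> is_epi e -> reflects_zero (act_by M Q).
Proof.
move=> fM he x hz; have h := @act_cover M Q e x fM he; apply: (h); rewrite comp0l comp_idl.
exact: zero_homl.
Qed.

Lemma unit_cover : exists (Q : C) (e : hom Q one), is_projective Q /\ is_epi e.
Proof. by case: tC => -[_ _ _ h _] _; apply: h. Qed.

Variables (M N : modCat C) (H : premodFunctor M N).
Hypotheses (exM : exact_module M) (fN : finite_module N) (hH : is_modFunctor H).

(* The sequence [Q ▷ (x -> y -> z -> 0)] consists of projectives, hence it is split
   and preserved by any additive functor; then [Q ▷ -] reflects exactness. *)
Lemma mod_right_exact : right_exact H.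
Proof.
move=> x y z p f hp; have [Q [e [pQ he]]] := unit_cover; case: exM => fM pM.
have abC : is_abelian C by case: tC => -[].
have [[abM _ _ _ _] eM _] := fM; have [[abN _ _ _ _] eN _] := fN.
have [si sn _ _] := hH.
have hQ := (eM Q).2 _ _ _ _ _ hp.
have [sg esg] := pM Q z pQ _ _ _ (idm (Q ▷ z)) (cokernel_epi hQ).
have [ta eta] : exists ta, (idm Q ▶ f) ∘ ta = idm (Q ▷ y) - sg ∘ (idm Q ▶ p).
  apply: (projective_lift abM (pM Q y pQ) hQ).
  by rewrite compBr comp_idr comp_assoc esg comp_idl subrr.
have sH c m m' (g : hom m m') : fmap H (idm c ▶ g) =
    inv (pm_str H c m') ∘ ((idm c ▶ fmap H g) ∘ pm_str H c m).
  by rewrite -sn invK.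
have pf : p ∘ f = 0 by case: hp.
have [c [q hq]] := coker_ex abN (fmap H f).
have [v ev] : exists v, v ∘ q = fmap H p.
  by apply: (cokernel_desc hq); rewrite -fmap_comp pf fmap0.
have hq' := (eN Q).2 _ _ _ _ _ hq.
have Hp_epi : is_epi (idm Q ▶ fmap H p).
  move=> w g g' eg; apply: (iso_epi (si Q z)).
  have : g ∘ (pm_str H Q z) ∘ fmap H (idm Q ▶ p) = g' ∘ (pm_str H Q z) ∘ fmap H (idm Q ▶ p).
    by rewrite -!comp_assoc sn !comp_assoc eg.
  move/(congr1 (fun u => u ∘ fmap H sg)); rewrite -!comp_assoc -fmap_comp esg fmap_id.
  by rewrite !comp_idr.
have key : (idm Q ▶ q) ∘ pm_str H Q y = (idm Q ▶ q) ∘ pm_str H Q y ∘ fmap H (sg ∘ (idm Q ▶ p)).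
  apply/eqP; rewrite -subr_eq0 -{1}(comp_idr (_ ∘ pm_str H Q y)) -fmap_id -compBr -fmapB -eta.
  rewrite fmap_comp comp_assoc -(comp_assoc _ (pm_str H Q y)) sn comp_assoc.
  by rewrite -act_compr; case: hq => -> _; rewrite act0r !comp0l.
pose r := (idm Q ▶ q) ∘ pm_str H Q y ∘ fmap H sg ∘ inv (pm_str H Q z).
have rp : r ∘ (idm Q ▶ fmap H p) = idm Q ▶ q.
  apply: (iso_epi (si Q y)); rewrite /r -!comp_assoc -sn invK //.
  by rewrite -fmap_comp !comp_assoc -key.
have vQ : is_iso (idm Q ▶ v).
  have vQe : (idm Q ▶ v) ∘ (idm Q ▶ q) = idm Q ▶ fmap H p by rewrite -act_compr ev.
  exists r; split.
    by apply: (cokernel_epi hq'); rewrite -comp_assoc vQe rp comp_idl.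
  by apply: Hp_epi; rewrite -comp_assoc rp vQe comp_idl.
have z0 := act_by_reflects_zero fN he.
have vi : is_iso v.
  have [g [g1 g2]] := vQ.
  apply: mono_epi_iso => //.
    apply: (reflect_mono abN (eN Q).1 z0) => w a b /(congr1 (comp g)).
    by rewrite !comp_assoc g1 !comp_idl.
  apply: (reflect_epi abN (eN Q).2 z0) => w a b /(congr1 (fun u => u ∘ g)).
  by rewrite -!comp_assoc g2 !comp_idr.
apply: mk_cokernel.
- by rewrite -fmap_comp pf fmap0.
- move=> w a b; rewrite -ev !comp_assoc => /(cokernel_epi hq); exact: iso_epi.
- move=> w g eg; have [h eh] := cokernel_desc hq eg.
  by exists (h ∘ inv v); rewrite -ev -comp_assoc invK.
Qed.

(** The cokernel of [Q ▷ f] is projective, so [Q ▷ f] has a retraction, which [H] preserves; then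
    [Q ▷ -] reflects monomorphisms. *)
Lemma mod_mono x y (f : hom x y) : is_mono f -> is_mono (fmap H f).
Proof.
move=> mf; have [Q [e [pQ he]]] := unit_cover; case: exM => fM pM.
have abC : is_abelian C by case: tC => -[].
have [[abM _ _ _ _] eM _] := fM; have [[abN _ _ _ _] eN _] := fN.
have [si sn _ _] := hH.
have [z [p hp]] := coker_ex abM f.
have hQ := (eM Q).2 _ _ _ _ _ hp.
have [sg esg] := pM Q z pQ _ _ _ (idm (Q ▷ z)) (cokernel_epi hQ).
have [ta eta] : exists ta, (idm Q ▶ f) ∘ ta = idm (Q ▷ y) - sg ∘ (idm Q ▶ p).
  apply: (projective_lift abM (pM Q y pQ) hQ).
  by rewrite compBr comp_idr comp_assoc esg comp_idl subrr.
have fQ : is_mono (idm Q ▶ f) := left_exact_mono abM (eM Q).1 mf.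
have tf : ta ∘ (idm Q ▶ f) = idm (Q ▷ x).
  apply: fQ; rewrite comp_assoc eta compBl comp_idl comp_idr -comp_assoc -act_compr.
  by case: hp => -> _; rewrite act0r comp0r subr0.
apply: (reflect_mono abN (eN Q).1 (act_by_reflects_zero fN he)) => w a b /= eab.
apply: (iso_mono (is_iso_inv (si Q x))).
have : fmap H (idm Q ▶ f) ∘ (inv (pm_str H Q x) ∘ a) = fmap H (idm Q ▶ f) ∘ (inv (pm_str H Q x) ∘ b).
  apply: (iso_mono (si Q y)); rewrite !(comp_assoc (pm_str H Q y)) sn -!comp_assoc !invKV //.
move/(congr1 (comp (fmap H ta))); rewrite !comp_assoc -!fmap_comp tf fmap_id !comp_idl.
by [].
Qed.

End RegularModule.

(** * Free module functors and internal homs *)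

Section FreeFunctor.
Variables (k : fieldType) (C : monCat k) (M : modCat C).

Lemma runit_tens (x y : C) : (idm x ⊠ runit y) ∘ assoc x y one = runit (x ⊗ y).
Proof.
have i := assoc_iso x y one; have e := @lunit_tens k (rev C) y x.
rewrite /= in e; apply: (iso_epi (is_iso_inv i)).
by rewrite -comp_assoc invR // comp_idr e.
Qed.

(* Module functors out of the regular module category are all of this form. *)
Definition free (x : M) : premodFunctor (reg C) M :=
  @PremodFunctor _ C (reg C) M (act_on x) (fun c d => massoc c d x).

Lemma free_mf x : is_modFunctor (free x).
Proof.
split=> /= [c m|c c' m m' f g|c d m|m].
- exact: massoc_iso.
- exact: massoc_nat.
- exact: mod_pentagon.
- exact: munit_act.
Qed.

Lemma free_mn x x' (g : hom x x') :
  @is_modNat _ _ _ _ (free x) (free x') (fun c => idm c ▶ g).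
Proof. by split=> [c d f|c d] /=; [rewrite act_swap | rewrite massoc_natr]. Qed.

Lemma free_uniq x (K : premodFunctor (reg C) M) a b : is_modFunctor K ->
  @is_modNat _ _ _ _ (free x) K a -> @is_modNat _ _ _ _ (free x) K b ->
  a one = b one -> forall c, a c = b c.
Proof.
case=> si _ _ _ [an am] [bn bm] e c.
have h : a (c ⊗ one) = b (c ⊗ one).
  by apply: (iso_mono (si c one)); rewrite am bm e.
apply: (iso_epi (iso_actl x (runit_iso c))).
by have /= <- := an _ _ (runit c); have /= <- := bn _ _ (runit c); rewrite h.
Qed.

Lemma free_iso (K : premodFunctor (reg C) M) : is_modFunctor K ->
  let a c := fmap K (runit c) ∘ inv (pm_str K c one) in
  @is_modIso _ _ _ _ (free (K one)) K a.
Proof.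
case=> si sn sa _ a; rewrite /a; split; last first.
  by move=> c; apply: is_iso_comp; [apply/is_iso_fmap/runit_iso | apply/is_iso_inv/si].
split=> [c d f|c d] /=.
  rewrite comp_assoc -fmap_comp -runit_nat fmap_comp -!comp_assoc; congr (_ ∘ _).
  apply: (iso_mono (si d one)); rewrite invKV; last exact: si.
  rewrite comp_assoc.
  have := sn _ _ _ _ f (idm one); rewrite fmap_id /= => ->.
  by rewrite -comp_assoc invR ?comp_idr //; apply: si.
rewrite -runit_tens fmap_comp act_compr !comp_assoc sn -!comp_assoc; congr (_ ∘ _).
apply: (iso_epi (si (c ⊗ d) one)); rewrite -!comp_assoc invL ?comp_idr; last exact: si.
apply: (iso_mono (iso_actr c (si d one))).
by rewrite sa !comp_assoc -act_compr invR ?actm_id ?comp_idl //; apply: si.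
Qed.

End FreeFunctor.

Lemma str_mn k (C : monCat k) (M N : modCat C) (K : premodFunctor M N) n : is_modFunctor K ->
  @is_modNat _ _ _ _ (comp_pm K (free n)) (free (K n)) (fun c => pm_str K c n).
Proof.
case=> _ sn sa _; split=> [c d f|c d] /=.
  by have := sn _ _ _ _ f (idm n); rewrite fmap_id.
by rewrite sa !comp_assoc.
Qed.

Section ModAdjunctionOps.
Variables (k : fieldType) (C : monCat k).

Definition madj_adj (N M : modCat C) (A : premodFunctor N M) (U : premodFunctor M N)
    (ad : madj A U) : adjunction A U :=
  @Adjunction _ _ _ A U (un ad) (co ad) (un_mn ad).1 (co_mn ad).1 (triL ad) (triR ad).

Program Definition madj_comp (L N M : modCat C) (A : premodFunctor L N)
    (U : premodFunctor N L) (B : premodFunctor N M) (V : premodFunctor M N)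
    (hU : is_modFunctor U) (hB : is_modFunctor B) (a : madj A U) (b : madj B V) :
    madj (comp_pm B A) (comp_pm U V) :=
  @Madj _ _ _ _ (comp_pm B A) (comp_pm U V)
    (fun x => fmap U (un b (A x)) ∘ un a x) (fun y => co b y ∘ fmap B (co a (V y))) _ _ _ _.
Next Obligation.
have h1 := un_mn a; have h2 := mn_whl (mf_str_nat hU) (mn_whr A (un_mn b)).
split=> [x y f|c m] /=.
  by rewrite comp_assoc (h2.1 x y f) -!comp_assoc; have /= -> := h1.1 x y f.
have /= e1 := h1.2 c m; have /= e2 := h2.2 c m.
rewrite comp_idl in e2; rewrite comp_idr in e1.
by rewrite act_compr comp_idr -comp_assoc -e1 (comp_assoc (idm c ▶ _)) -e2 !fmap_comp !comp_assoc.
Qed.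
Next Obligation.
have h1 := co_mn b; have h2 := mn_whl (mf_str_nat hB) (mn_whr V (co_mn a)).
split=> [x y f|c m] /=.
  by rewrite comp_assoc (h1.1 x y f) -!comp_assoc; have /= -> := h2.1 x y f.
have /= e1 := h1.2 c m; have /= e2 := h2.2 c m.
rewrite comp_idl in e1; rewrite comp_idl in e2.
by rewrite comp_idl comp_assoc e1 -!comp_assoc (comp_assoc (pm_str B c _)) e2 act_compr
  !fmap_comp !comp_assoc.
Qed.
Next Obligation.
have /= n := (co_mn b).1; have /= t := triL b; have t' := triL a.
have /= e := (co_mn a).1 _ _ (un b (A x)).
by rewrite (fmap_comp A) -comp_assoc -(fmap_comp B) comp_assoc -e -comp_assoc t' comp_idr t.
Qed.
Next Obligation.
have /= t := triR b; have t' := triR a.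
have /= e := (un_mn b).1 _ _ (co a (V y)).
by rewrite comp_assoc -(fmap_comp U) (fmap_comp V) -comp_assoc e comp_assoc t comp_idl t'.
Qed.

Program Definition madj_iso (N M : modCat C) (A : premodFunctor N M)
    (U U' : premodFunctor M N) (hA : is_modFunctor A) (ad : madj A U)
    (r : forall y, hom (U y) (U' y)) (hr : is_modIso r) : madj A U' :=
  @Madj _ _ _ _ A U' (fun x => r (A x) ∘ un ad x) (fun y => co ad y ∘ fmap A (inv (r y)))
    _ _ _ _.
Next Obligation.
case: hr => hr _; apply: (mn_comp (un_mn ad)); exact: mn_whr hr.
Qed.
Next Obligation.
case: hr => hr ir; refine (mn_comp _ (co_mn ad)).
exact: mn_whl (mf_str_nat hA) (mn_inv hr ir).
Qed.
Next Obligation.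
case: hr => hr ir.
by rewrite fmap_comp comp_assoc -(comp_assoc (co ad _)) -fmap_comp invL // fmap_id comp_idr triL.
Qed.
Next Obligation.
case: hr => [[hn _] ir].
have /= e := (un_mn ad).1 _ _ (inv (r y)).
rewrite comp_assoc hn fmap_comp -!comp_assoc e (comp_assoc (fmap U _)) triR comp_idl.
by rewrite invR.
Qed.

End ModAdjunctionOps.

Section Existence.
Variables (k : fieldType) (C : monCat k) (tC : finite_multitensor C) (M : modCat C).

Lemma inner_hom_ex (n : M) : finite_module M ->
  exists U : premodFunctor M (reg C), is_modFunctor U /\ inhabited (madj (free n) U).
Proof.
case: tC => fC rC [fM _ eM].
have [R [ad]] := @right_adjoint_ex _ (reg C) M (free n) fC (eM n).2 (let: And5 _ h _ _ _ := fM in h).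
exists (ra_pm (A:=free n) ad); split; first by apply: ra_pm_mf => //; apply: free_mf.
by split; apply: ra_madj => //; apply: free_mf.
Qed.

(** [U] is right exact because [M] is an exact module category, and its right adjoint, a module
    functor out of the regular one, is free on its value at the unit. For [U] the internal hom out
    of [n], the object [s] is the value at [n] of a relative Serre functor. *)
Lemma serre_ex (U : premodFunctor M (reg C)) : exact_module M -> is_modFunctor U ->
  exists s, inhabited (madj U (free s)).
Proof.
move=> eM hU; have rU := mod_right_exact tC eM (reg_finite tC) hU.
case: eM => -[fM _ _] _; case: tC => fC rC.
have [R [ad]] := @right_adjoint_ex _ M (reg C) U fM rU (let: And5 _ h _ _ _ := fC in h).
have hR : is_modFunctor (ra_pm ad) by apply: ra_pm_mf.
 exists (R one); split.
apply: (madj_iso hU (ra_madj hU ad rC)); split; last first.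
  by move=> c; apply/is_iso_inv/(free_iso hR).2.
exact: mn_inv (free_iso hR).1 (free_iso hR).2.
Qed.

End Existence.

(** * Module functors of rank one *)

Section RankOne.
Variables (k : fieldType) (C : monCat k) (M : modCat C).
Variable U : premodFunctor M (reg C).
Hypothesis hU : is_modFunctor U.

Definition rk1 (x : M) : premodFunctor M M := comp_pm (free x) U.

Lemma rk1_mf x : is_modFunctor (rk1 x).
Proof. exact: pm_comp_mf (free_mf x) hU. Qed.

Lemma rk1_mn x x' (g : hom x x') :
  @is_modNat _ _ _ _ (rk1 x) (rk1 x') (fun y => idm (U y) ▶ g).
Proof. exact: mn_whr (free_mn g). Qed.

Section Left.
Variables (n : M) (ad : madj (free n) U).

(** The identity of [n], as a point of its internal endomorphism object. *)
Definition coev1 : hom one (U n) := fmap U (munit n) ∘ un ad one.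
Definition rk1_in (x : M) : hom x (U n ▷ x) := (coev1 ▶ idm x) ∘ inv (munit x).

Lemma rk1_in_nat x x' (g : hom x x') :
  (idm (U n) ▶ g) ∘ rk1_in x = rk1_in x' ∘ g.
Proof. by rewrite /rk1_in comp_assoc act_swap -!comp_assoc inv_munit_nat. Qed.

Lemma co_coev1 : co ad n ∘ (coev1 ▶ idm n) = munit n.
Proof.
rewrite /coev1 act_compl comp_assoc.
have /= <- := (co_mn ad).1 _ _ (munit n).
by rewrite -comp_assoc; have /= -> := triL ad one; rewrite comp_idr.
Qed.

(* [rk1 x] is freely generated by [x] at [n]: morphisms [rk1 x -> K] correspond to
   morphisms [x -> K n]. *)
Definition extend (K : premodFunctor M M) x (g : hom x (K n)) y : hom (rk1 x y) (K y) :=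
  fmap K (co ad y) ∘ (inv (pm_str K (U y) n) ∘ (idm (U y) ▶ g)).

Lemma extend_mn (K : premodFunctor M M) x (g : hom x (K n)) :
  is_modFunctor K -> @is_modNat _ _ _ _ (rk1 x) K (extend g).
Proof.
move=> hK; have [si _ _ _] := hK.
have h1 := rk1_mn g.
have h2 := mn_whr U (mn_inv (str_mn n hK) (fun c => si c n)).
have h3 := mn_whl (mf_str_nat hK) (co_mn ad).
have [h4n h4s] := mn_comp h1 h2.
split=> [y z f|c y]; rewrite /extend.
  have /= e := h4n y z f; rewrite -[RHS]comp_assoc -e !comp_assoc; congr (_ ∘ _ ∘ _).
  exact: h3.1 y z f.
have /= e3 := h3.2 c y; have /= e4 := h4s c y.
rewrite fmap_id comp_idr in e3; rewrite comp_assoc e3 -!comp_assoc act_compr.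
by rewrite -!comp_assoc -e4 !fmap_comp -!comp_assoc.
Qed.

Lemma extend_in (K : premodFunctor M M) x (g : hom x (K n)) :
  is_modFunctor K -> extend g n ∘ rk1_in x = g.
Proof.
case=> si sn _ su; rewrite /extend -!comp_assoc rk1_in_nat /rk1_in -comp_assoc.
have e := sn _ _ _ _ coev1 (idm n); rewrite fmap_id in e.
have {}e : inv (pm_str K (U n) n) ∘ (coev1 ▶ idm (K n)) =
    fmap K (coev1 ▶ idm n) ∘ inv (pm_str K one n).
  by apply: (iso_mono (si (U n) n)); rewrite invKV // comp_assoc e -comp_assoc invR // comp_idr.
rewrite (comp_assoc (inv _)) e (comp_assoc (fmap K _)) (comp_assoc (fmap K _)).
rewrite -fmap_comp co_coev1 -su -!comp_assoc invKV // invKV //; exact: munit_iso.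
Qed.

Lemma extend_uniq (K : premodFunctor M M) x f f' : is_modFunctor K ->
  @is_modNat _ _ _ _ (rk1 x) K f -> @is_modNat _ _ _ _ (rk1 x) K f' ->
  f n ∘ rk1_in x = f' n ∘ rk1_in x -> forall y, f y = f' y.
Proof.
move=> hK hf hf' e y.
(* Transposing along [- ▷ n ⊣ U] gives a module transformation from [free x] to [K (- ▷ n)]. It is
   determined at the unit, where it reads [f n ∘ rk1_in x]. *)
pose m (f : forall y, hom (rk1 x y) (K y)) c := f (c ▷ n) ∘ (un ad c ▶ idm x).
have mm g : @is_modNat _ _ _ _ (rk1 x) K g ->
    @is_modNat _ _ _ _ (free x) (comp_pm K (free n)) (m g).
  move=> hg; have h1 := mn_whr (free n) hg.
  have h2 := mn_whl (mf_str_nat (free_mf x)) (un_mn ad).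
  split=> [c d h|c d]; rewrite /m.
    rewrite -comp_assoc; have /= <- := h2.1 c d h; rewrite !comp_assoc; congr (_ ∘ _).
    exact: h1.1 c d h.
  have /= e1 := h1.2 c d; have /= e2 := h2.2 c d; move: e2.
  rewrite actm_id comp_idr => e2; rewrite comp_assoc /= e1 act_compr -!comp_assoc -e2.
  by rewrite act_compl !comp_assoc.
have rec g : @is_modNat _ _ _ _ (rk1 x) K g -> g y = fmap K (co ad y) ∘ m g (U y).
  move=> [hg _]; rewrite /m comp_assoc hg /= -comp_assoc -act_compl.
  by have /= -> := triR ad y; rewrite actm_id comp_idr.
rewrite (rec _ hf) (rec _ hf'); congr (_ ∘ _).
apply: (free_uniq (pm_comp_mf hK (free_mf n)) (mm _ hf) (mm _ hf')).
apply: (iso_mono (is_iso_fmap K (munit_iso n))).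
have at1 g : @is_modNat _ _ _ _ (rk1 x) K g ->
    fmap K (munit n) ∘ m g one = (g n ∘ rk1_in x) ∘ munit x.
  move=> [hg _]; rewrite /m comp_assoc hg /= -comp_assoc -act_compl.
  by rewrite /rk1_in -!comp_assoc invL ?comp_idr //; apply: munit_iso.
by rewrite !at1 // e.
Qed.

End Left.

Section Right.
Variables (s : M) (ad : madj U (free s)).

Definition ev1 : hom (U s) one := co ad one ∘ fmap U (inv (munit s)).
Definition rk1_out (x : M) : hom (U s ▷ x) x := munit x ∘ (ev1 ▶ idm x).

Lemma rk1_out_nat x x' (g : hom x x') : g ∘ rk1_out x = rk1_out x' ∘ (idm (U s) ▶ g).
Proof. by rewrite /rk1_out -comp_assoc -act_swap !comp_assoc munit_nat. Qed.

Lemma ev1_co1 : ev1 ∘ fmap U (munit s) = co ad one.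
Proof.
by rewrite /ev1 -comp_assoc -fmap_comp invL ?fmap_id ?comp_idr //; apply: munit_iso.
Qed.

Lemma rk1_out_un : rk1_out s ∘ un ad s = idm s.
Proof.
apply: (iso_epi (munit_iso s)); rewrite comp_idl.
have /= e := (un_mn ad).1 _ _ (munit s); rewrite -!comp_assoc -e.
rewrite (comp_assoc (ev1 ▶ _)) -act_compl ev1_co1.
by have /= -> := triR ad one; rewrite comp_idr.
Qed.

(** Counterpart of [extend_uniq] for maps into [rk1 x]: transposing along [U ⊣ - ▷ s] gives a
    transformation from [free s] to [free x], that is, a morphism from [s] to [x]. *)
Lemma out_uniq x f : @is_modNat _ _ _ _ (id_pm M) (rk1 x) f ->
  forall y, f y = (idm (U y) ▶ (rk1_out x ∘ f s)) ∘ un ad y.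
Proof.
move=> hf y; have [fn fs] := hf.
pose g c := (co ad c ▶ idm x) ∘ f (c ▷ s).
have gm : @is_modNat _ _ _ _ (free s) (free x) g.
  have h1 := mn_whr (free s) hf.
  have h2 := mn_whl (mf_str_nat (free_mf x)) (co_mn ad).
  split=> [c d h|c d]; rewrite /g.
    rewrite -comp_assoc; have /= <- := h1.1 c d h; rewrite !comp_assoc; congr (_ ∘ _).
    exact: h2.1 c d h.
  have /= e1 := h1.2 c d; have /= e2 := h2.2 c d; move: e1 e2.
  rewrite actm_id comp_idr comp_idl => e1 e2; rewrite comp_assoc /= e2 act_compr -!comp_assoc -e1.
  by rewrite act_compl !comp_assoc.
have -> : f y = g (U y) ∘ un ad y.
  rewrite /g -comp_assoc; have /= <- := fn _ _ (un ad y).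
  by rewrite comp_assoc -act_compl; have /= -> := triL ad y; rewrite actm_id comp_idl.
congr (_ ∘ _); apply: (free_uniq (free_mf x) gm (free_mn _)).
apply: (iso_mono (munit_iso x)); rewrite munit_nat /g.
rewrite -ev1_co1 act_compl comp_assoc /rk1_out -!comp_assoc; congr (_ ∘ (_ ∘ _)).
by have /= := fn _ _ (munit s).
Qed.

Lemma runit_ev1 c : runit c ∘ ((idm c ⊠ ev1) ∘ pm_str U c s) = co ad c.
Proof.
have [si sn _ _] := hU.
have /= e := (co_mn ad).2 c one; rewrite comp_idl in e.
have /= e' := (co_mn ad).1 _ _ (runit c).
have t := mod_triangle c s.
apply: (iso_epi (is_iso_fmap U (iso_actl s (runit_iso c)))).
rewrite -e' e -t fmap_comp.
have := sn _ _ _ _ (idm c) (munit s) => /= h.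
rewrite -!comp_assoc (comp_assoc (pm_str U c s)) h !comp_assoc.
rewrite -(comp_assoc _ (idm c ⊠ ev1)).
have -> : (idm c ⊠ ev1) ∘ (idm c ⊠ fmap U (munit s)) = idm c ⊠ co ad one.
  by rewrite -tensm_comp comp_idl ev1_co1.
by [].
Qed.

(** A triangle identity of [U ⊣ - ▷ s] acting on [x], as [ev1] recovers the counit. It is what
    collapses [spread] in [c_split]. *)
Lemma rk1_out_str x y :
  (idm (U y) ▶ rk1_out x) ∘ (pm_str (rk1 x) (U y) s ∘ fmap (rk1 x) (un ad y)) = idm (U y ▷ x).
Proof.
rewrite /rk1_out act_compr /=.
have e := massoc_nat (idm (U y)) ev1 (idm x).
rewrite -!comp_assoc (comp_assoc _ (massoc _ _ _)) -e -comp_assoc.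
rewrite (comp_assoc (idm _ ▶ munit x)) mod_triangle -!act_compl.
rewrite (comp_assoc (idm _ ⊠ ev1)) comp_assoc.
have /= -> := runit_ev1 (U y); have /= -> := triL ad y; exact: actm_id.
Qed.

End Right.
End RankOne.

(** * Ends as universal families *)

(* When the spaces [Hom (y, 1)] are finite-dimensional, wedges [x -> Hom (y, 1) ⊗ y]
   amount to families of maps [Hom (y, 1)^* -> Hom (x, y)], linear and natural in [y]. *)
Section Families.
Variables (k : fieldType) (A : monCat k).
Hypothesis fd : forall y : A, fin_dim (hom y (@one k A)).
Notation dualof y := {linear hom y (@one k A) -> k^o}.

(** Linearity and naturality compare functionals through their values, so that they apply without
    any equality between bundled linear maps. *)
Definition is_family (x : A) (p : forall y : A, dualof y -> hom x y) :=
  (forall y n (c : 'I_n -> k) (t : 'I_n -> dualof y) (s : dualof y),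
     (forall v, s v = \sum_i c i * t i v) -> p y s = \sum_i c i *: p y (t i)) /\
  (forall y y' (f : hom y y') (t : dualof y) (t' : dualof y'),
     (forall v, t' v = t (v ∘ f)) -> f ∘ p y t = p y' t').

Definition universal_family (x : A) (p : forall y : A, dualof y -> hom x y) :=
  is_family p /\
  forall z q, is_family (x := z) q -> exists! h : hom z x, forall y t, q y t = p y t ∘ h.

Lemma family0 x p y (t : dualof y) : is_family (x := x) p -> (forall v, t v = 0) -> p y t = 0.
Proof.
move=> [l _] e; rewrite (l y 0%N (fun _ => 0) (fun _ => t) t) ?big_ord0 // => v.
by rewrite big_ord0 e.
Qed.

Lemma universal_iso x p x' (u : hom x' x) : universal_family p -> is_iso u ->
  universal_family (fun y t => p y t ∘ u).
Proof.
move=> [[pl pn] pu] iu; split; first split.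
- by move=> y n c t s /pl ->; rewrite comp_suml; apply: eq_bigr => i _; rewrite compZl.
- by move=> y y' f t t' /pn <-; rewrite comp_assoc.
- move=> z q /pu [h [eh uh]]; exists (inv u ∘ h); split.
    by move=> y t; rewrite -comp_assoc invKV.
  move=> h' eh'; apply: (iso_mono iu); rewrite invKV //; apply: uh => y t.
  by rewrite comp_assoc eh'.
Qed.

Section Contraction.
Variables (T : forall y z : A, copower (hom y (@one k A)) z).

Lemma contract_linear (y z : A) (t : dualof y) : linear (fun v => (t v : k) *: idm z).
Proof. by move=> a u v; rewrite linearP scalerDl scalerA. Qed.

Definition contract (y z : A) (t : dualof y) : hom (T y z) z :=
  cp_desc (T y z) (mk_linear (@contract_linear y z t)).

Lemma contractE (y z : A) (t : dualof y) v : contract z t ∘ cp_in (T y z) v = t v *: idm z.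
Proof. exact: cp_descE. Qed.

Lemma contract_map (y z z' : A) (f : hom z z') (t : dualof y) :
  contract z' t ∘ cp_map (T y z) (T y z') idfun f = f ∘ contract z t.
Proof.
apply: (cp_uniq (c := T y z)) => v.
rewrite -!comp_assoc cp_descE contractE /= /cp_map_fun comp_assoc contractE.
by rewrite compZl compZr comp_idl comp_idr.
Qed.

Lemma contract_precomp (y y' z : A) (f : hom y y') (t : dualof y) (t' : dualof y') :
  (forall v, t' v = t (v ∘ f)) ->
  contract z t ∘ cp_map (T y' z) (T y z) (precomp f) (idm z) = contract z t'.
Proof.
move=> e; apply: (cp_uniq (c := T y' z)) => v.
rewrite -!comp_assoc cp_descE contractE /= /cp_map_fun comp_assoc contractE.
by rewrite comp_idr /= /precomp e.
Qed.

Definition dbasis (y : A) := dual_basis (fd y).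
Definition db_n (y : A) := projT1 (cid (dbasis y)).
Definition db_b (y : A) := projT1 (cid (projT2 (cid (dbasis y)))).
Definition db_t (y : A) : 'I_(db_n y) -> dualof y :=
  projT1 (cid (projT2 (cid (projT2 (cid (dbasis y)))))).
Lemma db_eq (y : A) v : v = \sum_i db_t i v *: @db_b y i.
Proof. by rewrite {1}/db_t; case: (cid (projT2 (cid (projT2 (cid (dbasis y)))))) => /= t [<-]. Qed.

(** Pairs [p] with the canonical tensor of a basis of [Hom (y, 1)] and its dual basis; this inverts
    contraction with all functionals. *)
Definition assemble x (p : forall y : A, dualof y -> hom x y) y : hom x (T y y) :=
  \sum_i (cp_in (T y y) (@db_b y i) ∘ p y (db_t i)).

Lemma contract_assemble x p y t : is_family (x := x) p ->
  contract y t ∘ assemble p y = p y t.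
Proof.
move=> [pl _]; rewrite comp_sumr (pl y _ (fun i => t (@db_b y i)) (@db_t y) t).
  by apply: eq_bigr => i _; rewrite comp_assoc contractE compZl comp_idl.
move=> v; rewrite {1}(db_eq v) linear_sum; apply: eq_bigr => i _.
by rewrite linearZ /= mulrC.
Qed.

Lemma contract_inj (x y z : A) (f g : hom x (T y z)) :
  (forall t, contract z t ∘ f = contract z t ∘ g) -> f = g.
Proof.
move=> h; have e : \sum_i (cp_in (T y z) (@db_b y i) ∘ contract z (db_t i)) = idm (T y z).
  apply: (cp_uniq (c := T y z)) => v; rewrite comp_suml comp_idl.
  rewrite {2}(db_eq v) linear_sum; apply: eq_bigr => i _.
  by rewrite -comp_assoc contractE linearZ compZr comp_idr.
rewrite -(comp_idl f) -(comp_idl g) -e !comp_suml; apply: eq_bigr => i _.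
by rewrite -!comp_assoc h.
Qed.

Lemma wedge_family x (p : forall y, hom x (T y y)) : is_wedge (T := T) p ->
  is_family (fun y t => contract y t ∘ p y).
Proof.
move=> wp; split.
  move=> y n c t s e; rewrite (eq_bigr (fun i => (c i *: contract y (t i)) ∘ p y)) => [|i _].
    rewrite -comp_suml; congr (_ ∘ _); apply: (cp_uniq (c := T y y)) => v.
    rewrite contractE comp_suml e scaler_suml; apply: eq_bigr => i _.
    by rewrite compZl contractE scalerA.
  by rewrite compZl.
move=> y y' f t t' e.
by rewrite comp_assoc -contract_map -comp_assoc wp comp_assoc (contract_precomp _ e).
Qed.

Lemma family_wedge x p : is_family (x := x) p -> is_wedge (T := T) (assemble p).
Proof.
move=> hp y y' f; apply: contract_inj => t.
rewrite !comp_assoc contract_map -comp_assoc contract_assemble //.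
have l : linear (fun v => t (v ∘ f) : k^o) by move=> a u v; rewrite compDl compZl linearP.
rewrite (@contract_precomp _ _ _ _ _ (mk_linear l)) // contract_assemble //.
by case: hp => _; apply.
Qed.

End Contraction.

Lemma distinguished_universal (E : distinguished A) :
  exists p, universal_family (x := do_ob E) p.
Proof.
exists (fun y t => contract (do_cp E) y t ∘ do_proj E y); split.
  apply: wedge_family; exact: do_wedge.
move=> z q hq; have [h [eh uh]] := do_univ (family_wedge (do_cp E) hq).
exists h; split=> [y t|h' eh'].
  by rewrite -comp_assoc eh contract_assemble.
apply: uh => y; apply: contract_inj => t.
by rewrite comp_assoc -eh' contract_assemble.
Qed.

Lemma universal_distinguished (T : forall y z : A, copower (hom y (@one k A)) z) x p :
  universal_family (x := x) p -> exists E : distinguished A, do_ob E = x.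
Proof.
move=> [pf pu].
have univ z (q : forall y, hom z (T y y)) : is_wedge (T := T) q ->
    exists! h : hom z x, forall y, assemble T p y ∘ h = q y.
  move=> wq; have [h [eh uh]] := pu _ _ (wedge_family wq).
  exists h; split=> [y|h' eh'].
    by apply: contract_inj => t; rewrite comp_assoc contract_assemble // eh.
  by apply: uh => y t; rewrite -eh' comp_assoc contract_assemble.
by exists (Distinguished (family_wedge T pf) univ).
Qed.

End Families.

(** * Nakayama objects *)

Section LinearDual.
Variables (k : fieldType) (V : lmodType k).

(** Functionals as a module in their own right: [representable] asks for functors with values in
    [lmodType]. *)
Record ldual := Ldual { ld_fun :> V -> k^o; ld_lin : linear ld_fun }.

Lemma ldual_ext (a b : ldual) : (forall v, a v = b v) -> a = b.
Proof.
case: a => a ha; case: b => b hb /= e.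
have {}e : a = b by apply: functional_extensionality_dep.
by subst b; congr Ldual; apply: Prop_irrelevance.
Qed.

HB.instance Definition _ := gen_eqMixin ldual.
HB.instance Definition _ := gen_choiceMixin ldual.

Program Definition ldual_zero : ldual := @Ldual (fun v => 0) _.
Next Obligation. by move=> a u v; rewrite scaler0 addr0. Qed.
Program Definition ldual_add (a b : ldual) : ldual := @Ldual (fun v => a v + b v) _.
Next Obligation.
by move=> c u v; rewrite (ld_lin a) (ld_lin b) scalerDr addrACA.
Qed.
Program Definition ldual_scale (s : k) (a : ldual) : ldual := @Ldual (fun v => s *: a v) _.
Next Obligation. by move=> c u v; rewrite (ld_lin a) scalerDr !scalerA mulrC. Qed.

Fact ldual_addA : associative ldual_add.
Proof. by move=> a b c; apply: ldual_ext => m /=; rewrite addrA. Qed.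
Fact ldual_addC : commutative ldual_add.
Proof. by move=> a b; apply: ldual_ext => m /=; rewrite addrC. Qed.
Fact ldual_add0 : left_id ldual_zero ldual_add.
Proof. by move=> a; apply: ldual_ext => m /=; rewrite add0r. Qed.
Fact ldual_addN : left_inverse ldual_zero (ldual_scale (-1)) ldual_add.
Proof. by move=> a; apply: ldual_ext => m /=; rewrite scaleN1r addNr. Qed.

HB.instance Definition _ := GRing.isZmodule.Build ldual
  ldual_addA ldual_addC ldual_add0 ldual_addN.

Fact ldual_scaleA (s t : k) a : ldual_scale s (ldual_scale t a) = ldual_scale (s * t) a.
Proof. by apply: ldual_ext => m /=; rewrite scalerA. Qed.
Fact ldual_scale1 : left_id 1 ldual_scale.
Proof. by move=> a; apply: ldual_ext => m /=; rewrite scale1r. Qed.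
Fact ldual_scaleDr : right_distributive ldual_scale +%R.
Proof. by move=> s a b; apply: ldual_ext => m /=; rewrite scalerDr. Qed.
Fact ldual_scaleDl a : {morph ldual_scale^~ a : s t / s + t}.
Proof. by move=> s t; apply: ldual_ext => m /=; rewrite scalerDl. Qed.

HB.instance Definition _ := GRing.Zmodule_isLmodule.Build k ldual
  ldual_scaleA ldual_scale1 ldual_scaleDr ldual_scaleDl.

Lemma ldual_sumE n (f : 'I_n -> ldual) v : (\sum_i f i) v = \sum_i f i v.
Proof.
elim: n f => [|n ih] f; first by rewrite !big_ord0.
by rewrite !big_ord_recr /= -ih.
Qed.

Lemma ldual_fin_dim : fin_dim V -> fin_dim (ldual : lmodType k).
Proof.
move=> /dual_basis [n [b [t [e _]]]].
have l i : linear (t i : V -> k^o) by move=> a u v; rewrite linearP.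
exists n, (fun i => Ldual (l i)) => f; exists (fun i => f (b i)); apply: ldual_ext => v.
rewrite ldual_sumE {1}(e v).
have -> : f (\sum_i t i v *: b i) = mk_linear (ld_lin f) (\sum_i t i v *: b i) by [].
rewrite linear_sum; apply: eq_bigr => i _; rewrite linearZ /=.
exact: mulrC.
Qed.

End LinearDual.

Section Nakayama.
Variables (k : fieldType) (A : linCat k) (finA : is_finite A) (p : A).
Hypothesis pp : is_projective p.

Lemma ldual_pull_lin x y (f : hom x y) (t : ldual (hom p y)) :
  linear (fun g : hom p x => t (f ∘ g) : k^o).
Proof. by move=> a u v; rewrite compDr compZr (ld_lin t). Qed.
Definition ldual_pull x y (f : hom x y) (t : ldual (hom p y)) : ldual (hom p x) :=
  Ldual (ldual_pull_lin f t).
Lemma ldual_pull_linear x y (f : hom x y) : linear (ldual_pull f).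
Proof. by move=> a s t; apply: ldual_ext. Qed.

(* [n] is the Nakayama object of [p]: the pairing [Hom (p, x) × Hom (x, n) -> k],
   [(g, f) |-> lam (f ∘ g)], is perfect. *)
Definition nakayama (n : A) (lam : {linear hom p n -> k^o}) :=
  (forall x (t : {linear hom p x -> k^o}),
     exists! f : hom x n, forall g, t g = lam (f ∘ g)) /\
  (forall x (t : {linear hom x n -> k^o}),
     exists! g : hom p x, forall f, t f = lam (f ∘ g)).

(** [n] represents [x |-> ldual (hom p x)], which is left exact because [p] is projective, and [lam]
    is the universal element. The second half of perfectness is reflexivity of the
    finite-dimensional space [hom p x]. *)
Theorem nakayama_ex : exists n lam, @nakayama n lam.
Proof.
have [ab hfd _ _ _] := finA.
have [n [s hs]] : exists n (s : ldual (hom p n)),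
    forall x (t : ldual (hom p x)), exists! f : hom x n, ldual_pull f s = t.
  apply: (@representable k A (fun x => ldual (hom p x))
    (fun x y f => mk_linear (@ldual_pull_linear x y f))) => //.
  - by move=> x; apply: ldual_fin_dim.
  - by move=> x t; apply: ldual_ext => g /=; rewrite comp_idl.
  - by move=> x y z g f t; apply: ldual_ext => h /=; rewrite comp_assoc.
  - move=> x y t a f g; apply: ldual_ext => h /=.
    by rewrite compDl compZl (ld_lin t).
  - move=> x y z q f hq t t0.
    have tq (g g' : hom p y) : q ∘ g = q ∘ g' -> t g = t g'.
      move=> e; have [|h eh] := projective_lift ab (g := g - g') pp hq.
        by rewrite compBr e subrr.
      have -> : g = 1 *: (g - g') + g' by rewrite scale1r subrK.
      rewrite (ld_lin t) -eh; have /= -> := congr1 (fun u : ldual _ => u h) t0.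
      by rewrite scaler0 add0r.
    have lift (g : hom p z) : exists g', q ∘ g' = g by apply: pp; apply: cokernel_epi hq.
    pose t' g := t (projT1 (cid (lift g))).
    have t'E g : t' (q ∘ g) = t g by apply: tq; case: cid.
    have lt' : linear t'.
      move=> a u v; have [u' <-] := lift u; have [v' <-] := lift v.
      by rewrite -compZr -compDr !t'E (ld_lin t).
    exists (Ldual lt'); split; first by apply: ldual_ext => g /=; rewrite t'E.
    move=> t'' e; apply: ldual_ext => g; have [g' <-] := lift g.
    by rewrite /= t'E -e.
have [lam lamE] : exists lam : {linear hom p n -> k^o}, forall g, lam g = s g.
  by exists (mk_linear (ld_lin s)).
have P1 x (t : {linear hom p x -> k^o}) : exists! f : hom x n, forall g, t g = lam (f ∘ g).
  have l : linear (t : hom p x -> k^o) by move=> a u v; rewrite linearP.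
  have [f [ef uf]] := hs x (Ldual l); exists f; split.
    by move=> g; have /= := congr1 (fun u : ldual _ => u g) ef; rewrite lamE => <-.
  by move=> f' ef'; apply: uf; apply: ldual_ext => g; rewrite /= ef' lamE.
exists n, lam; split=> // x t.
(* The first half transports the dual basis [c] of [hom p x] to elements [f i] of [hom x n]; these
   span, with coefficients given by pairing with [b]. *)
have [d [b [c [e _]]]] := dual_basis (hfd p x).
pose f i := projT1 (cid (P1 x (c i))).
have fE i g : c i g = lam (f i ∘ g) by rewrite /f; case: cid => h [].
have exp_h h : h = \sum_i (lam (h ∘ b i) : k) *: f i.
  have l : linear (fun g : hom p x => lam (h ∘ g) : k^o).
    by move=> a u v; rewrite compDr compZr linearP.
  have [h0 [_ uh]] := P1 x (mk_linear l).
  transitivity h0; first by symmetry; apply: uh.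
  apply: uh => g /=; rewrite {1}(e g) comp_sumr comp_suml !linear_sum.
  by apply: eq_bigr => i _; rewrite compZr compZl !linearZ /= -fE; apply: mulrC.
exists (\sum_i t (f i) *: b i); split.
  move=> h; rewrite {1}(exp_h h) comp_sumr !linear_sum; apply: eq_bigr => i _.
  by rewrite compZr !linearZ /=; apply: mulrC.
move=> g hg; rewrite (e g); apply: eq_bigr => i _.
by rewrite fE -hg.
Qed.

End Nakayama.

(** * Frobenius data *)

Section DualCategory.
Variables (k : fieldType) (C : monCat k) (tC : finite_multitensor C) (M : modCat C).
Hypothesis exM : exact_module M.
Implicit Types K : dual M.

Definition to_dual (H : premodFunctor M M) (hH : is_modFunctor H) : dual M :=
  ModFunctor hH (mod_right_exact tC exM exM.1 hH).

Definition to_hom K K' a (h : @is_modNat _ _ _ _ (as_mf K) (as_mf K') a) : hom K K' :=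
  ModNat h.

Lemma mn_gen_uniq (H H' : functor M M) (p : M) f g : right_exact H -> proj_gen p ->
  is_natural (F := H) (G := H') f -> is_natural (F := H) (G := H') g ->
  f p = g p -> forall x, f x = g x.
Proof.
move=> rH pg fn gn e x; have [[ab _ _ _ _] _ _] := exM.1.
have [n [s [q hq]]] := proj_gen_cover x ab pg.
apply: (right_exact_epi ab rH hq); rewrite -fn -gn; congr (_ ∘ _).
rewrite -(comp_idr (f s)) -(comp_idr (g s)) -fmap_id -(ds_sum s) fmap_sum !comp_sumr.
by apply: eq_bigr => i _; rewrite fmap_comp !comp_assoc -fn -gn e.
Qed.

Lemma dual_hom_fin_dim K K' : fin_dim (hom K K').
Proof.
have [fM _ _] := exM.1; have [p pg] := proj_gen_ex fM; have [_ hfd _ _ _] := fM.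
have l : linear (fun a : hom K K' => as_mn a p) by [].
apply: (fin_dim_sub (f := mk_linear l)); first exact: hfd.
move=> a b /= e; apply: modNat_ext.
by apply: (mn_gen_uniq (mf_rex K) pg) e; [case: (mn_ax a) | case: (mn_ax b)].
Qed.

End DualCategory.

Section FrobeniusDatum.
Variables (k : fieldType) (C : monCat k) (M : modCat C) (n p : M).
Variables (lam : {linear hom p n -> k^o}) (U : premodFunctor M (reg C)).
Variable ad : madj (free n) U.

(* The elementary form of a unimodular structure: such an [e] exists if and only if the
   identity functor is an end [∫_H Hom (H, 1) ⊗ H], by [universal_frob_datum] and
   [datum_distinguished]. *)
Definition frob_datum (e : forall y, hom y (rk1 U p y)) :=
  [/\ @is_modNat _ _ _ _ (id_pm M) (rk1 U p) e,
      exists ad' : madj U (free p), forall y, un ad' y = e y &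
      forall x f, @is_modNat _ _ _ _ (rk1 U p) (rk1 U x) f -> exists g : hom p x,
        (forall y, f y ∘ e y = (idm (U y) ▶ g) ∘ e y) /\
        forall q : hom x n, lam (co ad n ∘ ((idm (U n) ▶ q) ∘ (f n ∘ rk1_in ad p)))
          = lam (q ∘ g)].

Lemma co_in : co ad n ∘ rk1_in ad n = idm n.
Proof. by rewrite /rk1_in comp_assoc co_coev1 invR //; apply: munit_iso. Qed.

Lemma co_in_nat x (q : hom x n) : co ad n ∘ ((idm (U n) ▶ q) ∘ rk1_in ad x) = q.
Proof. by rewrite rk1_in_nat comp_assoc co_in comp_idl. Qed.

Lemma extend_id x (q : hom x n) y :
  extend ad (K := id_pm M) q y = co ad y ∘ (idm (U y) ▶ q).
Proof. by rewrite /extend /= inv_idm comp_idl. Qed.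

End FrobeniusDatum.

(** * From a universal wedge to a Frobenius datum *)

Section UniversalDatum.
Variables (k : fieldType) (C : monCat k) (tC : finite_multitensor C) (M : modCat C).
Hypothesis exM : exact_module M.
Variables (n p : M) (lam : {linear hom p n -> k^o}).
Hypothesis nak : nakayama lam.
Variables (U : premodFunctor M (reg C)) (hU : is_modFunctor U) (ad : madj (free n) U).
Variable pi : forall K : dual M, {linear hom K one -> k^o} -> hom (one : dual M) K.
Hypothesis univ : universal_family pi.
Implicit Types K : dual M.

Lemma lam_inj x (g g' : hom p x) : (forall q, lam (q ∘ g) = lam (q ∘ g')) -> g = g'.
Proof.
move=> h; have l : linear (fun q : hom x n => lam (q ∘ g) : k^o).
  by move=> a u v; rewrite compDl compZl linearP.
have [g0 [_ u]] := nak.2 x (mk_linear l).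
by rewrite -(u g) // -(u g') // => q; rewrite /= h.
Qed.

Lemma lam_inj' x (q q' : hom x n) : (forall g, lam (q ∘ g) = lam (q' ∘ g)) -> q = q'.
Proof.
move=> h; have l : linear (fun g : hom p x => lam (q ∘ g) : k^o).
  by move=> a u v; rewrite compDr compZr linearP.
have [g0 [_ u]] := nak.1 x (mk_linear l).
by rewrite -(u q) // -(u q') // => g; rewrite /= h.
Qed.

Lemma eval_lin K (g : hom p (as_mf K n)) :
  linear (fun q : hom K one => lam (as_mn q n ∘ g) : k^o).
Proof.
by move=> a u v; rewrite -linearP; congr (lam _); rewrite -comp_linl.
Qed.
(** [lam] acts as a trace at [n]. With [K] the functor [rk1 U p] and [g] its generator
    [rk1_in ad p], this is the tautological functional that defines [e]. *)
Definition eval_at K (g : hom p (as_mf K n)) : {linear hom K one -> k^o} :=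
  mk_linear (eval_lin g).

Let W x : dual M := to_dual tC exM (rk1_mf hU x).
Let e y : hom y (rk1 U p y) := as_mn (pi (eval_at (K := W p) (rk1_in ad p))) y.

Lemma e_mn : @is_modNat _ _ _ _ (id_pm M) (rk1 U p) e.
Proof. exact: mn_ax (pi (eval_at (K := W p) (rk1_in ad p))). Qed.

Lemma e_nat x (g : hom p x) y :
  as_mn (pi (eval_at (K := W x) (rk1_in ad x ∘ g))) y = (idm (U y) ▶ g) ∘ e y.
Proof.
have [[_ pn] _] := univ.
rewrite -(pn (W p) (W x) (to_hom (K := W p) (K' := W x) (rk1_mn U g))
  (eval_at (K := W p) (rk1_in ad p))) // => v /=.
by rewrite -comp_assoc rk1_in_nat.
Qed.

(** Naturality of [pi] replaces [f ∘ e] by the component at a functional on [Hom (rk1 U x, 1)], that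
    is, on [hom x n]. Perfectness of the pairing represents this functional by a morphism
    [g : p -> x]. *)
Lemma e_compat x f : @is_modNat _ _ _ _ (rk1 U p) (rk1 U x) f -> exists g : hom p x,
  (forall y, f y ∘ e y = (idm (U y) ▶ g) ∘ e y) /\
  forall q : hom x n, lam (co ad n ∘ ((idm (U n) ▶ q) ∘ (f n ∘ rk1_in ad p))) = lam (q ∘ g).
Proof.
move=> hf.
have l : linear (fun q : hom x n =>
    lam (co ad n ∘ ((idm (U n) ▶ q) ∘ (f n ∘ rk1_in ad p))) : k^o).
  by move=> a u v; rewrite actm_linr compDl compZl compDr compZr linearP.
have [g [hg _]] := nak.2 x (mk_linear l); exists g; split; last exact: hg.
move=> y; rewrite -e_nat; have [[pl pn] _] := univ.
rewrite -(pn (W p) (W x) (to_hom (K := W p) (K' := W x) hf)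
  (eval_at (K := W p) (rk1_in ad p))) //.
move=> v /=; rewrite comp_assoc -hg /=.
have e1 : as_mn v n = co ad n ∘ (idm (U n) ▶ (as_mn v n ∘ rk1_in ad x)).
  rewrite -extend_id; apply: (extend_uniq (ad := ad) (K := id_pm M) (x := x) (f := as_mn v)).
  - by case: (mf_ax (id_mf M)).
  - exact: mn_ax v.
  - exact: extend_mn (mf_ax (id_mf M)).
  - by rewrite extend_in //; apply: mf_ax (id_mf M).
by rewrite (comp_assoc (co ad n)) -e1 comp_assoc.
Qed.

Section Splitting.
Variables (s : M) (adS : madj U (free s)).
Let c := rk1_out adS p ∘ e s.

Lemma e_out y : e y = (idm (U y) ▶ c) ∘ un adS y.
Proof. exact: (out_uniq adS e_mn). Qed.

(* The transpose of [Hom (K, 1) -> Hom (K n, n)] goes the wrong way; instead a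
   morphism [K s -> n] yields [K -> K (rk1 s) ≅ rk1 (K s) -> rk1 n -> 1]. *)
Definition spread (K : premodFunctor M M) (q : hom (K s) n) y : hom (K y) y :=
  co ad y ∘ ((idm (U y) ▶ q) ∘ (pm_str K (U y) s ∘ fmap K (un adS y))).

Lemma spread_mn (K : premodFunctor M M) (q : hom (K s) n) : is_modFunctor K ->
  @is_modNat _ _ _ _ K (id_pm M) (spread q).
Proof.
move=> hK; have [si sn sa su] := hK.
have [h1n h1s] := mn_whl (mf_str_nat hK) (un_mn adS).
have [h2n h2s] := mn_whr U (str_mn s hK).
have h34 := mn_comp (rk1_mn U q) (co_mn ad).
have h12 : @is_modNat _ _ _ _ K (rk1 U (K s))
    (fun y => pm_str K (U y) s ∘ fmap K (un adS y)).
  split=> [x y f|d y].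
    have /= e1 := h1n x y f; have /= e2 := h2n x y f.
    by rewrite /= comp_assoc e2 -!comp_assoc e1.
  have /= e1 := h1s d y; have /= e2 := h2s d y.
  rewrite fmap_id comp_idr in e1.
  by rewrite /= comp_assoc e2 act_compr -!comp_assoc -e1 !fmap_comp !comp_assoc.
apply: mn_ext (mn_comp h12 h34) => y.
by rewrite /spread -!comp_assoc.
Qed.

Lemma spread_nat (K K' : premodFunctor M M) f (q : hom (K' s) n) y :
  @is_modNat _ _ _ _ K K' f -> spread q y ∘ f y = spread (q ∘ f s) y.
Proof.
move=> [fn fs]; rewrite /spread -!comp_assoc fn (comp_assoc (pm_str K' _ _)) fs.
by rewrite act_compr -!comp_assoc.
Qed.

Lemma spread_lin K : linear (fun q : hom (as_mf K s) n =>
  to_hom (K := K) (K' := one) (spread_mn q (mf_ax (as_mf K)))).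
Proof.
move=> a u v; apply: modNat_ext => y /=; rewrite /spread actm_linr.
by rewrite compDl compZl compDr compZr.
Qed.

Lemma unspread_ex K (t : {linear hom K one -> k^o}) :
  exists g : hom p (as_mf K s), forall q, t (mk_linear (@spread_lin K) q) = lam (q ∘ g).
Proof.
have l : linear (fun q => t (mk_linear (@spread_lin K) q) : k^o).
  by move=> a u v; rewrite !linearP.
by have [g [h _]] := nak.2 _ (mk_linear l); exists g.
Qed.
Definition unspread K (t : {linear hom K one -> k^o}) : hom p (as_mf K s) :=
  projT1 (cid (unspread_ex t)).
Lemma unspreadE K (t : {linear hom K one -> k^o}) q :
  t (mk_linear (@spread_lin K) q) = lam (q ∘ unspread t).
Proof. by rewrite /unspread; case: cid. Qed.

Variables (Us : premodFunctor M (reg C)) (hUs : is_modFunctor Us) (ads : madj (free s) Us).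
Let X : dual M := to_dual tC exM (rk1_mf hUs p).

(** A second family, whose source is generated by [p] at [s] instead of [n]; factoring it through
    the universal family will produce a section of [c]. *)
Definition tautological K (t : {linear hom K one -> k^o}) : hom X K :=
  to_hom (K := X) (extend_mn ads (unspread t) (mf_ax (as_mf K))).

Lemma tautological_family : is_family tautological.
Proof.
split.
  move=> K d c0 t t' h.
  have e1 : unspread t' = \sum_i c0 i *: unspread (t i).
    apply: lam_inj => q; rewrite -unspreadE h comp_sumr linear_sum.
    by apply: eq_bigr => i _; rewrite compZr linearZ /= -unspreadE.
  have eval_sum (r : 'I_d -> hom X K) y : as_mn (\sum_i r i) y = \sum_i as_mn (r i) y.
    elim: d r {c0 t h e1} => [|d ih] r; first by rewrite !big_ord0.
    by rewrite !big_ord_recr /= -ih.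
  apply: modNat_ext => y; rewrite [RHS]eval_sum /= /extend e1.
  have l : linear (fun g => fmap (as_mf K) (co ads y) ∘
      (inv (pm_str (as_mf K) (Us y) s) ∘ (idm (Us y) ▶ g : hom (Us y ▷ p) _))).
    by move=> a u v; rewrite actm_linr compDr compZr compDr compZr.
  rewrite -[LHS]/(mk_linear l (\sum_i _)) linear_sum; apply: eq_bigr => i _.
  by rewrite linearZ.
move=> K K' f t t' h; apply: modNat_ext => y.
have hK' := mf_ax (as_mf K').
apply: (extend_uniq (ad := ads) hK' (x := p) (f := as_mn (f ∘ tautological t)) (f' := as_mn (tautological t'))).
- exact: mn_ax (as_mn (f ∘ tautological t)).
- exact: mn_ax (as_mn (tautological t')).
- rewrite /= -comp_assoc !extend_in //; last exact: mf_ax (as_mf K).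
  apply: lam_inj => q; rewrite comp_assoc -!unspreadE h; congr (t _).
  apply: modNat_ext => z /=; rewrite (@spread_nat (as_mf K) (as_mf K') (as_mn f)) //.
  exact: mn_ax (as_mn f).
Qed.

(** The factorization [h] of [tautological] through [pi], evaluated on the functional that defines
    [e], says that [unspread t0] is [e s ∘ r]. Composing with [rk1_out] gives the identity of [p],
    as both sides pair equally with every [q]. *)
Lemma c_split : exists r : hom p s, c ∘ r = idm p.
Proof.
have [h [hE _]] := univ.2 _ _ tautological_family.
exists (as_mn h s ∘ rk1_in ads p).
pose t0 := eval_at (K := W p) (rk1_in ad p).
have e1 : unspread t0 = e s ∘ (as_mn h s ∘ rk1_in ads p).
  rewrite -[LHS](extend_in ads (K := as_mf (W p)) _ (mf_ax (as_mf (W p)))) [RHS]comp_assoc.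
  congr (_ ∘ _); exact: (congr1 (fun a : hom X (W p) => as_mn a s) (hE (W p) t0)).
rewrite /c -[LHS]comp_assoc -e1.
apply: lam_inj => q; rewrite comp_idr comp_assoc.
have /= <- := unspreadE t0 (q ∘ rk1_out adS p); congr (lam _).
have o := rk1_out_str hU adS p n.
by rewrite /spread act_compr -(comp_assoc (idm _ ▶ q)) o comp_idr -comp_assoc co_in_nat.
Qed.

(** The defect [v] of [r] as an inverse satisfies [c ∘ v = 0]. It induces an endomorphism [w] of [U]
    whose action on [U (-) ▷ p] kills [e]. By [e_compat] and the pairing, the corresponding
    endomorphism of [n] vanishes, hence [w] does, hence [v]. *)
Lemma c_iso : is_iso c.
Proof.
have [r cr] := c_split; exists r; split=> //.
have fs y : fmap U (0 : hom y y) = 0 by rewrite fmap0.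
pose v := idm s - r ∘ c.
have cv : c ∘ v = 0 by rewrite compBr comp_idr comp_assoc cr comp_idl subrr.
suff v0 : v = 0 by apply/eqP; rewrite eq_sym -subr_eq0; apply/eqP.
(* Transpose of [v] acting on the unit: the endomorphism of the left adjoint [U] corresponding to
   the endomorphism [- ▷ v] of its right adjoint. *)
pose w y := co adS (U y) ∘ fmap U ((idm (U y) ▶ v) ∘ un adS y).
have sU := mf_str_nat hU.
have w_un y : (w y ▶ idm s) ∘ un adS y = (idm (U y) ▶ v) ∘ un adS y.
  rewrite /w act_compl -!comp_assoc.
  have /= -> := (un_mn adS).1 _ _ ((idm (U y) ▶ v) ∘ un adS y).
  rewrite comp_assoc; have /= -> := triR adS (U y); by rewrite comp_idl.
have w_mn : @is_modNat _ _ _ _ U U w.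
  have h1 := mn_whl sU (mn_comp (un_mn adS) (rk1_mn U v)).
  have h2 := mn_whr U (co_mn adS).
  split=> [x y f|d y]; rewrite /w.
    rewrite comp_assoc; have /= -> := h2.1 x y f; rewrite -!comp_assoc.
    by have /= -> := h1.1 x y f.
  have /= e1 := h1.2 d y; have /= e2 := h2.2 d y.
  rewrite fmap_id comp_idr in e1; rewrite comp_idl in e2.
  rewrite (fmap_comp U (massoc d (U y) s)) in e1.
  by rewrite tens_compr comp_assoc e2 -[RHS]comp_assoc -e1 -!comp_assoc.
have f_mn : @is_modNat _ _ _ _ (rk1 U p) (rk1 U p) (fun y => w y ▶ idm p).
  exact: mn_whl (mf_str_nat (free_mf p)) w_mn.
have f_e y : (w y ▶ idm p) ∘ e y = 0.
  rewrite e_out comp_assoc -act_swap -comp_assoc w_un comp_assoc -act_compr cv.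
  by rewrite act0r comp0l.
have [g [hg hl]] := e_compat f_mn.
have g0 : g = 0.
  rewrite -(comp_idr g) -cr comp_assoc /c (comp_assoc g) rk1_out_nat -(comp_assoc (rk1_out _ _)).
  by rewrite -hg f_e comp0r comp0l.
have v'0 : co ad n ∘ ((w n ▶ idm n) ∘ rk1_in ad n) = 0.
  apply: lam_inj' => q; rewrite comp0l linear0.
  transitivity (lam (q ∘ g)); last by rewrite g0 comp0r linear0.
  rewrite -hl; congr (lam _); rewrite -(comp_assoc (co ad n)) -(comp_assoc (w n ▶ idm n)).
  by rewrite (comp_assoc (idm _ ▶ q)) act_swap -(comp_assoc (w n ▶ _)) rk1_in_nat.
have cw y : co ad y ∘ (w y ▶ idm n) = 0.
  have h1 := mn_comp (mn_whl (mf_str_nat (free_mf n)) w_mn) (co_mn ad).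
  have h2 := @extend_mn _ _ _ _ _ ad (id_pm M) n 0 (mf_ax (id_mf M)).
  have h3 : (co ad n ∘ (w n ▶ idm n)) ∘ rk1_in ad n =
      extend ad (K := id_pm M) (0 : hom n n) n ∘ rk1_in ad n.
    by rewrite extend_in -?comp_assoc ?v'0 //; apply: mf_ax (id_mf M).
  by rewrite (extend_uniq (mf_ax (id_mf M)) h1 h2 h3 y) /extend /= act0r !comp0r.
have w0 y : w y = 0.
  have /= <- := comp_idl (w y); have /= <- := triR ad y.
  rewrite -comp_assoc; have /= <- := (un_mn ad).1 _ _ (w y).
  by rewrite comp_assoc -fmap_comp cw fmap0 comp0l.
have := w_un s; rewrite w0 act0l comp0l => h0.
rewrite -(comp_idr v) -(rk1_out_un adS) comp_assoc rk1_out_nat -comp_assoc -h0.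
by rewrite comp0r.
Qed.

End Splitting.

Theorem universal_frob_datum : exists e, @frob_datum _ _ _ n p lam U ad e.
Proof.
have [fM _ _] := exM.1; have [s [adS]] := serre_ex tC exM hU.
have [Us [hUs [ads]]] := inner_hom_ex tC s exM.1.
have ci := c_iso adS hUs ads.
exists e; split; first exact: e_mn; last exact: e_compat.
have hr : @is_modIso _ _ _ _ (free s) (free p) (fun y => idm y ▶ (rk1_out adS p ∘ e s)).
  by split; [apply: free_mn | move=> y; apply: iso_actr].
by exists (madj_iso hU adS hr) => y; rewrite /= -e_out.
Qed.

End UniversalDatum.

Lemma copower_ex (k : fieldType) (A : linCat k) (V : lmodType k) (z : A) :
  fin_dim V -> (forall n, inhabited (dsum n z)) -> inhabited (copower V z).
Proof.
move=> /dual_basis [n [b [t [e d]]]] /(_ n) [s].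
have li : linear (fun v => \sum_i (t i v : k) *: ds_in s i).
  move=> a u v; rewrite scaler_sumr -big_split /=; apply: eq_bigr => i _.
  by rewrite linearP scalerDl scalerA.
split; refine (@Copower k A V z s (mk_linear li) (fun y g => dsum_desc s (fun i => g (b i))) _ _).
- move=> y g v; rewrite /= comp_sumr [in RHS](e v) linear_sum; apply: eq_bigr => i _.
  by rewrite compZr dsum_descE linearZ.
- move=> y h h' hh; apply: (dsum_inP (s := s)) => j; have := hh (b j).
  rewrite /= (bigD1 j) //= big1 ?addr0; last first.
    by move=> i /negPf ij; rewrite d ij scale0r.
  by rewrite d eqxx scale1r.
Qed.

(** * Direct sums and copowers in the dual category *)

Section DualSums.
Variables (k : fieldType) (C : monCat k) (tC : finite_multitensor C) (M : modCat C).
Hypothesis exM : exact_module M.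
Variables (K : dual M) (r : nat).
Let H := as_mf K.

Lemma pointwise_dsum m : exists d : dsum r (H m), True.
Proof.
by have [[ab _ _ _ _] _ _] := exM.1; have [d] := dsum_ex r (H m) ab; exists d.
Qed.
Let s (m : M) : dsum r (H m) := projT1 (cid (pointwise_dsum m)).

Let sm m m' (f : hom m m') : hom (s m) (s m') :=
  dsum_desc (s m) (fun i => ds_in (s m') i ∘ fmap H f).

Lemma sm_in m m' (f : hom m m') i : sm f ∘ ds_in (s m) i = ds_in (s m') i ∘ fmap H f.
Proof. exact: dsum_descE. Qed.

Lemma sm_id m : sm (idm m) = idm (s m).
Proof. by apply: dsum_inP => i; rewrite sm_in fmap_id comp_idl comp_idr. Qed.
Lemma sm_comp x y z (g : hom y z) (f : hom x y) : sm (g ∘ f) = sm g ∘ sm f.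
Proof.
by apply: dsum_inP => i; rewrite -comp_assoc !sm_in comp_assoc sm_in fmap_comp comp_assoc.
Qed.
Lemma sm_linear x y : linear (@sm x y).
Proof.
move=> a f g; apply: dsum_inP => i.
by rewrite compDl compZl !sm_in fmap_linear compDr compZr.
Qed.
Let S : functor M M := @Functor _ M M (fun m => s m) sm sm_id sm_comp sm_linear.

Let st c m : hom (S (c ▷ m)) (c ▷ S m) :=
  dsum_desc (s (c ▷ m)) (fun i => (idm c ▶ ds_in (s m) i) ∘ pm_str H c m).

Lemma st_in c m i :
  st c m ∘ ds_in (s (c ▷ m)) i = (idm c ▶ ds_in (s m) i) ∘ pm_str H c m.
Proof. exact: dsum_descE. Qed.

Lemma act_dsum c m : \sum_i ((idm c ▶ ds_in (s m) i) ∘ (idm c ▶ ds_pr (s m) i))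
  = idm (c ▷ s m : M).
Proof.
rewrite (eq_bigr (fun i => idm c ▶ (ds_in (s m) i ∘ ds_pr (s m) i))) => [|i _].
  rewrite -actm_id -ds_sum; have l := @actm_linr _ C M c c (s m) (s m) (idm c).
  by rewrite -[RHS]/(mk_linear l (\sum_i _)) linear_sum.
by rewrite act_compr.
Qed.

Lemma act_dsum_inP c m y (f g : hom (c ▷ s m) y) :
  (forall i, f ∘ (idm c ▶ ds_in (s m) i) = g ∘ (idm c ▶ ds_in (s m) i)) -> f = g.
Proof.
move=> h; rewrite -(comp_idr f) -(comp_idr g) -act_dsum !comp_sumr.
by apply: eq_bigr => i _; rewrite !comp_assoc h.
Qed.

Let P : premodFunctor M M := @PremodFunctor _ C M M S st.

Lemma sum_mf : is_modFunctor P.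
Proof.
have [hi hn ha hu] := mf_ax H; split=> /= [c m|c c' m m' f g|c d m|m].
- exists (\sum_i (ds_in (s (c ▷ m)) i ∘ (inv (pm_str H c m) ∘ (idm c ▶ ds_pr (s m) i)))).
  have inv_in i : (\sum_j (ds_in (s (c ▷ m)) j ∘ (inv (pm_str H c m) ∘ (idm c ▶ ds_pr (s m) j))))
      ∘ (idm c ▶ ds_in (s m) i) = ds_in (s (c ▷ m)) i ∘ inv (pm_str H c m).
    rewrite comp_suml (bigD1 i) //= -!comp_assoc -act_compr ds_id actm_id comp_idr.
    rewrite big1 ?addr0 // => j /eqP ji.
    by rewrite -!comp_assoc -act_compr ds_0 // act0r !comp0r.
  split.
    apply: (dsum_inP (s := s (c ▷ m))) => i.
    by rewrite -comp_assoc st_in comp_assoc inv_in -comp_assoc invL // comp_idl comp_idr.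
  apply: act_dsum_inP => i.
  by rewrite -comp_assoc inv_in comp_assoc st_in -comp_assoc invR // comp_idl comp_idr.
- apply: (dsum_inP (s := s (c ▷ m))) => i.
  rewrite -!comp_assoc sm_in st_in (comp_assoc (st _ _)) st_in -!comp_assoc hn !comp_assoc.
  by rewrite -!actm_comp comp_idl comp_idr sm_in.
- apply: (dsum_inP (s := s (_ ▷ m))) => i.
  rewrite -!comp_assoc sm_in st_in (comp_assoc (st _ _)) st_in -!comp_assoc.
  rewrite (comp_assoc (massoc _ _ _)) massoc_natr -!comp_assoc ha.
  rewrite (comp_assoc (idm c ▶ st d m)) -act_compr st_in act_compr.
  by rewrite !comp_assoc.
- apply: (dsum_inP (s := s (_ ▷ m))) => i.
  by rewrite -!comp_assoc sm_in st_in comp_assoc munit_nat -comp_assoc hu.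
Qed.

Let D : dual M := to_dual tC exM sum_mf.

Lemma sum_in_mn i : @is_modNat _ _ _ _ H P (fun m => ds_in (s m) i).
Proof. by split=> [x y f|c m] /=; rewrite ?sm_in ?st_in. Qed.

Lemma sum_pr_sm i m m' (f : hom m m') : ds_pr (s m') i ∘ sm f = fmap H f ∘ ds_pr (s m) i.
Proof.
apply: dsum_inP => j; rewrite -!comp_assoc sm_in; case: (eqVneq i j) => [<-|/eqP ij].
  by rewrite comp_assoc !ds_id comp_idl comp_idr.
by rewrite comp_assoc !ds_0 // comp0l comp0r.
Qed.

Lemma sum_pr_mn i : @is_modNat _ _ _ _ P H (fun m => ds_pr (s m) i).
Proof.
split=> [x y f|c m] /=; first by rewrite sum_pr_sm.
apply: dsum_inP => j; rewrite -!comp_assoc st_in [in RHS]comp_assoc -act_compr.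
case: (eqVneq i j) => [<-|/eqP ij].
  by rewrite !ds_id comp_idr actm_id comp_idl.
by rewrite !ds_0 // act0r comp0l comp0r.
Qed.

Lemma dual_sum_eval n (X Y : dual M) (f : 'I_n -> hom X Y) m :
  as_mn (\sum_i f i) m = \sum_i as_mn (f i) m.
Proof.
elim: n f => [|n ih] f; first by rewrite !big_ord0.
by rewrite !big_ord_recr /= -ih.
Qed.

Lemma dual_dsum : inhabited (dsum r K).
Proof.
split; refine (@Dsum k (dual M) r K D (fun i => to_hom (K' := D) (sum_in_mn i))
  (fun i => to_hom (K := D) (sum_pr_mn i)) _ _ _).
- by move=> j; apply: modNat_ext => m; apply: ds_id.
- by move=> i j ij; apply: modNat_ext => m; apply: ds_0.
- apply: modNat_ext => m; rewrite -[LHS]/(as_mn _ m) dual_sum_eval; exact: ds_sum.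
Qed.

End DualSums.

Lemma dual_copower (k : fieldType) (C : monCat k) (tC : finite_multitensor C) (M : modCat C)
  (exM : exact_module M) (y z : dual M) : inhabited (copower (hom y one) z).
Proof.
by apply: copower_ex; [apply: dual_hom_fin_dim | move=> n; apply: dual_dsum].
Qed.

Section CalculusUnits.
Variables (k : fieldType) (C : monCat k) (M N P : modCat C).

Lemma mn_idl (H : premodFunctor M N) (K : premodFunctor M N) a :
  @is_modNat _ _ _ _ (comp_pm (id_pm N) H) K a -> @is_modNat _ _ _ _ H K a.
Proof.
move=> [an am]; split=> [x y f|c m]; first exact: an.
by have /= := am c m; rewrite comp_idl.
Qed.

Lemma mn_idr (H : premodFunctor M N) (K : premodFunctor M N) a :
  @is_modNat _ _ _ _ (comp_pm H (id_pm M)) K a -> @is_modNat _ _ _ _ H K a.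
Proof.
move=> [an am]; split=> [x y f|c m]; first exact: an.
by have /= := am c m; rewrite fmap_id comp_idr.
Qed.

Lemma mn_assocl (Q : modCat C) (H : premodFunctor N P) (K : premodFunctor M N)
    (L : premodFunctor Q M) X a :
  @is_modNat _ _ _ _ (comp_pm (comp_pm H K) L) X a ->
  @is_modNat _ _ _ _ (comp_pm H (comp_pm K L)) X a.
Proof.
move=> [an am]; split=> [x y f|c m]; first exact: an.
by rewrite am /= fmap_comp !comp_assoc.
Qed.

Lemma mn_assocr (Q : modCat C) (H : premodFunctor N P) (K : premodFunctor M N)
    (L : premodFunctor Q M) X a :
  @is_modNat _ _ _ _ X (comp_pm (comp_pm H K) L) a ->
  @is_modNat _ _ _ _ X (comp_pm H (comp_pm K L)) a.
Proof.
move=> [an am]; split=> [x y f|c m]; first exact: an.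
by rewrite -am /= fmap_comp !comp_assoc.
Qed.

Lemma mn_lift (L H K : premodFunctor M N) (a : forall m, hom (H m) (K m))
    (b : forall m, hom (L m) (K m)) (h : forall m, hom (L m) (H m)) :
  (forall m, is_mono (a m)) -> (forall c m, is_mono (idm c ▶ a m)) ->
  (forall m, a m ∘ h m = b m) ->
  @is_modNat _ _ _ _ H K a -> @is_modNat _ _ _ _ L K b -> @is_modNat _ _ _ _ L H h.
Proof.
move=> ma mca e [an am] [bn bm]; split=> [x y f|c m].
  by apply: ma; rewrite !comp_assoc -an -comp_assoc !e bn.
by apply: mca; rewrite !comp_assoc -am -comp_assoc e bm -act_compr e.
Qed.

End CalculusUnits.

(** * From a Frobenius datum to the end *)

Section Datum.
Variables (k : fieldType) (C : monCat k) (tC : finite_multitensor C) (M : modCat C).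
Hypothesis exM : exact_module M.
Variables (n p : M) (lam : {linear hom p n -> k^o}).
Hypotheses (nak : nakayama lam) (pg : proj_gen p).
Variables (U : premodFunctor M (reg C)) (hU : is_modFunctor U) (ad : madj (free n) U).
Variable e : forall y, hom y (rk1 U p y).
Hypothesis fe : frob_datum lam ad e.

Let e_mn : @is_modNat _ _ _ _ (id_pm M) (rk1 U p) e := let: And3 h _ _ := fe in h.

Lemma datum_right_exact : right_exact U.
Proof. by have h := mod_right_exact tC exM (reg_finite tC) hU. Qed.

Lemma datum_left_exact : left_exact U.
Proof. exact: (radj_left_exact (madj_adj ad)). Qed.

(** If [U y] is zero, so is [Hom (y, c ▷ p)] for all [c], and by duality [Hom (Q ▷ y, p)]. For
    projective [Q] covering the unit, [Q ▷ y] is a summand of a sum of copies of [p], hence zero,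
    and it covers [y]. *)
Lemma datum_reflects_zero : reflects_zero U.
Proof.
move=> y hy; have [_ [ad' _] _] := fe; have [fM pM] := exM.
have [[abM _ _ _ _] _ _] := fM.
have [Q [q [pQ hq]]] := unit_cover tC.
have [_ [c [ev [coev [zig zag]]]]] := tC.2 Q.
have homc (f : hom y (c ▷ p)) : f = 0.
  rewrite -(@adj_tr _ _ _ _ _ (madj_adj ad') y c f).
  by rewrite (zero_homl (_ ∘ _) hy) fmap0 comp0l.
have homQ (f : hom (Q ▷ y) p) : f = 0.
  rewrite -(@adj_tr' _ _ _ _ _ (act_adjunction M zig zag) y p f).
  by rewrite (homc (fmap (act_by M c) f ∘ _)) fmap0 comp0r.
apply: (act_by_reflects_zero tC fM hq).
have [r [s [f hf]]] := proj_gen_cover (Q ▷ y) abM pg.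
have [g fg] := pM Q y pQ _ _ f (idm (Q ▷ y)) hf.
rewrite /is_zero_ob /= -fg -(comp_idl g) -(ds_sum s) comp_suml comp_sumr big1 // => i _.
by rewrite -comp_assoc (homQ (ds_pr s i ∘ g)) !comp0r.
Qed.

Let abM : is_abelian M := let: And3 (And5 h _ _ _ _) _ _ := exM.1 in h.

Lemma datum_co_epi y : is_epi (co ad y).
Proof.
apply: (reflect_epi abM datum_right_exact datum_reflects_zero) => w f g.
move/(congr1 (fun u => u ∘ un ad (U y))); rewrite -!comp_assoc.
by have /= -> := triR ad y; rewrite !comp_idr.
Qed.

(** The counit of [U ⊣ - ▷ p] at [U y] is the extra map that splits the image under [U] of the fork
    of [e y]. *)
Lemma datum_retract : exists r : forall y, hom (U (U y ▷ p)) (U y),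
  (forall y, r y ∘ fmap U (e y) = idm (U y)) /\
  forall y z (g : hom (U y) (U z)), g ∘ r y = r z ∘ fmap U (g ▶ idm p).
Proof.
have [_ [ad' he] _] := fe; exists (fun y => co ad' (U y)); split=> [y|y z g].
  by rewrite -he; apply: triL ad' y.
exact: (co_mn ad').1 _ _ g.
Qed.

Lemma datum_unit_mono y : is_mono (e y).
Proof.
have [r [re _]] := datum_retract.
apply: (reflect_mono abM datum_left_exact datum_reflects_zero) => w f g.
by move/(congr1 (comp (r y))); rewrite !comp_assoc re !comp_idl.
Qed.

(** Descent: [e y] is the equalizer of [e (U y ▷ p)] and [fmap U (e y) ▷ p]. The comparison [v] from
    [y] to the true equalizer is mono since [e y] is, and epi since [U v] has a right inverse built
    from [r] and [U] reflects epimorphisms. *)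
Lemma datum_cobar y w (g : hom w (U y ▷ p)) :
  e (U y ▷ p) ∘ g = (fmap U (e y) ▶ idm p) ∘ g -> exists h, e y ∘ h = g.
Proof.
move=> eg; have [r [re rn]] := datum_retract.
pose d := e (U y ▷ p) - (fmap U (e y) ▶ idm p).
have de : d ∘ e y = 0.
  by rewrite compBl; have /= -> := e_mn.1 _ _ (e y); rewrite subrr.
have [z [i hi]] := ker_ex abM d.
have [v ev] := kernel_lift hi de.
have [g' eg'] : exists g', i ∘ g' = g.
  by apply: (kernel_lift hi); rewrite compBl eg subrr.
have Ui := datum_left_exact hi.
have Ud : fmap U d ∘ fmap U i = 0 by rewrite -fmap_comp; case: hi => -> _; rewrite fmap0.
have Uv_epi : is_epi (fmap U v).
  have : fmap U v ∘ (r y ∘ fmap U i) = idm (U z).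
    apply: (kernel_mono Ui); rewrite comp_assoc -fmap_comp ev comp_idr comp_assoc rn.
    have := Ud; rewrite /d fmapB compBl => /eqP; rewrite subr_eq0 => /eqP h.
    by rewrite -comp_assoc -h comp_assoc re comp_idl.
  by move=> e1 w' a b /(congr1 (fun u => u ∘ (r y ∘ fmap U i))); rewrite -!comp_assoc e1 !comp_idr.
have v_epi := reflect_epi abM datum_right_exact datum_reflects_zero Uv_epi.
have v_mono : is_mono v.
  by move=> w' a b h; apply: (@datum_unit_mono y); rewrite -ev -!comp_assoc h.
have [v' [_ vv']] := mono_epi_iso abM v_mono v_epi.
by exists (v' ∘ g'); rewrite -ev comp_assoc -(comp_assoc i) vv' comp_idr.
Qed.

Lemma datum_unit_inj x (g : hom p x) : (forall y, (idm (U y) ▶ g) ∘ e y = 0) -> g = 0.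
Proof.
have [_ [ad' he] _] := fe => h.
rewrite -(comp_idr g) -(rk1_out_un ad') comp_assoc rk1_out_nat -comp_assoc.
by rewrite he h comp0r.
Qed.

Lemma one_mf : is_modFunctor (id_pm M).
Proof. exact: (mf_ax (id_mf M)). Qed.

Lemma datum_eval (K : premodFunctor M M) (v : forall y, hom (K y) y) y :
  @is_modNat _ _ _ _ K (id_pm M) v ->
  v y ∘ fmap K (co ad y) = co ad y ∘ ((idm (U y) ▶ v n) ∘ pm_str K (U y) n).
Proof.
move=> [vn vs]; have /= <- := vn _ _ (co ad y).
by have /= <- := vs (U y) n; rewrite comp_idl.
Qed.

Lemma rk1_to_one x (v : forall y, hom (rk1 U x y) y) y :
  @is_modNat _ _ _ _ (rk1 U x) (id_pm M) v ->
  v y = co ad y ∘ (idm (U y) ▶ (v n ∘ rk1_in ad x)).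
Proof.
move=> hv; rewrite -extend_id.
apply: (extend_uniq (ad := ad) one_mf hv); first exact: extend_mn one_mf.
by rewrite extend_in //; apply: one_mf.
Qed.

(** If [f] kills [e], the [g] of the datum is zero, so every value of [lam] that it computes is
    zero. *)
Lemma datum_kill x f : @is_modNat _ _ _ _ (rk1 U p) (rk1 U x) f ->
  (forall y, f y ∘ e y = 0) -> forall v : forall y, hom (rk1 U x y) y,
  @is_modNat _ _ _ _ (rk1 U x) (id_pm M) v -> lam (v n ∘ (f n ∘ rk1_in ad p)) = 0.
Proof.
move=> hf f0 v hv; have [_ _ /(_ x f hf) [g [hg hl]]] := fe.
have g0 : g = 0 by apply: datum_unit_inj => y; rewrite -hg f0.
by rewrite (rk1_to_one n hv) -comp_assoc hl g0 comp0r linear0.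
Qed.

Implicit Types K : dual M.

(** Since [co ad] is epi, a transformation from [K] to the identity is determined at [n]. A
    functional on these transformations therefore extends to [hom (as_mf K n) n], where the pairing
    represents it. The extension is a choice, whose irrelevance is [trace_eq]. *)
Lemma select_ex K (t : {linear hom K one -> k^o}) : exists g : hom p (as_mf K n),
  forall v, t v = lam (as_mn v n ∘ g).
Proof.
have l : linear (fun v : hom K one => as_mn v n) by [].
have [_ hfd _ _ _] : is_finite M by case: exM => -[].
have [|t' ht'] := @functional_extension k _ _ (mk_linear l) t (hfd _ _).
  move=> v v' /= ev; apply: modNat_ext => y.
  have hK := right_exact_epi abM (mf_rex (as_mf K)) (@datum_co_epi y).
  by apply: hK; rewrite !datum_eval ?ev //; [exact: mn_ax (as_mn v') | exact: mn_ax (as_mn v)].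
have [g [hg _]] := nak.2 _ t'; exists g => v.
by rewrite -ht' hg.
Qed.
Definition select K (t : {linear hom K one -> k^o}) := projT1 (cid (select_ex t)).
Lemma selectE K (t : {linear hom K one -> k^o}) v : t v = lam (as_mn v n ∘ select t).
Proof. by rewrite /select; case: cid. Qed.

Lemma trace_mn K (g : hom p (as_mf K n)) :
  @is_modNat _ _ _ _ (id_mf M) (as_mf K) (fun y => extend ad g y ∘ e y).
Proof. exact: mn_comp e_mn (extend_mn ad g (mf_ax (as_mf K))). Qed.

Definition trace K (g : hom p (as_mf K n)) : hom one K :=
  to_hom (K := one) (trace_mn g).

(** Composing with the mono [fmap H (e y)] and the constraint of [H] turns the claim into one about
    a transformation from [rk1 U p] to [rk1 U (H p)]. For it the datum yields a [g1] that pairs to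
    zero with everything, because each such pairing comes from a transformation of [K] to the
    identity. *)
Lemma trace0 K (g : hom p (as_mf K n)) :
  (forall v : hom K one, lam (as_mn v n ∘ g) = 0) -> trace g = 0.
Proof.
move=> hg; apply: modNat_ext => y /=; have hK := mf_ax (as_mf K).
set H := as_mf K in hK *; have [si sn _ _] := hK.
have h1 := mn_whr U (str_mn p hK).
have h2 := mn_idr (mn_whl (mf_str_nat hK) e_mn).
have [h1n h1s] := h1; have [h2n h2s] := h2.
have h12 : @is_modNat _ _ _ _ H (rk1 U (H p)) (fun y => pm_str H (U y) p ∘ fmap H (e y)).
  split=> [x z f|c z].
    by rewrite -comp_assoc; have /= <- := h2n x z f; rewrite !comp_assoc; have /= <- := h1n x z f.
  have /= e1 := h1s c z; have /= e2 := h2s c z.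
  rewrite /= act_compr -!comp_assoc; move: e2; rewrite fmap_comp => <-.
  by rewrite !comp_assoc e1 !comp_assoc.
have hf := mn_comp (extend_mn ad g hK) h12.
have [_ _ /(_ _ _ hf) [g1 [hg1 hl]]] := fe.
have g10 : g1 = 0.
  apply: (lam_inj nak) => q; rewrite -hl comp0r linear0.
  have hv := mn_comp h12 (mn_comp (rk1_mn U q) (co_mn ad)).
  rewrite -(hg (to_hom (K := K) (K' := one) hv)) /= -[in RHS](extend_in ad g hK).
  by rewrite !comp_assoc.
have := hg1 y; rewrite g10 act0r comp0l => h.
have h' : fmap H (e y) ∘ (extend ad g y ∘ e y) = 0.
  by apply: (iso_mono (si (U y) p)); rewrite comp0r -h !comp_assoc.
exact: mono0 (mod_mono tC exM exM.1 hK (@datum_unit_mono y)) h'.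
Qed.

Lemma trace_lin K : linear (@trace K).
Proof.
move=> a g g'; apply: modNat_ext => y /=.
by rewrite /extend actm_linr !(compDr, compZr, compDl, compZl).
Qed.

Lemma trace_eq K (g g' : hom p (as_mf K n)) :
  (forall v : hom K one, lam (as_mn v n ∘ g) = lam (as_mn v n ∘ g')) -> trace g = trace g'.
Proof.
move=> h; apply/eqP; rewrite -subr_eq0; apply/eqP.
rewrite -[LHS]/(mk_linear (@trace_lin K) g - mk_linear (@trace_lin K) g') -linearB.
by apply: trace0 => v; rewrite compBr linearB h subrr.
Qed.

Definition trace_family K (t : {linear hom K one -> k^o}) : hom one K := trace (select t).

Lemma trace_familyE K (t : {linear hom K one -> k^o}) (g : hom p (as_mf K n)) :
  (forall v, t v = lam (as_mn v n ∘ g)) -> trace_family t = trace g.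
Proof. by move=> h; apply: trace_eq => v; rewrite -selectE h. Qed.

Lemma extend_dual K K' (f : hom K K') x (g : hom x (as_mf K n)) y :
  as_mn f y ∘ extend ad g y = extend ad (K := as_mf K') (as_mn f n ∘ g) y.
Proof.
have hK := mf_ax (as_mf K); have hK' := mf_ax (as_mf K').
apply: (extend_uniq (ad := ad) hK' (mn_comp (extend_mn ad g hK) (mn_ax (as_mn f)))
  (extend_mn ad _ hK')).
by rewrite -comp_assoc !extend_in.
Qed.

Lemma trace_family_is_family : is_family trace_family.
Proof.
split=> [K d c t t' h|K K' f t t' h].
  rewrite (@trace_familyE K t' (\sum_i c i *: select (t i))).
    rewrite -[LHS]/(mk_linear (@trace_lin K) _) linear_sum; apply: eq_bigr => i _.
    by rewrite linearZ.
  move=> v; rewrite h comp_sumr linear_sum; apply: eq_bigr => i _.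
  by rewrite compZr linearZ /= -selectE.
rewrite (@trace_familyE K' t' (as_mn f n ∘ select t)).
  by apply: modNat_ext => y /=; rewrite comp_assoc extend_dual.
by move=> v; rewrite h selectE /= comp_assoc.
Qed.

Let W : dual M := to_dual tC exM (rk1_mf hU p).
Let WW : dual M := to_dual tC exM (pm_comp_mf (rk1_mf hU p) (rk1_mf hU p)).
Let d1 : hom W WW :=
  to_hom (K := W) (K' := WW) (mn_idl (mn_whr (rk1 U p) e_mn)).
Let d2 : hom W WW :=
  to_hom (K := W) (K' := WW) (mn_idr (mn_whl (mf_str_nat (rk1_mf hU p)) e_mn)).

Lemma dual_subE K K' (a b : hom K K') y : as_mn (a - b) y = as_mn a y - as_mn b y.
Proof. by rewrite -(scaleN1r (as_mn b y)). Qed.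

(** Naturality of [e] says that [d1 - d2] kills [e], so [datum_kill] applies once the constraint of
    [rk1 U p] brings the target [WW] to rank-one form. *)
Lemma d12_kill (v : hom WW one) :
  lam ((as_mn v n ∘ (as_mn d1 n - as_mn d2 n)) ∘ rk1_in ad p) = 0.
Proof.
have hW := rk1_mf hU p; have [si _ _ _] := hW.
have h1 := mn_whr U (str_mn p hW).
have {}h1 := mn_assocl h1.
have h2 := mn_inv h1 (fun y => si (U y) p).
have hd := mn_comp (mn_ax (as_mn (d1 - d2))) h1.
have hv := mn_comp h2 (mn_ax (as_mn v)).
have k0 y : pm_str (rk1 U p) (U y) p ∘ as_mn (d1 - d2) y ∘ e y = 0.
  rewrite -comp_assoc.
  suff -> : as_mn (d1 - d2) y ∘ e y = 0 by rewrite comp0r.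
  by rewrite dual_subE compBl; have /= -> := e_mn.1 _ _ (e y); rewrite subrr.
rewrite -[RHS](datum_kill hd k0 hv); congr (lam _).
rewrite -dual_subE -(comp_assoc (as_mn v n) (inv _)) -(comp_assoc (pm_str _ _ _)) invK; last exact: si.
by rewrite -comp_assoc.
Qed.

(** The component of any family at the tautological functional equalizes [d1] and [d2]: their
    difference sends that functional to zero. *)
Lemma d12_family X q : is_family (x := X) q -> (d1 - d2) ∘
  q W (eval_at lam (K := W) (rk1_in ad p)) = 0.
Proof.
move=> qf; have l : linear (fun v : hom WW one =>
    eval_at lam (K := W) (rk1_in ad p) (v ∘ (d1 - d2))).
  by move=> a u v; rewrite compDl compZl linearP.
rewrite (qf.2 W WW (d1 - d2) _ (mk_linear l)) //.
apply: family0 qf _ => v; rewrite -[RHS](d12_kill v).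
by rewrite -dual_subE.
Qed.

Theorem datum_universal : universal_family (x := one) trace_family.
Proof.
split; first exact: trace_family_is_family.
move=> X q qf; pose t0 := eval_at lam (K := W) (rk1_in ad p).
have q0 y : e (U y ▷ p) ∘ as_mn (q W t0) y = (fmap U (e y) ▶ idm p) ∘ as_mn (q W t0) y.
  have /(congr1 (fun a => as_mn a y)) h := d12_family qf.
  apply/eqP; rewrite -subr_eq0 -compBl; apply/eqP; rewrite -[RHS]h.
  exact: (congr1 (fun z => z ∘ as_mn (q W t0) y) (esym (dual_subE d1 d2 y))).
(* The component of [q] at [rk1 U p] lies in the equalizer, and so factors through [e]. All other
   components follow, every functional being pulled from this one by [extend]. *)
pose h y := projT1 (cid (datum_cobar (q0 y))).
have hE y : e y ∘ h y = as_mn (q W t0) y by rewrite /h; case: cid.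
have h_mn : @is_modNat _ _ _ _ (as_mf X) (id_mf M) h.
  apply: (@mn_lift _ _ M M (as_mf X) (id_pm M) (rk1 U p) e (as_mn (q W t0)) h _ _ hE) => //.
  - exact: datum_unit_mono.
  - move=> c y; have [_ /(_ c) [lc _] _] := exM.1.
    exact: (left_exact_mono abM lc (@datum_unit_mono y)).
  - exact: mn_ax (as_mn (q W t0)).
exists (to_hom (K' := one) h_mn); split.
  move=> K t; have hK := mf_ax (as_mf K).
  pose f : hom W K := to_hom (K := W) (extend_mn ad (select t) hK).
  rewrite -(qf.2 W K f t0); last by move=> v; rewrite selectE /= -comp_assoc extend_in.
  by apply: modNat_ext => y /=; rewrite -[RHS]comp_assoc hE.
move=> h' eh'; apply: modNat_ext => y /=; apply: (@datum_unit_mono y).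
have tE : as_mn (trace_family t0) y = e y.
  rewrite (@trace_familyE W t0 (rk1_in ad p)) //= -[RHS]comp_idl; congr (_ ∘ _).
  apply: (extend_uniq (ad := ad) (rk1_mf hU p) (extend_mn ad _ (rk1_mf hU p)) (mn_id _)).
  by rewrite extend_in ?comp_idl //; apply: rk1_mf.
by rewrite hE -tE; exact: (congr1 (fun a => as_mn a y) (eh' W t0)).
Qed.

Theorem datum_distinguished : exists E : distinguished (dual M), do_ob E = one.
Proof.
pose T (y z : dual M) : copower (hom y (one : dual M)) z :=
  projT1 (cid (let: inhabits c := dual_copower tC exM y z in ex_intro (fun=> True) c I)).
exact: (universal_distinguished (fun K => dual_hom_fin_dim exM K one) T datum_universal).
Qed.

End Datum.

(** * Bimodule structures of the adjoints of [F] *)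

Section Mate.
Variables (k : fieldType) (C : monCat k) (N M : modCat C).
Variables (A : premodFunctor N M) (U : premodFunctor M N) (ad : madj A U).
Variables (S : premodFunctor N N) (T : premodFunctor M M).
Hypotheses (hU : is_modFunctor U) (hT : is_modFunctor T).
Variable sg : forall x, hom (A (S x)) (T (A x)).
Hypothesis hsg : @is_modNat _ _ _ _ (comp_pm A S) (comp_pm T A) sg.

(** Used to show that the right [C]-actions on [R] and [RR] are compatible with the left ones: they
    are mates of the transformations [inv (mu F x c)], and taking mates preserves compatibility with
    the constraints. *)
Lemma mate_mn : @is_modNat _ _ _ _ (comp_pm S U) (comp_pm U T)
  (fun y => fmap U (fmap T (co ad y) ∘ sg (U y)) ∘ un ad (S (U y))).
Proof.
have [h1n h1s] := un_mn ad; have [h2n h2s] := hsg.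
have [h3n h3s] := mn_whl (mf_str_nat hT) (co_mn ad).
have sU := mf_str_nat hU.
split=> [x y f|c y] /=.
  have /= e1 := h1n _ _ (fmap S (fmap U f)); rewrite -[RHS]comp_assoc -e1.
  rewrite !comp_assoc -!fmap_comp; congr (fmap U _ ∘ _); rewrite -comp_assoc.
  have /= <- := h2n _ _ (fmap U f); rewrite !comp_assoc; congr (_ ∘ _).
  exact: h3n _ _ f.
have /= e1 := h1s c (S (U y)); have /= e2 := h2s c (U y); have /= e3 := h3s c y.
rewrite fmap_id comp_idr in e3; rewrite comp_idr in e1.
have /= n1 := h1n _ _ (pm_str S c (U y) ∘ fmap S (pm_str U c y)).
set w := pm_str S c (U y) ∘ _ in n1 *.
have key : pm_str T c y ∘ (fmap T (co ad (c ▷ y)) ∘ sg (U (c ▷ y))) =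
    (idm c ▶ (fmap T (co ad y) ∘ sg (U y))) ∘ (pm_str A c (S (U y)) ∘ fmap A w).
  have /= n2 := h2n _ _ (pm_str U c y).
  rewrite comp_assoc e3 act_compr fmap_comp -!comp_assoc n2; congr (_ ∘ _).
  by rewrite 2!comp_assoc e2 /w fmap_comp !comp_assoc.
rewrite act_compr -comp_assoc -e1 -!comp_assoc -n1.
rewrite (comp_assoc (fmap U (pm_str T c y))) -fmap_comp key.
by rewrite 2!fmap_comp !comp_assoc -sU -!comp_assoc.
Qed.

End Mate.

Section TensorFunctor.
Variables (k : fieldType) (C D : monCat k) (F : monFunctor C D).

Definition fun_pm : premodFunctor (reg C) (twist F (reg D)) :=
  @PremodFunctor _ C (reg C) (twist F (reg D)) F (fun c d => inv (mu F c d)).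

Lemma fun_pm_mf : is_modFunctor fun_pm.
Proof.
have i := mu_iso F; have j := eps_iso F; split=> /= [c m|c c' m m' f g|c d m|m].
- exact/is_iso_inv/i.
- by rewrite mu_inv_nat.
- by rewrite fmap_id mu_inv_assoc.
- have e := mu_lunit F m; rewrite -e -!comp_assoc.
  rewrite (comp_assoc (eps F ⊠ _)) -tens_compl invR // tensm_id comp_idl.
  by rewrite invR ?comp_idr.
Qed.

Program Definition rev_fun : monFunctor (rev C) (rev D) :=
  @MonFunctor k (rev C) (rev D)
    (mon_fun F : functor (rev C) (rev D))
    (fun x y => mu F y x) (eps F) _ _ _ _ _ _.
Next Obligation. exact: mu_iso. Qed.
Next Obligation. exact: eps_iso. Qed.
Next Obligation. exact: mu_nat. Qed.
Next Obligation.
have i := assoc_iso z y x; have j := assoc_iso (F z) (F y) (F x).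
apply: (iso_epi j); rewrite -!comp_assoc invL // comp_idr fmap_inv //.
apply: (iso_mono (is_iso_fmap F i)); rewrite invKV; last exact: is_iso_fmap.
by rewrite comp_assoc -mu_assoc !comp_assoc.
Qed.
Next Obligation. exact: mu_runit. Qed.
Next Obligation. exact: mu_lunit. Qed.

End TensorFunctor.

Section Bimodule.
Variables (k : fieldType) (C D : monCat k) (F : monFunctor C D) (rC : is_rigid C).
Variables (R : functor D C) (adj : adjunction F R).
Variables (RR : functor C D) (adj' : adjunction R RR).

Definition ra_fun : premodFunctor (twist F (reg D)) (reg C) :=
  ra_pm (A := fun_pm F) (adj : adjunction (fun_pm F) R).
Lemma ra_fun_mf : is_modFunctor ra_fun.
Proof. exact: (ra_pm_mf (fun_pm_mf F) _ rC). Qed.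
Definition ra_fun_madj : madj (fun_pm F) ra_fun := ra_madj (fun_pm_mf F) _ rC.

Definition rra_fun : premodFunctor (reg C) (twist F (reg D)) :=
  ra_pm (A := ra_fun) (adj' : adjunction ra_fun RR).
Lemma rra_fun_mf : is_modFunctor rra_fun.
Proof. exact: (ra_pm_mf ra_fun_mf _ rC). Qed.
Definition rra_fun_madj : madj ra_fun rra_fun := ra_madj ra_fun_mf _ rC.

(** Identifies the bimodule structure of the definitions with the lax structure of an adjoint, which
    is where its invertibility comes from. *)
Lemma ra_leftE c d : ra_left adj c d = ra_lax (A := fun_pm F) adj c d.
Proof. by rewrite ra_lax_def /= fmap_id. Qed.
Lemma rra_leftE c x : rra_left adj adj' c x = ra_lax (A := ra_fun) adj' c x.
Proof. by rewrite ra_lax_def /rra_left ra_leftE. Qed.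

Lemma ra_left_iso c d : is_iso (ra_left adj c d).
Proof. by rewrite ra_leftE; apply: (ra_lax_iso (fun_pm_mf F) _ rC). Qed.
Lemma rra_left_iso c x : is_iso (rra_left adj adj' c x).
Proof. by rewrite rra_leftE; apply: (ra_lax_iso ra_fun_mf _ rC). Qed.

End Bimodule.

Section RightStructure.
Variables (k : fieldType) (C D : monCat k) (F : monFunctor C D) (rC : is_rigid C).
Variables (R : functor D C) (adj : adjunction F R).
Variables (RR : functor C D) (adj' : adjunction R RR).

Let rrC := rev_rigid rC.
Let revF := rev_fun F.
Let adjr : adjunction revF (R : functor (rev D) (rev C)) := adj.
Let adjr' : adjunction (R : functor (rev D) (rev C)) (RR : functor (rev C) (rev D)) := adj'.

(** The right structure is by computation the left structure of the reversed functor. *)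
Lemma ra_rightE d c : ra_right adj d c = ra_left adjr c d.
Proof. by []. Qed.
Lemma rra_rightE x c : rra_right adj adj' x c = rra_left adjr adjr' c x.
Proof. by []. Qed.

Lemma ra_right_iso d c : is_iso (ra_right adj d c).
Proof. by rewrite ra_rightE; have h := ra_left_iso rrC adjr c d. Qed.
Lemma rra_right_iso x c : is_iso (rra_right adj adj' x c).
Proof. by rewrite rra_rightE; have h := rra_left_iso rrC adjr adjr' c x. Qed.

Lemma rra_right_nat x x' c c' (f : hom x x') (g : hom c c') :
  rra_right adj adj' x' c' ∘ (fmap RR f ⊠ fmap F g) = fmap RR (f ⊠ g) ∘ rra_right adj adj' x c.
Proof.
rewrite !rra_rightE !rra_leftE.
exact: (ra_lax_nat (ra_fun_mf rrC adjr) (adjr' : adjunction (ra_fun adjr) _) g f).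
Qed.

Lemma rra_right_assoc x b c :
  rra_right adj adj' x (b ⊗ c) ∘ (idm (RR x) ⊠ mu F b c) ∘ assoc (RR x) (F b) (F c) =
  fmap RR (assoc x b c) ∘ rra_right adj adj' (x ⊗ b) c ∘ (rra_right adj adj' x b ⊠ idm (F c)).
Proof.
have i := assoc_iso (RR x) (F b) (F c); have j := assoc_iso x b c; have m := mu_iso F b c.
have e := ra_lax_assoc (ra_fun_mf rrC adjr) (adjr' : adjunction (ra_fun adjr) _) c b x.
rewrite -!rra_leftE -!rra_rightE /= in e.
rewrite fmap_id fmap_inv // in e.
have {}e := congr1 (comp (fmap RR (assoc x b c))) e.
rewrite (invKV _ (is_iso_fmap RR j)) in e.
have mi : (idm (RR x) ⊠ inv (mu F b c)) ∘ (idm (RR x) ⊠ mu F b c) = idm (RR x ⊗ (F b ⊗ F c)).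
  by rewrite -tens_compr invL // tensm_id.
rewrite -e -!comp_assoc (comp_assoc (idm (RR x) ⊠ inv _)) mi comp_idl invL //.
by rewrite comp_idr !comp_assoc.
Qed.

Lemma unit_right d c :
  fmap RR (ra_right adj d c) ∘ rra_right adj adj' (R d) c ∘ (adj_unit adj' d ⊠ idm (F c))
  = adj_unit adj' (d ⊗ F c).
Proof.
have e := (un_mn (rra_fun_madj rrC adjr adjr')).2 c d.
move: e; rewrite /= -rra_leftE -ra_leftE -rra_rightE -ra_rightE comp_idr fmap_id => e.
have i := rra_right_iso (R d) c; have j := ra_right_iso d c.
have {}e := congr1 (comp (rra_right adj adj' (R d) c)) e.
rewrite -comp_assoc invKV // in e.
rewrite -comp_assoc -e fmap_inv // invKV //; exact: is_iso_fmap.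
Qed.

(* The two descriptions of the lax monoidal structure of [R]. *)
Lemma ra_lax_mon d e :
  fmap R (idm d ⊠ adj_counit adj e) ∘ ra_right adj d (R e) =
  fmap R (adj_counit adj d ⊠ idm e) ∘ ra_left adj (R d) e.
Proof.
rewrite /ra_right /ra_left !comp_assoc -!fmap_comp !comp_assoc -!tensm_comp.
by rewrite !comp_idl !comp_idr.
Qed.

Lemma fun_right_mn c : @is_modNat _ _ _ _ (comp_pm (fun_pm F) (free (M := reg C) c))
  (comp_pm (pull_pm F (free (M := reg D) (F c))) (fun_pm F)) (fun x => inv (mu F x c)).
Proof.
split=> [x y f|b x] /=.
  by have := mu_inv_nat F f (idm c); rewrite fmap_id.
by rewrite fmap_id !comp_assoc -mu_inv_assoc.
Qed.

Lemma pull_mf (M N : modCat D) (H : premodFunctor M N) :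
  is_modFunctor H -> is_modFunctor (pull_pm F H).
Proof.
case=> Hi Hn Ha Hu; split=> /= [c m|c c' m m' f g|c d m|m].
- exact: Hi.
- exact: Hn.
- have e := Hn _ _ _ _ (inv (mu F c d)) (idm m); rewrite fmap_id in e.
  by rewrite fmap_id -comp_assoc -e fmap_comp !comp_assoc Ha.
- have e := Hn _ _ _ _ (inv (eps F)) (idm m); rewrite fmap_id in e.
  by rewrite -comp_assoc -e fmap_comp comp_assoc Hu.
Qed.

Lemma ra_right_mn c : @is_modNat _ _ _ _ (comp_pm (free (M := reg C) c) (ra_fun adj))
  (comp_pm (ra_fun adj) (pull_pm F (free (M := reg D) (F c)))) (fun d => ra_right adj d c).
Proof.
apply: mn_ext (mate_mn (ra_fun_madj rC adj) (ra_fun_mf rC adj)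
  (pull_mf (free_mf (M := reg D) (F c))) (fun_right_mn c)) => d.
by [].
Qed.

Lemma rra_right_mn c : @is_modNat _ _ _ _
  (comp_pm (pull_pm F (free (M := reg D) (F c))) (rra_fun adj adj'))
  (comp_pm (rra_fun adj adj') (free (M := reg C) c)) (fun x => rra_right adj adj' x c).
Proof.
have h := mn_inv (ra_right_mn c) (fun d => ra_right_iso d c).
apply: mn_ext (mate_mn (rra_fun_madj rC adj adj') (rra_fun_mf rC adj adj')
  (free_mf (M := reg C) c) h) => x.
by [].
Qed.

(** The two actions commute because [rra_right] at fixed [c] is a transformation of left module
    functors. *)
Lemma rra_left_right b x c :
  rra_left adj adj' b (x ⊗ c) ∘ (idm (F b) ⊠ rra_right adj adj' x c)
    ∘ assoc (F b) (RR x) (F c) =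
  fmap RR (assoc b x c) ∘ rra_right adj adj' (b ⊗ x) c ∘ (rra_left adj adj' b x ⊠ idm (F c)).
Proof.
have i := rra_left_iso rC adj adj' b (x ⊗ c); have j := rra_left_iso rC adj adj' b x.
have /= e := (rra_right_mn c).2 b x.
rewrite -!rra_leftE fmap_id in e.
move: e i j; move: (rra_left _ _ _ _) (rra_left _ _ _ _) (rra_right _ _ _ _) (rra_right _ _ _ _).
move=> l' l q q' e i j.
have {}e := congr1 (comp l) e; rewrite -!comp_assoc invKV // in e.
rewrite e -!comp_assoc -tens_compl invL // tensm_id comp_idr.
by [].
Qed.

Definition chi_iso c : hom (chi RR ⊗ F c) (RR c) :=
  fmap RR (lunit c) ∘ rra_right adj adj' one c.

Lemma chi_iso_iso c : is_iso (chi_iso c).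
Proof.
by apply: is_iso_comp; [apply/is_iso_fmap/lunit_iso | apply: rra_right_iso].
Qed.

Lemma chi_iso_nat c c' (f : hom c c') :
  chi_iso c' ∘ (idm (chi RR) ⊠ fmap F f) = fmap RR f ∘ chi_iso c.
Proof.
have := rra_right_nat (idm one) f; rewrite fmap_id => e.
by rewrite /chi_iso -comp_assoc e !comp_assoc -!fmap_comp lunit_nat.
Qed.

Lemma chi_iso_tens b c :
  chi_iso (b ⊗ c) ∘ (idm (chi RR) ⊠ mu F b c) ∘ assoc (chi RR) (F b) (F c) =
  rra_right adj adj' b c ∘ (chi_iso b ⊠ idm (F c)).
Proof.
have e1 := rra_right_assoc one b c.
have e2 := rra_right_nat (lunit b) (idm c); rewrite fmap_id in e2.
rewrite /chi_iso; move: e1 e2; move: (rra_right adj adj' one (b ⊗ c))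
  (rra_right adj adj' one b) (rra_right adj adj' (one ⊗ b) c) (rra_right adj adj' b c).
move=> r1 r2 r3 r4 e1 e2; rewrite -!comp_assoc; rewrite -!comp_assoc in e1.
rewrite e1 (comp_assoc (fmap RR (lunit _))) -fmap_comp lunit_tens (comp_assoc (fmap RR _)) -e2.
by rewrite tens_compl !comp_assoc.
Qed.

Lemma chi_braid_left b :
  rra_left adj adj' b one ∘ chi_braid adj adj' b = fmap RR (inv (runit b)) ∘ chi_iso b.
Proof.
rewrite /chi_braid /chi_iso; move: (rra_left_iso rC adj adj' b one).
by move: (rra_left _ _ _ _) (rra_right _ _ _ _) => l r i; rewrite -!comp_assoc invKV.
Qed.

(** The half-braiding is defined so that [chi_iso], from [χ ⊗ F (-)] to [RR], respects the left
    actions. The proof reduces to [rra_left_right] at the unit and the triangle axiom. *)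
Lemma chi_iso_left b c :
  rra_left adj adj' b c ∘ (idm (F b) ⊠ chi_iso c) ∘ assoc (F b) (chi RR) (F c)
    ∘ (chi_braid adj adj' b ⊠ idm (F c)) =
  rra_right adj adj' b c ∘ (chi_iso b ⊠ idm (F c)).
Proof.
have ln : rra_left adj adj' b c ∘ (idm (F b) ⊠ fmap RR (lunit c)) =
    fmap RR (idm b ⊠ lunit c) ∘ rra_left adj adj' b (one ⊗ c).
  rewrite !rra_leftE; have := ra_lax_nat (ra_fun_mf rC adj)
    (adj' : adjunction (ra_fun adj) _) (idm b) (lunit c).
  by rewrite /= fmap_id.
have e1 := rra_left_right b one c; have e2 := chi_braid_left b.
have e3 := rra_right_nat (inv (runit b)) (idm c); rewrite fmap_id in e3.
have e4 := mon_triangle b c; have i := runit_iso b.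
rewrite [X in idm _ ⊠ X]/chi_iso; move: ln e1 e2 e3.
move: (rra_left adj adj' b c) (rra_left adj adj' b (one ⊗ c)) (rra_left adj adj' b one)
  (rra_right adj adj' one c) (rra_right adj adj' (b ⊗ one) c) (rra_right adj adj' b c)
  (chi_braid adj adj' b) (chi_iso b).
move=> l1 l2 l3 r1 r2 r3 s t ln e1 e2 e3.
rewrite tens_compr -!comp_assoc (comp_assoc l1) ln -!comp_assoc; rewrite -!comp_assoc in e1.
rewrite (comp_assoc (idm _ ⊠ r1)) (comp_assoc l2) e1.
rewrite -!comp_assoc (comp_assoc (fmap RR _)) -fmap_comp e4 -tens_compl e2.
rewrite tens_compl (comp_assoc r2) e3 -!comp_assoc (comp_assoc (fmap RR _)) -fmap_comp.
by rewrite -tens_compl invR // tensm_id fmap_id comp_idl.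
Qed.

End RightStructure.

(** * The action of the relative modular object *)

Section ChiModule.
Variables (k : fieldType) (C D : monCat k) (F : monFunctor C D) (rC : is_rigid C).
Variables (R : functor D C) (adj : adjunction F R).
Variables (RR : functor C D) (adj' : adjunction R RR) (M : modCat D).

Definition chi_act_iso c (x : M) : hom (chi RR ▷ (F c ▷ x)) (RR c ▷ x) :=
  (chi_iso adj adj' c ▶ idm x) ∘ inv (massoc (chi RR) (F c) x).

Lemma chi_act_iso_iso c x : is_iso (chi_act_iso c x).
Proof.
by apply: is_iso_comp; [apply/iso_actl/chi_iso_iso | apply/is_iso_inv/massoc_iso].
Qed.

Lemma chi_act_iso_nat c x x' (f : hom x x') :
  chi_act_iso c x' ∘ (idm (chi RR) ▶ (idm (F c) ▶ f)) = (idm (RR c) ▶ f) ∘ chi_act_iso c x.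
Proof.
rewrite /chi_act_iso -comp_assoc inv_massoc_nat tensm_id !comp_assoc.
by rewrite -act_swap.
Qed.

Lemma chi_act_iso_natl c c' (f : hom c c') x :
  chi_act_iso c' x ∘ (idm (chi RR) ▶ (fmap F f ▶ idm x)) = (fmap RR f ▶ idm x) ∘ chi_act_iso c x.
Proof.
rewrite /chi_act_iso -comp_assoc inv_massoc_nat !comp_assoc.
by rewrite -!act_compl chi_iso_nat.
Qed.

Lemma chi_act_iso_massoc b c (x : M) :
  chi_act_iso (b ⊗ c) x ∘ (idm (chi RR) ▶ ((mu F b c ▶ idm x) ∘ inv (massoc (F b) (F c) x))) =
  (rra_right adj adj' b c ▶ idm x) ∘ inv (massoc (RR b) (F c) x) ∘ chi_act_iso b (F c ▷ x).
Proof.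
have i u v w := @massoc_iso k D M u v w.
have e := chi_iso_tens rC adj adj' b c.
have n := inv_massoc_nat (chi_iso adj adj' b) (idm (F c)) (idm x); rewrite actm_id in n.
rewrite /chi_act_iso; move: e n; move: (chi_iso _ _ _) (chi_iso _ _ _) (rra_right _ _ _ _).
move=> s t q e n; rewrite act_compr -!comp_assoc (comp_assoc (inv _)) inv_massoc_nat.
rewrite [in RHS](comp_assoc (inv _)) n !comp_assoc -!act_compl -e -!comp_assoc.
by rewrite -mod_pentagon_inv (comp_assoc ((t ∘ _) ▶ _)) -act_compl -!comp_assoc.
Qed.

Lemma chi_act_iso_mn (x : M) : @is_modNat _ _ _ _
  (comp_pm (chi_act adj adj' M) (free (M := twist F M) x))
  (comp_pm (pull_pm F (free x)) (rra_fun adj adj')) (fun c => chi_act_iso c x).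
Proof.
have i u v w := @massoc_iso k D M u v w.
split=> [c d f|b c] /=; first by rewrite chi_act_iso_natl.
rewrite -rra_leftE fmap_id.
have e := chi_iso_left rC adj adj' b c; have et := chi_iso_tens rC adj adj' b c.
have il := rra_left_iso rC adj adj' b c; have m := mu_iso F b c.
rewrite -et in e.
have {}e : inv (rra_left adj adj' b c) ∘ chi_iso adj adj' (b ⊗ c) =
    (idm (F b) ⊠ chi_iso adj adj' c) ∘ assoc (F b) (chi RR) (F c)
    ∘ (chi_braid adj adj' b ⊠ idm (F c)) ∘ inv (assoc (chi RR) (F b) (F c))
    ∘ (idm (chi RR) ⊠ inv (mu F b c)).
  move: il e; move: (rra_left _ _ _ _) (chi_iso _ _ _) (chi_iso _ _ _) (chi_braid _ _ _).
  move=> l s t q il e; apply: (iso_mono il); rewrite invKV // !comp_assoc e.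
  rewrite -!comp_assoc invKV; last exact: assoc_iso.
  by rewrite -tens_compr invR // tensm_id comp_idr.
rewrite /chi_act_iso; move: e; move: (rra_left _ _ _ _) (chi_iso _ _ _) (chi_iso _ _ _) (chi_braid _ _ _).
move=> l s t q e.
have n1 := massoc_nat (idm (F b)) s (idm x).
have n2 := inv_massoc_nat q (idm (F c)) (idm x); rewrite actm_id in n2.
have n4 := inv_massoc_nat (idm (chi RR)) (inv (mu F b c)) (idm x).
have p1 : (idm (F b) ▶ inv (massoc (chi RR) (F c) x)) ∘ massoc (F b) (chi RR) (F c ▷ x) =
    massoc (F b) (chi RR ⊗ F c) x ∘ ((assoc (F b) (chi RR) (F c) ▶ idm x)
    ∘ inv (massoc (F b ⊗ chi RR) (F c) x)).
  rewrite -inv_actr //; apply: (iso_mono (iso_actr (F b) (i (chi RR) (F c) x))).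
  rewrite invKV; last exact: iso_actr.
  apply: (iso_epi (i (F b ⊗ chi RR) (F c) x)); rewrite mod_pentagon -!comp_assoc.
  by rewrite invL // comp_idr.
have p3 : inv (massoc (chi RR ⊗ F b) (F c) x) ∘ (inv (massoc (chi RR) (F b) (F c ▷ x))
      ∘ (idm (chi RR) ▶ massoc (F b) (F c) x)) =
    (inv (assoc (chi RR) (F b) (F c)) ▶ idm x) ∘ inv (massoc (chi RR) (F b ⊗ F c) x).
  have ia := assoc_iso (chi RR) (F b) (F c).
  apply: (iso_mono (iso_actl x ia)).
  rewrite (comp_assoc (inv (massoc (chi RR ⊗ F b) _ _))) comp_assoc mod_pentagon_inv.
  rewrite -comp_assoc -act_compr invL // actm_id comp_idr comp_assoc -act_compl invR //.
  by rewrite actm_id comp_idl.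
rewrite -comp_assoc (comp_assoc (inv l ▶ _)) -act_compl e !act_compl !act_compr.
rewrite !comp_assoc n1 -!comp_assoc -n4 (comp_assoc (inv (assoc _ _ _) ▶ _)) -p3.
rewrite -!comp_assoc (comp_assoc (_ ▶ inv _)) p1 -!comp_assoc.
by rewrite [in RHS](comp_assoc _ (q ▶ _)) n2 -!comp_assoc.
Qed.

End ChiModule.

(** * Frobenius data of twisted module categories *)

Section Pull.
Variables (k : fieldType) (C D : monCat k) (F : monFunctor C D).

Lemma pull_mn (M N : modCat D) (H K : premodFunctor M N) a :
  @is_modNat _ _ _ _ H K a -> @is_modNat _ _ _ _ (pull_pm F H) (pull_pm F K) a.
Proof. by move=> [an am]; split=> [x y f|c m] /=; [apply: an | rewrite fmap_id am]. Qed.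

Program Definition pull_madj (M N : modCat D) (A : premodFunctor N M)
    (U : premodFunctor M N) (ad : madj A U) : madj (pull_pm F A) (pull_pm F U) :=
  @Madj _ _ _ _ (pull_pm F A) (pull_pm F U) (un ad) (co ad) _ _ (triL ad) (triR ad).
Next Obligation. exact: pull_mn (un_mn ad). Qed.
Next Obligation. exact: pull_mn (co_mn ad). Qed.

(** Perfectness enters here: a functor with exact right adjoint preserves projectives. *)
Lemma twist_exact (M : modCat D) : is_rigid C -> is_exact F ->
  (exists R : functor D C, right_exact R /\ inhabited (adjunction F R)) -> is_abelian D ->
  exact_module M -> exact_module (twist F M).
Proof.
move=> rC [lF rF] [R [rR [adj]]] abD [[fM eM eM'] pM]; split.
  split=> // [c|m]; first exact: act_by_exact.
  split=> [z x y i f /lF hi|x y z q f /rF hq]; first exact: (eM' m).1 _ _ _ _ _ hi.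
  exact: (eM' m).2 _ _ _ _ _ hq.
by move=> p m pp; apply: pM; apply: (ladj_projective adj).
Qed.

End Pull.

(** Pastes three commuting squares side by side. *)
Lemma ladder (k : fieldType) (A : linCat k) (a0 a1 a2 a3 b0 b1 b2 b3 z : A)
    (t0 : hom a0 b0) (t1 : hom a1 b1) (t2 : hom a2 b2) (t3 : hom a3 b3)
    (c1 : hom a2 a3) (c2 : hom a1 a2) (c3 : hom a0 a1)
    (d1 : hom b2 b3) (d2 : hom b1 b2) (d3 : hom b0 b1) (h : hom z b0) :
  t3 ∘ c1 = d1 ∘ t2 -> t2 ∘ c2 = d2 ∘ t1 -> t1 ∘ c3 = d3 ∘ t0 -> is_iso t0 ->
  t3 ∘ (c1 ∘ (c2 ∘ c3)) ∘ (inv t0 ∘ h) = d1 ∘ d2 ∘ d3 ∘ h.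
Proof.
move=> e1 e2 e3 i; rewrite !comp_assoc e1 -(comp_assoc d1) e2 -!comp_assoc.
by rewrite (comp_assoc t1) e3 -comp_assoc invKV.
Qed.

(** * The unit of the twisted internal hom *)

Section ChiDatum.
Variables (k : fieldType) (C D : monCat k) (F : monFunctor C D).
Hypotheses (rC : is_rigid C).
Variables (R : functor D C) (adj : adjunction F R).
Variables (RR : functor C D) (adj' : adjunction R RR).
Variables (M : modCat D) (n p : M) (lam : {linear hom p n -> k^o}).
Variables (U : premodFunctor M (reg D)) (hU : is_modFunctor U) (ad : madj (free n) U).
Variable e : forall y, hom y (rk1 U p y).
Hypothesis fe : frob_datum lam ad e.

Definition tw_hom : premodFunctor (twist F M) (reg C) :=
  comp_pm (ra_fun adj) (pull_pm F U).

Lemma tw_hom_mf : is_modFunctor tw_hom.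
Proof. exact: pm_comp_mf (ra_fun_mf rC adj) (pull_mf F hU). Qed.

Definition tw_madj : madj (free (M := twist F M) n) tw_hom :=
  let X := madj_comp (ra_fun_mf rC adj) (pull_mf F (free_mf n)) (ra_fun_madj rC adj)
    (pull_madj F ad) in
  @Madj _ C (reg C) (twist F M) (free (M := twist F M) n) tw_hom (un X) (co X) (un_mn X) (co_mn X)
    (triL X) (triR X).

Lemma tw_co y : co tw_madj y = co ad y ∘ (adj_counit adj (U y) ▶ idm n).
Proof. by []. Qed.

(* Multiplications [U y ⊗ U n -> U y]: composition of internal homs. *)
Let m y : hom (U y ⊗ U n) (U y) := fmap U (co ad y) ∘ inv (pm_str U (U y) n).
Let mC y : hom (R (U y) ⊗ R (U n)) (R (U y)) :=
  fmap tw_hom (co tw_madj y) ∘ inv (pm_str tw_hom (R (U y)) n).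

(** Composition of twisted internal homs is that of [U] through the lax monoidal structure of [R].
    Of its two descriptions, the one by the right action is chosen, since [unit_right] carries it
    across the unit of [R ⊣ RR]. *)
Lemma tw_mult y : mC y =
  fmap R (m y ∘ (idm (U y) ⊠ adj_counit adj (U n))) ∘ ra_right adj (U y) (R (U n)).
Proof.
have [si sn _ _] := hU.
have e1 := sn _ _ _ _ (adj_counit adj (U y)) (idm n); rewrite fmap_id /= in e1.
have e2 := ra_lax_mon adj (U y) (U n).
have il := ra_left_iso rC adj (R (U y)) (U n).
rewrite fmap_comp -comp_assoc e2 comp_assoc -fmap_comp /mC /= -ra_leftE.
rewrite inv_comp; [| exact: is_iso_inv | exact/is_iso_fmap/si].
rewrite inv_inv // -fmap_inv; last exact: si.
rewrite comp_assoc -fmap_comp; congr (fmap R _ ∘ _).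
rewrite fmap_comp /m -!comp_assoc; congr (_ ∘ _).
apply: (iso_mono (si (U y) n)); rewrite comp_assoc e1 -comp_assoc invR ?comp_idr ?invKV //.
Qed.

(** The unit of [R ⊣ RR] acting on [z], rewritten through [RR c ▷ z ≅ χ ▷ (F c ▷ z)]. *)
Definition chi_unit (z y : M) : hom (U y ▷ z) (chi RR ▷ (F (R (U y)) ▷ z)) :=
  inv (chi_act_iso adj adj' (R (U y)) z) ∘ (adj_unit adj' (U y) ▶ idm z).

Lemma chi_unit_natr y z z' (g : hom z z') :
  (idm (chi RR) ▶ (idm (F (R (U y))) ▶ g)) ∘ chi_unit z y = chi_unit z' y ∘ (idm (U y) ▶ g).
Proof.
have iT b (w : M) := chi_act_iso_iso rC adj adj' b w.
apply: (iso_mono (iT (R (U y)) z')); rewrite comp_assoc chi_act_iso_nat /chi_unit.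
by rewrite -(comp_assoc (inv _)) invKV // -act_swap -comp_assoc invKV.
Qed.

Section Key.
Variables (x : M) (f : forall y : M, hom (F (R (U y)) ▷ p) (F (R (U y)) ▷ x)).
Hypothesis hf : @is_modNat _ C (twist F M) (twist F M) (rk1 tw_hom p) (rk1 tw_hom x) f.
Let fh : hom p (F (R (U n)) ▷ x) := f n ∘ rk1_in tw_madj p.

Lemma tw_expand y : f y = (fmap F (mC y) ▶ idm x) ∘
  (((mu F (R (U y)) (R (U n)) ▶ idm x) ∘ inv (massoc (F (R (U y))) (F (R (U n))) x))
   ∘ (idm (F (R (U y))) ▶ fh)).
Proof.
have hW := rk1_mf tw_hom_mf x; have [si _ _ _] := tw_hom_mf.
have E : f y = extend tw_madj (K := rk1 tw_hom x) fh y.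
  apply: (extend_uniq (ad := tw_madj) hW hf (extend_mn tw_madj _ hW)).
  by rewrite extend_in.
have hS := si (R (U y)) n; have iM := massoc_iso (F (R (U y))) (F (R (U n))) x.
have imu := mu_iso F (R (U y)) (R (U n)).
have mE : fmap F (mC y) ▶ idm x = (fmap F (fmap tw_hom (co tw_madj y)) ▶ idm x) ∘
    inv (fmap F (pm_str tw_hom (R (U y)) n) ▶ idm x).
  by rewrite /mC fmap_comp act_compl fmap_inv // inv_actl //; apply: is_iso_fmap.
have sE : pm_str (rk1 tw_hom x) (R (U y)) n = massoc (F (R (U y))) (F (R (U n))) x
    ∘ (inv (mu F (R (U y)) (R (U n))) ▶ idm x)
    ∘ (fmap F (pm_str tw_hom (R (U y)) n) ▶ idm x) by [].
have iT := iso_actl x (is_iso_fmap F hS); have iI := iso_actl x (is_iso_inv imu).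
rewrite E /extend sE inv_comp //; last exact: is_iso_comp.
rewrite (inv_comp iM iI) inv_actl ?inv_inv //; last exact: is_iso_inv.
rewrite mE -!comp_assoc; congr (_ ∘ (_ ∘ (_ ∘ (_ ∘ _)))).
by rewrite /= fmap_id.
Qed.

(** The datum for [e] cannot be applied to [f], which is only [C]-linear. [Lf] is the [D]-linear
    transformation with the generator of [f] pushed along the counit of [F ⊣ R]. *)
Let Lf := extend ad (K := rk1 U x) ((adj_counit adj (U n) ▶ idm x) ∘ fh).

Lemma tw_untwist y : Lf y = (m y ▶ idm x) ∘ ((idm (U y) ⊠ adj_counit adj (U n)) ▶ idm x)
  ∘ inv (massoc (U y) (F (R (U n))) x) ∘ (idm (U y) ▶ fh).
Proof.
have [si _ _ _] := hU; have iM := massoc_iso (U y) (U n) x.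
have iS := iso_actl x (si (U y) n).
have sE : pm_str (rk1 U x) (U y) n = massoc (U y) (U n) x ∘ (pm_str U (U y) n ▶ idm x) by [].
rewrite /Lf /extend sE inv_comp // inv_actl // act_compr -[in RHS]comp_assoc.
have nM := inv_massoc_nat (idm (U y)) (adj_counit adj (U n)) (idm x).
rewrite -!comp_assoc (comp_assoc (inv (massoc _ _ _)) (idm _ ▶ _)) nM.
by rewrite /m act_compl -!comp_assoc.
Qed.

(** Both transformations are a generator followed by a multiplication, by [tw_expand] and
    [tw_untwist], and [chi_unit] intertwines the two multiplications. *)
Lemma chi_unit_nat y : (idm (chi RR) ▶ f y) ∘ chi_unit p y = chi_unit x y ∘ Lf y.
Proof.
have iT b (z : M) := chi_act_iso_iso rC adj adj' b z.
have e1 := chi_act_iso_natl rC adj adj' (mC y) x.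
have e2 := chi_act_iso_massoc rC adj adj' (R (U y)) (R (U n)) x.
have e3 := chi_act_iso_nat adj adj' (R (U y)) fh.
have e4 : (fmap RR (mC y) ▶ idm x) ∘ ((rra_right adj adj' (R (U y)) (R (U n)) ▶ idm x)
  ∘ inv (massoc (RR (R (U y))) (F (R (U n))) x)) ∘ (idm (RR (R (U y))) ▶ fh)
  ∘ (adj_unit adj' (U y) ▶ idm p) = (adj_unit adj' (U y) ▶ idm x) ∘ Lf y.
  have nM := inv_massoc_nat (adj_unit adj' (U y)) (idm (F (R (U n)))) (idm x).
  rewrite actm_id in nM; rewrite tw_untwist; move: (fh) => g.
  rewrite -!(comp_assoc _ (idm _ ▶ g)) act_swap !comp_assoc; congr (_ ∘ _).
  rewrite -(comp_assoc _ (inv _)) nM comp_assoc; congr (_ ∘ _).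
  rewrite -!act_compl tw_mult fmap_comp; congr (_ ▶ _).
  rewrite -(comp_assoc _ _ (rra_right _ _ _ _)) -(comp_assoc _ _ (_ ⊠ _)) unit_right //.
  by rewrite adj_unit_nat comp_assoc.
apply: (iso_mono (iT (R (U y)) x)).
rewrite tw_expand /chi_unit -(comp_assoc (inv _) _ (Lf y)) invKV // -e4.
rewrite act_compr (act_compr _ _ (_ ▶ fh)) comp_assoc; exact: ladder e1 e2 e3 (iT _ _).
Qed.

(** The [g] that [e] assigns to [Lf] works for [f]: the counit in the generator of [Lf] is the one
    in [tw_co], so both traces are equal. *)
Lemma chi_compat : exists g : hom p x,
  (forall y, (idm (chi RR) ▶ f y) ∘ (chi_unit p y ∘ e y) =
     (idm (chi RR) ▶ (idm (F (R (U y))) ▶ g)) ∘ (chi_unit p y ∘ e y)) /\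
  forall q : hom (x : twist F M) n,
    lam (co tw_madj n ∘ ((idm (tw_hom n) ▶ q) ∘ (f n ∘ rk1_in tw_madj p))) = lam (q ∘ g).
Proof.
have [_ _ tr] := fe; have hW := rk1_mf hU x.
have [g [g1 g2]] := tr x Lf (extend_mn ad _ hW); exists g; split=> [y|q].
  rewrite comp_assoc chi_unit_nat -comp_assoc g1 !comp_assoc; congr (_ ∘ _).
  by rewrite -chi_unit_natr comp_assoc.
rewrite -g2; congr (lam _); rewrite /Lf extend_in // (comp_assoc (idm (U n) ▶ q)) act_swap.
have -> : idm (tw_hom n) ▶ q = idm (F (R (U n))) ▶ (q : hom (x : M) n) by rewrite /= fmap_id.
by rewrite tw_co -!(comp_assoc _ _ fh) -(comp_assoc (co ad n)).
Qed.

End Key.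

Lemma chi_madj : exists ad3 : madj tw_hom (comp_pm (pull_pm F (free p)) (rra_fun adj adj')),
  forall y, un ad3 y = (adj_unit adj' (U y) ▶ idm p) ∘ e y.
Proof.
have [_ [ad' he] _] := fe.
exists (madj_comp (pull_mf F (free_mf p)) (ra_fun_mf rC adj) (pull_madj F ad') (rra_fun_madj rC adj adj')).
by move=> y; rewrite -he.
Qed.

Lemma chi_act_iso_inv_mn (z : M) : @is_modNat _ C (reg C) (twist F M)
  (comp_pm (pull_pm F (free z)) (rra_fun adj adj'))
  (comp_pm (chi_act adj adj' M) (free (M := twist F M) z))
  (fun c => inv (chi_act_iso adj adj' c z)).
Proof. exact: mn_inv (chi_act_iso_mn rC adj adj' z) (fun c => chi_act_iso_iso rC adj adj' c z). Qed.

Theorem frob_of_trivialization (t : forall y : M, hom (chi RR ▷ y) y) :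
  chi_trivialization adj adj' t ->
  exists e' : forall y, hom y (F (R (U y)) ▷ p),
    @frob_datum _ C (twist F M) n p lam tw_hom tw_madj e'.
Proof.
move=> [tm ti]; have [ad3 h3] := chi_madj.
pose r c := t (F c ▷ p) ∘ inv (chi_act_iso adj adj' c p).
have hr : @is_modIso _ C (reg C) (twist F M) (comp_pm (pull_pm F (free p)) (rra_fun adj adj'))
    (free (M := twist F M) p) r.
  split=> [|c]; last by apply: is_iso_comp; [apply: ti | apply/is_iso_inv/chi_act_iso_iso].
  have h := mn_comp (chi_act_iso_inv_mn p) (mn_whr (free (M := twist F M) p) tm).
  split=> [c d g|c d]; first exact: h.1 c d g.
  by have := h.2 c d; rewrite [LHS]/= comp_idl.
pose ad4 := madj_iso tw_hom_mf ad3 hr.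
exists (un ad4); split; [exact: un_mn ad4 | by exists ad4 | move=> x f hf].
have [g [g1 g2]] := chi_compat hf; exists g; split=> // y.
have tn z z' (h : hom z z') : h ∘ t z = t z' ∘ (idm (chi RR) ▶ h) by have := tm.1 z z' h.
have -> : un ad4 y = t (F (R (U y)) ▷ p) ∘ (chi_unit p y ∘ e y).
  transitivity (r (tw_hom y) ∘ un ad3 y); first by [].
  by rewrite h3 /r /chi_unit !comp_assoc.
have gE : @actm k C (twist F M) _ _ _ _ (idm (tw_hom y)) g = idm (F (R (U y))) ▶ (g : hom (p : M) x) by rewrite /= fmap_id.
pose fy : @hom k M (F (R (U y)) ▷ p) (F (R (U y)) ▷ x) := f y.
have : fy ∘ (t _ ∘ (chi_unit p y ∘ e y)) =
    (idm (F (R (U y))) ▶ (g : hom (p : M) x)) ∘ (t _ ∘ (chi_unit p y ∘ e y)).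
  by rewrite comp_assoc tn -(comp_assoc _ _ (_ ∘ e y)) g1 !comp_assoc tn.
by rewrite gE.
Qed.

End ChiDatum.

Lemma mn_sub (k : fieldType) (C : monCat k) (M N : modCat C) (H K : premodFunctor M N) a b :
  @is_modNat _ _ _ _ H K a -> @is_modNat _ _ _ _ H K b ->
  @is_modNat _ _ _ _ H K (fun m => a m - b m).
Proof.
move=> [an am] [bn bm]; split=> [x y f|c m].
  by rewrite compBr compBl an bn.
rewrite compBr am bm -compBl; congr (_ ∘ _).
by rewrite -!scaleN1r [in RHS]addrC actm_linr addrC.
Qed.

Section DatumKernel.
Variables (k : fieldType) (C : monCat k) (tC : finite_multitensor C) (M : modCat C).
Hypothesis exM : exact_module M.
Variables (n p : M) (lam : {linear hom p n -> k^o}) (pg : proj_gen p).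
Variables (U : premodFunctor M (reg C)) (hU : is_modFunctor U) (ad : madj (free n) U).
Variable e : forall y, hom y (rk1 U p y).
Hypothesis fe : frob_datum lam ad e.

Definition datum_diff y : hom (U y ▷ p) (U (U y ▷ p) ▷ p) :=
  e (U y ▷ p) - (fmap U (e y) ▶ idm p).

Lemma datum_kernel y : is_kernel (e y) (datum_diff y).
Proof.
have [[en _] _ _] := fe; split=> [|w g]; rewrite /datum_diff compBl.
  by have /= <- := en _ _ (e y); rewrite subrr.
move/subr0_eq => h; have [h' hh] := datum_cobar tC exM pg hU fe h.
exists h'; split=> // h'' hh''; apply: (datum_unit_mono tC exM pg fe); by rewrite hh hh''.
Qed.

(** The constraint moves the target into rank-one form, as the last clause of a datum requires. *)
Lemma datum_diff_mn : @is_modNat _ _ _ _ (rk1 U p) (rk1 U (U p ▷ p))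
  (fun y => pm_str (rk1 U p) (U y) p ∘ datum_diff y).
Proof.
have [[en em] _ _] := fe; have hW := rk1_mf hU p.
have h1 := rk1_mn U (e p).
have h2 := mn_idr (mn_whl (mf_str_nat hW) (conj en em)).
have h3 := mn_assocl (mn_whr U (str_mn p hW)).
apply: mn_ext (mn_sub h1 (mn_comp h2 h3)) => y.
by rewrite /datum_diff compBr em comp_idr.
Qed.

End DatumKernel.

Section Compare.
Variables (k : fieldType) (M N : linCat k) (U : functor M N).

Lemma adj_compare_id (V W : functor N M) (a : adjunction U V) (b : adjunction U W) c :
  (fmap V (adj_counit b c) ∘ adj_unit a (W c)) ∘ (fmap W (adj_counit a c) ∘ adj_unit b (V c))
  = idm (V c).
Proof.
rewrite -comp_assoc (comp_assoc (adj_unit a _)) -adj_unit_nat -(comp_assoc _ (adj_unit a _)).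
rewrite -adj_unit_nat !comp_assoc -!fmap_comp -adj_counit_nat -comp_assoc adj_triL comp_idr.
exact: adj_triR.
Qed.

Lemma adj_compare_iso (V W : functor N M) (a : adjunction U V) (b : adjunction U W) c :
  is_iso (fmap W (adj_counit a c) ∘ adj_unit b (V c)).
Proof.
by exists (fmap V (adj_counit b c) ∘ adj_unit a (W c)); split; apply: adj_compare_id.
Qed.

End Compare.

(** Left exactness makes [fmap G i] a kernel too, and the inverses at [y] and [z] induce one on
    kernels. *)
Lemma iso_on_kernel (k : fieldType) (A : linCat k) (G : functor A A)
    (t : forall x, hom x (G x)) x y z (i : hom x y) (d : hom y z) : left_exact G ->
  (forall x y (f : hom x y), fmap G f ∘ t x = t y ∘ f) ->
  is_kernel i d -> is_iso (t y) -> is_iso (t z) -> is_iso (t x).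
Proof.
move=> lG tn ki iy iz; have kG := lG _ _ _ _ _ ki; have iG := kernel_mono kG.
have [di kd] := ki; have [|s [es _]] := kd _ (inv (t y) ∘ fmap G i).
  apply: (iso_mono iz); rewrite comp0r !comp_assoc -tn -(comp_assoc _ (t y)) invR // comp_idr.
  exact: kG.1.
exists s; split.
  by apply: (kernel_mono ki); rewrite comp_assoc es -comp_assoc tn invK // comp_idr.
by apply: iG; rewrite comp_assoc tn -comp_assoc es invKV // comp_idr.
Qed.

Lemma chi_act_str_nat (k : fieldType) (C D : monCat k) (F : monFunctor C D) (R : functor D C)
    (adj : adjunction F R) (RR : functor C D) (adj' : adjunction R RR) (M : modCat D) :
  str_nat (chi_act adj adj' M).
Proof.
move=> c m m' g /=; rewrite fmap_id -comp_assoc inv_massoc_nat !comp_assoc.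
rewrite tensm_id -(comp_assoc (massoc _ _ _)) -act_swap comp_assoc; congr (_ ∘ _ ∘ _).
exact: massoc_natr.
Qed.

(** * From a twisted datum to a trivialization *)

Section Converse.
Variables (k : fieldType) (C D : monCat k) (F : monFunctor C D).
Hypotheses (tC : finite_multitensor C) (rD : is_rigid D).
Variables (R : functor D C) (adj : adjunction F R).
Variables (RR : functor C D) (adj' : adjunction R RR).
Variables (M : modCat D) (n p : M) (lam : {linear hom p n -> k^o}).
Hypotheses (exT : exact_module (twist F M)) (nak : nakayama lam) (pg : proj_gen p).
Variables (U : premodFunctor M (reg D)) (hU : is_modFunctor U) (ad : madj (free n) U).
Variable e : forall y, hom y (rk1 U p y).
Hypothesis fe : frob_datum lam ad e.
Let rC := tC.2.
Let W := tw_hom adj U.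
Variable e' : forall y : M, hom y (F (R (U y)) ▷ p).
Hypothesis fe' : @frob_datum _ C (twist F M) n p lam W (tw_madj rC adj ad) e'.

Let hW : is_modFunctor W := tw_hom_mf rC adj hU.
Let e5 y := chi_unit adj adj' U p y ∘ e y.
Let d y : hom (F (R (U y)) ▷ p) (F (R (U (F (R (U y)) ▷ p))) ▷ p) :=
  @datum_diff _ C (twist F M) p W e' y.

(** By [chi_compat] the difference map acts on [e5] through some [g : p -> M]-object. As the
    difference kills [e'], [datum_kill] makes all pairings of [g] vanish, so [g] is zero. *)
Lemma chi_diff y : (idm (chi RR) ▶ d y) ∘ e5 y = 0.
Proof.
have hf := datum_diff_mn hW fe'.
have [g [g1 g2]] := chi_compat rC adj' hU fe hf.
have kr := datum_kernel tC exT pg hW fe'.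
have g0 : g = 0.
  apply: (lam_inj nak) => q; rewrite -g2 comp0r linear0.
  pose v := extend (tw_madj rC adj ad) (K := id_pm (twist F M)) q.
  have hv : is_modNat v by apply: extend_mn; apply: mf_ax (id_mf _).
  have := datum_kill fe' hf _ hv; rewrite /v extend_id -!comp_assoc; apply.
  by move=> z; rewrite -comp_assoc (kr z).1 comp0r.
have [si _ _ _] := rk1_mf hW p.
have iS : is_iso (idm (chi RR) ▶ (pm_str (rk1 W p) (W y) p : @hom k M _ _)).
  exact/iso_actr/si.
apply: (iso_mono iS); rewrite comp_assoc -act_compr comp0r g1 g0.
by rewrite !act0r comp0l.
Qed.

Let chi_lex : left_exact (act_by M (chi RR)) := (act_by_exact rD M (chi RR)).1.

Lemma chi_factor_ex y : exists s : hom y (chi RR ▷ y), (idm (chi RR) ▶ e' y) ∘ s = e5 y.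
Proof.
have kr := datum_kernel tC exT pg hW fe' y.
have [_ kd] := chi_lex (kr : @is_kernel k M _ _ _ (e' y) (d y)).
by have [s [hs _]] := kd _ _ (chi_diff y); exists s.
Qed.

Let s y := projT1 (cid (chi_factor_ex y)).
Let sE y : (idm (chi RR) ▶ e' y) ∘ s y = e5 y.
Proof. by rewrite /s; case: cid. Qed.

(** Compatibility is checked after the mono [χ ▷ e'], where the section becomes [e5], a composite of
    module transformations. *)
Lemma chi_section_mn : @is_modNat _ _ _ _ (id_pm (twist F M)) (chi_act adj adj' M) s.
Proof.
have [em [ad' he'] _] := fe'; have kr := datum_kernel tC exT pg hW fe'.
have [ad3 h3] := chi_madj rC adj adj' fe.
have h1 := mn_idr (mn_whl (@chi_act_str_nat _ _ _ _ _ adj _ adj' M) em).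
have h2 := mn_comp (un_mn ad3) (mn_whr W (chi_act_iso_inv_mn rC adj adj' p)).
have em' y : is_mono (e' y : @hom k M _ _) := kernel_mono (kr y).
have abM : is_abelian M by case: exT => -[[]].
have ma c m : is_mono (e' m : @hom k M _ _) -> is_mono (idm c ▶ e' m : @hom k M _ _).
  exact: (left_exact_mono (F := act_by M c) abM (act_by_exact rD M c).1).
apply: (mn_lift _ _ _ h1 (mn_assocr h2)) => [m|c m|m].
- exact/ma/em'.
- rewrite /= fmap_id; apply: (left_exact_mono (F := act_by M _) abM (act_by_exact rD M _).1).
  exact/ma/em'.
- by rewrite sE h3 /e5 /chi_unit -comp_assoc.
Qed.

(** At [F c ▷ p] the section is, up to [chi_act_iso], the canonical comparison between two right
    adjoints of [R U], namely [F (-) ▷ p] from [e'] and [RR (-) ▷ p] from [e]. *)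
Lemma chi_section_iso_free c : is_iso (s (F c ▷ p)).
Proof.
have [_ [ad' he'] _] := fe'; have [ad3 h3] := chi_madj rC adj adj' fe.
have iT b := chi_act_iso_iso rC adj adj' b p.
have sn y z (g : @hom k M y z) : (idm (chi RR) ▶ g) ∘ s y = s z ∘ g := chi_section_mn.1 y z g.
have ts : chi_act_iso adj adj' c p ∘ s (F c ▷ p) =
    (fmap RR (co ad' c) ▶ idm p) ∘ un ad3 (F c ▷ p).
  have e1 : un ad3 (F c ▷ p) = chi_act_iso adj adj' _ p ∘ (s _ ∘ e' (F c ▷ p)).
    by rewrite h3 -sn sE /e5 /chi_unit -comp_assoc invKV.
  have e2 : (fmap F (co ad' c) ▶ idm p) ∘ e' (F c ▷ p) = idm (F c ▷ p).
    by rewrite -he'; have := triR ad' c.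
  have e3 := chi_act_iso_natl rC adj adj' (co ad' c) p.
  rewrite -[s (F c ▷ p)]comp_idr -e2 (comp_assoc (s _)) -(sn _ _ (fmap F (co ad' c) ▶ idm p)) e1.
  by rewrite !comp_assoc; congr (_ ∘ _ ∘ _); rewrite -[RHS]comp_assoc; exact: e3.
have h : is_iso ((fmap RR (co ad' c) ▶ idm p) ∘ un ad3 (F c ▷ p)) := 
  adj_compare_iso (madj_adj ad') (madj_adj ad3) c.
rewrite -ts in h; rewrite -(invK (s _) (iT c)).
by apply: is_iso_comp h; apply: is_iso_inv.
Qed.

Theorem trivialization_of_frob : Frobenius_wrt adj adj' M.
Proof.
(* Every object is the kernel of a map between objects of the form [F c ▷ p]. *)
have i y : is_iso (s y).
  apply: (iso_on_kernel (G := act_by M (chi RR)) chi_lex).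
  - exact: chi_section_mn.1.
  - exact: (datum_kernel tC exT pg hW fe' y).
  - exact: chi_section_iso_free.
  - exact: chi_section_iso_free.
exists (fun y => inv (s y)); split=> [|y]; last exact: is_iso_inv.
exact: mn_inv chi_section_mn i.
Qed.

End Converse.

(** * Tensor Frobenius functors *)

Program Definition adj_transport (k : fieldType) (A B : linCat k) (L R : functor A B)
    (G : functor B A) (adj : adjunction L G) (t : forall x, hom (L x) (R x))
    (tn : is_natural t) (ti : forall x, is_iso (t x)) : adjunction R G :=
  @Adjunction _ _ _ _ _ (fun x => fmap G (t x) ∘ adj_unit adj x)
    (fun y => adj_counit adj y ∘ inv (t (G y))) _ _ _ _.
Next Obligation. by rewrite comp_assoc -fmap_comp tn fmap_comp -comp_assoc adj_unit_nat comp_assoc. Qed.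
Next Obligation.
apply: (iso_epi (ti (G y))); rewrite -!comp_assoc invL // comp_idr tn invK //.
exact: adj_counit_nat.
Qed.
Next Obligation.
apply: (iso_epi (ti x)); rewrite -!comp_assoc tn invK // fmap_comp comp_assoc.
by rewrite -adj_counit_nat -comp_assoc adj_triL comp_idr comp_idl.
Qed.
Next Obligation.
rewrite fmap_comp -comp_assoc (comp_assoc (fmap G (inv _))) -fmap_comp invL //.
by rewrite fmap_id comp_idl adj_triR.
Qed.

Section Mates.
Variables (k : fieldType) (C D : monCat k) (F : monFunctor C D) (rC : is_rigid C).
Variables (R : functor D C) (adj : adjunction F R).
Variables (RR : functor C D) (adj' : adjunction R RR).

Lemma ra_left_nat c d d' (g : hom d d') :
  ra_left adj c d' ∘ (idm c ⊠ fmap R g) = fmap R (idm (F c) ⊠ g) ∘ ra_left adj c d.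
Proof.
rewrite !ra_leftE; have := ra_lax_nat (fun_pm_mf F) (adj : adjunction (fun_pm F) R) (idm c) g.
by rewrite /= fmap_id.
Qed.

Section Left.
Variables (L : functor D C) (adjL : adjunction L F) (t : forall d, hom (L d) (R d)).
Hypotheses (tn : is_natural t) (ti : forall d, is_iso (t d)).
Hypothesis tl : forall c d,
  ra_left adj c d ∘ (idm c ⊠ t d) ∘ la_left adjL c d = t (F c ⊗ d).

Let a := adj_transport adjL tn ti.

(* The comparison [F -> RR] of two right adjoints of [R ≅ L]. *)
Definition mate c : hom (F c) (RR c) := fmap RR (adj_counit a c) ∘ adj_unit adj' (F c).

Lemma mate_iso c : is_iso (mate c).
Proof. exact: (adj_compare_iso a adj'). Qed.

Lemma mate_nat c c' (f : hom c c') : fmap RR f ∘ mate c = mate c' ∘ fmap F f.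
Proof.
by rewrite /mate comp_assoc -fmap_comp adj_counit_nat fmap_comp -comp_assoc
  adj_unit_nat comp_assoc.
Qed.

(** The hypothesis [tl] says that the counit of the transported adjunction [R ⊣ F] respects the left
    actions ([K] below); transposing along [R ⊣ RR] gives the claim. *)
Lemma mate_left c x : rra_left adj adj' c x ∘ (idm (F c) ⊠ mate x) = mate (c ⊗ x) ∘ mu F c x.
Proof.
have iR d := ra_left_iso rC adj c d.
have K : adj_counit a (c ⊗ x) ∘ fmap R (mu F c x) =
    (idm c ⊠ adj_counit a x) ∘ inv (ra_left adj c (F x)).
  have tl' : inv (ra_left adj c (F x)) ∘ t (F c ⊗ F x) = (idm c ⊠ t (F x)) ∘ la_left adjL c (F x).
    by rewrite -tl -(comp_assoc (ra_left _ _ _)) invK.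
  apply: (iso_epi (ti _)); rewrite -comp_assoc tn -[RHS]comp_assoc tl' /=.
  rewrite -!(comp_assoc (adj_counit adjL _)) invK // comp_assoc -tens_compr.
  rewrite -comp_assoc invL // comp_idr /la_left comp_assoc adj_counit_nat -comp_assoc -fmap_comp.
  rewrite comp_assoc mu_nat fmap_id -comp_assoc -tensm_comp comp_idl.
  by rewrite adj_triR tensm_id comp_idr.
rewrite /mate -comp_assoc -adj_unit_nat comp_assoc -fmap_comp K.
rewrite /rra_left -comp_assoc -adj_unit_nat comp_assoc -fmap_comp; congr (fmap RR _ ∘ _).
set g := fmap RR _ ∘ _; have g1 : adj_counit adj' x ∘ fmap R g = adj_counit a x.
  by rewrite /g fmap_comp comp_assoc -adj_counit_nat -comp_assoc adj_triL comp_idr.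
apply: (iso_epi (iR (F x))); rewrite -[RHS]comp_assoc invL // comp_idr -g1 tens_compr.
rewrite -(comp_assoc _ (fmap R _)) -ra_left_nat.
by rewrite -(comp_assoc (_ ⊠ _) (inv _)) invK.
Qed.

End Left.
End Mates.

Section TensorFrobenius.
Variables (k : fieldType) (C D : monCat k) (F : monFunctor C D) (rC : is_rigid C).
Variables (R : functor D C) (adj : adjunction F R).
Variables (RR : functor C D) (adj' : adjunction R RR).
Variables (L : functor D C) (adjL : adjunction L F) (t : forall d, hom (L d) (R d)).
Hypotheses (tn : is_natural t) (ti : forall d, is_iso (t d)).
Hypothesis tl : forall c d,
  ra_left adj c d ∘ (idm c ⊠ t d) ∘ la_left adjL c d = t (F c ⊗ d).
Hypothesis tr : forall d c,
  ra_right adj d c ∘ (t d ⊠ idm c) ∘ la_right adjL d c = t (d ⊗ F c).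

Let y c : hom (F c) (RR c) := mate adj' adjL tn ti c.

Lemma mate_right x c : rra_right adj adj' x c ∘ (y x ⊠ idm (F c)) = y (x ⊗ c) ∘ mu F x c.
Proof.
exact: (@mate_left k (rev C) (rev D) (rev_fun F) (rev_rigid rC) R adj RR adj' L adjL t tn ti
  (fun c d => tr d c) c x).
Qed.

Let z : hom one (chi RR) := y one ∘ eps F.

(** After [rra_left], both sides become [mate] at [c] up to unitors, because [mate] intertwines both
    actions. Hence [z : 1 -> χ] carries the trivial half-braiding to that of [χ]. *)
Lemma chi_braid_unit c : chi_braid adj adj' c ∘ (z ⊠ idm (F c)) =
  (idm (F c) ⊠ z) ∘ inv (runit (F c)) ∘ lunit (F c).
Proof.
have iL := rra_left_iso rC adj adj' c one.
have yn b b' (f : hom b b') : fmap RR f ∘ y b = y b' ∘ fmap F f := mate_nat adj' adjL tn ti f.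
have yl b x : rra_left adj adj' b x ∘ (idm (F b) ⊠ y x) = y (b ⊗ x) ∘ mu F b x :=
  mate_left rC adj' tn ti tl b x.
have r1 := runit_iso (F c); have r2 := runit_iso c.
have el : chi_iso adj adj' c ∘ (z ⊠ idm (F c)) = y c ∘ lunit (F c).
  rewrite /z tens_compl /chi_iso (comp_assoc _ (y one ⊠ _)) -(comp_assoc (fmap RR _)) mate_right.
  by rewrite (comp_assoc (fmap RR _)) yn -(mu_lunit F c) -!comp_assoc.
have er : rra_left adj adj' c one ∘ (idm (F c) ⊠ z) = fmap RR (inv (runit c)) ∘ y c ∘ runit (F c).
  rewrite /z tens_compr (comp_assoc (rra_left _ _ _ _)) yl yn -(mu_runit F c) -!comp_assoc.
  by rewrite (comp_assoc (fmap F _)) -fmap_comp invL // fmap_id comp_idl.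
apply: (iso_mono iL); rewrite (comp_assoc _ (chi_braid _ _ _)) chi_braid_left //.
rewrite -(comp_assoc _ (chi_iso _ _ _)) el.
rewrite !(comp_assoc (rra_left _ _ _ _)) er -(comp_assoc _ (runit _)) invR //.
by rewrite comp_idr comp_assoc.
Qed.

Theorem tensor_Frobenius_wrt (M : modCat D) : Frobenius_wrt adj adj' M.
Proof.
have iz : is_iso z by apply: is_iso_comp; [apply: mate_iso | apply: eps_iso].
pose s (m : M) := (z ▶ idm m) ∘ inv (munit m).
have si m : is_iso (s m).
  by apply: is_iso_comp; [apply: iso_actl | apply/is_iso_inv/munit_iso].
have hs : @is_modNat _ _ _ _ (id_pm (twist F M)) (chi_act adj adj' M) s.
  split=> [m m' f|c m] /=; rewrite /s.
    by rewrite comp_assoc act_swap -!comp_assoc inv_munit_nat.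
  have u := munit_iso; have i1 := massoc_iso; have i2 := lunit_iso; have i3 := runit_iso.
  have n1 := inv_massoc_nat z (idm (F c)) (idm m); rewrite actm_id in n1.
  have n2 : inv (massoc one (F c) m) ∘ inv (munit (F c ▷ (m : M))) = inv (lunit (F c)) ▶ idm (m : M).
    by rewrite -inv_comp // munit_act inv_actl.
  have n3 : massoc (F c) one (m : M) ∘ (inv (runit (F c)) ▶ idm (m : M)) = idm (F c) ▶ inv (munit (m : M)).
    by rewrite -massoc_munit invKV.
  rewrite comp_idr -comp_assoc (comp_assoc (inv _)) n1 -!comp_assoc n2.
  rewrite -!act_compl (comp_assoc (chi_braid _ _ _)) chi_braid_unit -comp_assoc invR //.
  rewrite comp_idr act_compl comp_assoc massoc_nat -comp_assoc n3 fmap_id.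
  by rewrite act_compr.
exists (fun m => inv (s m)); split=> [|m]; last exact: is_iso_inv.
exact: mn_inv hs si.
Qed.

End TensorFrobenius.

(** * Unimodular structures *)

Section DualIso.
Variables (k : fieldType) (C : monCat k) (M : modCat C).
Implicit Types H K : dual M.

Lemma dual_iso_at H K (a : hom H K) : is_iso a -> forall y, is_iso (as_mn a y).
Proof.
move=> [b [e1 e2]] y; exists (as_mn b y); split.
  by have := congr1 (fun c : hom H H => as_mn c y) e1.
by have := congr1 (fun c : hom K K => as_mn c y) e2.
Qed.

Lemma modIso_dual_iso H K a (h : @is_modIso _ _ _ _ (as_mf H) (as_mf K) a) :
  @is_iso _ (dual M) H K (to_hom (K := H) (K' := K) h.1).
Proof.
apply: (modNat_iso (b := to_hom (K := K) (K' := H) (mn_inv h.1 h.2))) => y /=.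
by split; [apply: invL | apply: invR]; apply: h.2.
Qed.

Lemma inverse_of_one H : isomorphic (one : dual M) H ->
  exists I : inverse_ob H, iv_ob I = one.
Proof.
move=> [a ia]; have ib := is_iso_inv ia.
by exists (@InverseOb _ _ H one (inv a ∘ lunit H) (inv a ∘ runit H)
  (is_iso_comp ib (lunit_iso H)) (is_iso_comp ib (runit_iso H))).
Qed.

Hypotheses (tC : finite_multitensor C) (exM : exact_module M).

Lemma unimodular_frob (E : distinguished (dual M)) u (n p : M) (lam : {linear hom p n -> k^o})
    (U : premodFunctor M (reg C)) (ad : madj (free n) U) :
  unimodular_structure (E := E) u -> nakayama lam -> is_modFunctor U ->
  exists e, frob_datum lam ad e.
Proof.
move=> hu nak hU.
have [q uq] := distinguished_universal (fun y => dual_hom_fin_dim exM y one) E.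
have := universal_iso uq (modIso_dual_iso (H := one) (K := E) hu).
exact: universal_frob_datum.
Qed.

Lemma frob_unimodular (n p : M) (lam : {linear hom p n -> k^o})
    (U : premodFunctor M (reg C)) (ad : madj (free n) U) e :
  nakayama lam -> proj_gen p -> is_modFunctor U -> frob_datum lam ad e ->
  exists E : distinguished (dual M), exists u, unimodular_structure (E := E) u.
Proof.
move=> nak pg hU fe; have [E eE] := datum_distinguished tC exM nak pg hU fe.
exists E; rewrite /unimodular_structure; case: _ / (esym eE).
by exists (fun m => idm m); split=> [|m]; [apply: mn_id | apply: is_iso_id].
Qed.

End DualIso.

Section Comparison.
Variables (k : fieldType) (C D : monCat k) (F : monFunctor C D).
Variables (R : functor D C) (adj : adjunction F R).
Variables (RR : functor C D) (adj' : adjunction R RR) (M : modCat D).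
Variable t : forall m : M, hom (chi RR ▷ m) m.
Hypothesis ht : chi_trivialization adj adj' t.

Lemma trivial_comparison :
  @is_modIso _ _ _ _ (comp_pm (chi_act adj adj' M) (pull F (id_mf M))) (id_mf (twist F M)) t.
Proof.
have [[tn tm] ti] := ht; split=> //; split=> [x y f|c m]; first exact: tn.
by have := tm c m; rewrite [in X in _ -> X]/= actm_id comp_idr.
Qed.

Variables (E : distinguished (dual M)) (E' : distinguished (dual (twist F M))).
Variables (I : inverse_ob (do_ob E)) (I' : inverse_ob (do_ob E')).
Variable phi : forall m : M, hom (chi RR ▷ as_mf (iv_ob I) m) (as_mf (iv_ob I') m).
Hypothesis hphi : modular_comparison adj adj' phi.

Lemma inv_comparison_iso : @is_modIso _ _ _ _ (pull F (as_mf (iv_ob I))) (as_mf (iv_ob I'))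
  (inv_comparison phi t).
Proof.
have [tm ti] := ht; have [pm pi] := hphi; split=> [|m]; last first.
  exact: is_iso_comp (pi m) (is_iso_inv (ti _)).
exact: mn_idl (mn_comp (mn_whr (pull F (as_mf (iv_ob I))) (mn_inv tm ti)) pm).
Qed.

Lemma comparison_iso :
  @is_modIso _ _ _ _ (pull F (as_mf E)) (as_mf E') (comparison phi t).
Proof.
have [im ii] := inv_comparison_iso.
have il := dual_iso_at (iv_l_iso I'); have ir := dual_iso_at (iv_r_iso I).
split=> [|m]; last first.
  apply: is_iso_comp; last exact/is_iso_fmap/is_iso_inv/il.
  by apply: is_iso_comp; [apply: ir | apply/is_iso_fmap/is_iso_inv/ii].
have sE := mf_str_nat (pull_mf F (mf_ax (as_mf E))).
have hl : @is_modNat _ C (twist F M) (twist F M) (comp_pm (as_mf (iv_ob I')) (as_mf E'))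
  (id_pm _) (as_mn (iv_l I')) := mn_ax (as_mn (iv_l I')).
have hr : @is_modNat _ C (twist F M) (twist F M)
  (comp_pm (pull_pm F (as_mf E)) (pull_pm F (as_mf (iv_ob I)))) (id_pm _) (as_mn (iv_r I)).
  have [hn hm] := pull_mn F (mn_ax (as_mn (iv_r I))).
  by split=> [x y f|c m]; [exact: (hn x y f) | exact: (hm c m)].
have h1 := mn_idr (mn_whl sE (mn_inv hl il)).
have h2 := mn_whl sE (mn_whr (as_mf E') (mn_inv im ii)).
have h3 := mn_assocl (mn_whr (as_mf E') hr).
have [hn hm] := mn_comp h1 (mn_comp h2 h3); rewrite /comparison.
split=> [x y f|c m]; first exact: hn.
by have := hm c m; rewrite /= comp_idl !comp_assoc.
Qed.

Lemma comparison_unimodular u : unimodular_structure (E := E) u ->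
  unimodular_structure (E := E') (fun m : M => comparison phi t m ∘ u m).
Proof.
move=> [um ui]; have [cm ci] := comparison_iso; split=> [|m].
  exact: mn_comp (pull_mn F um) cm.
exact: is_iso_comp (ci m) (ui m).
Qed.

End Comparison.

Unset Implicit Arguments.

Theorem proposition4p21 (k : closedFieldType) (C D : monCat k)
    (hC : finite_tensor C) (hD : finite_tensor D)
    (F : monFunctor C D) (hF : is_exact F)
    (Fra : functor D C) (adj : adjunction F Fra)
    (Frra : functor C D) (adj' : adjunction Fra Frra)
    (perfect_F : is_exact Fra)
    (M : modCat D) (hM : exact_module M)
    (E : distinguished (dual M)) (u : forall m : M, hom m (as_mf (do_ob E) m))
    (hu : unimodular_structure u) :
  (unimodular (twist F M) <-> Frobenius_wrt adj adj' M) /\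
  (Frobenius_wrt adj adj' M ->
     (exists (E' : distinguished (dual (twist F M)))
             (I : inverse_ob (do_ob E)) (I' : inverse_ob (do_ob E'))
             (phi : forall m : M,
               hom (chi Frra ▷ as_mf (iv_ob I) m) (as_mf (iv_ob I') m)),
        modular_comparison adj adj' phi) /\
     (forall (E' : distinguished (dual (twist F M)))
             (I : inverse_ob (do_ob E)) (I' : inverse_ob (do_ob E'))
             (phi : forall m : M,
               hom (chi Frra ▷ as_mf (iv_ob I) m) (as_mf (iv_ob I') m))
             (t : forall m : M, hom (chi Frra ▷ m) m),
        modular_comparison adj adj' phi ->
        chi_trivialization adj adj' t ->
        unimodular_structure (E := E') (fun m : M => comparison phi t m ∘ u m))) /\
  (tensor_Frobenius adj -> unimodular (twist F M)).
Proof.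
have [[tC _] [tD _]] := (hC, hD); pose rC := tC.2.
have exT : exact_module (twist F M).
  apply: twist_exact => //; last by case: tD => -[].
  by exists Fra; split; [case: perfect_F | constructor].
have [p pg] := proj_gen_ex (let: And3 h _ _ := hM.1 in h).
have [n [lam nak]] := nakayama_ex (let: And3 h _ _ := hM.1 in h) pg.1.
have [U [hU [ad]]] := inner_hom_ex tD n hM.1.
have [e fe] := unimodular_frob tD hM ad hu nak hU.
have frob_uni : Frobenius_wrt adj adj' M -> exists E' : distinguished (dual (twist F M)),
    exists u', unimodular_structure (E := E') u'.
  move=> [t /(frob_of_trivialization rC hU fe) [e' fe']].
  exact: (frob_unimodular tC exT nak pg (tw_hom_mf rC adj hU) fe').
have uniP : unimodular (twist F M) <-> Frobenius_wrt adj adj' M.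
  split=> [[_ [E' [u' hu']]]|/frob_uni //].
  have [e' fe'] := unimodular_frob tC exT (tw_madj rC adj ad) hu' nak (tw_hom_mf rC adj hU).
  exact: (trivialization_of_frob (tC := tC) tD.2 adj' exT nak pg hU fe fe').
split=> //; split; last first.
  move=> [L [adjL [t [tn ti tl tr]]]]; apply/uniP.
  exact: (tensor_Frobenius_wrt rC adj' tn ti tl tr).
move=> fr; split=> [|E' I I' phi t hphi ht]; last first.
  exact: (comparison_unimodular ht hphi hu).
have [E' [u' hu']] := frob_uni fr; have [t ht] := fr.
(* Both distinguished objects are isomorphic to the unit, so their inverses may be taken to be the
   unit itself; a trivialization [t] of [χ ▷ -] is then a comparison. *)
have [I eI] : exists I : inverse_ob (do_ob E), iv_ob I = one.
  by apply: inverse_of_one; exists (to_hom hu.1); apply: modIso_dual_iso.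
have [I' eI'] : exists I : inverse_ob (do_ob E'), iv_ob I = one.
  by apply: inverse_of_one; exists (to_hom hu'.1); apply: modIso_dual_iso.
exists E', I, I'; rewrite /modular_comparison eI eI'.
by exists t; apply: trivial_comparison.
Qed.
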